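(* Let $\mathcal{X}_j = [m_j]$ with $m_j \in \mathbb{N}$ for $j \in [d]$. Let $D_R > 0$, $F' \in \mathbb{N}_0$ and $f_{\mathbb{S}}^{(1),'},\ldots,f_{\mathbb{S}}^{(F'),'} \in \mathcal{G}_{\mathbb{S}}^+$, all taking values in $[-1,|\mathbb{S}|-1]$, be such that \[ \max_{\ell \in [F']} R(P_{\mathbb{S}}, f_{\mathbb{S}}^{(\ell),'})_+ \leq R(P_{\mathbb{S}}) \leq D_R \max_{\ell \in [F']} R(P_{\mathbb{S}}, f_{\mathbb{S}}^{(\ell),'})_+ \quad \text{for all } P_{\mathbb{S}} \in \mathcal{P}_{\mathbb{S}}^{\mathrm{cons}}. \] Fix $\alpha,\beta \in (0,1)$. Whenever $P_{\mathbb{S}} = (P_S : S \in \mathbb{S}) \in \mathcal{P}_{\mathbb{S}}^0$, we have $\mathbb{P}_{P_{\mathbb{S}}}\bigl(R(\widehat{P}_{\mathbb{S}}) \geq C_\alpha'\bigr) \leq \alpha$. Moreover, there exists $M > 0$, depending only on $|\mathbb{S}|$ and $D_R$, such that for any $P_{\mathbb{S}} \in \mathcal{P}_{\mathbb{S}}$ satisfying \[ R(P_{\mathbb{S}}) \geq M(C_\alpha' + C_\beta'), \] we have $\mathbb{P}_{P_{\mathbb{S}}}\bigl(R(\widehat{P}_{\mathbb{S}}) \geq C_\alpha'\bigr) \geq 1-\beta$.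
   Context: Let $d \in \mathbb{N}$, $[m] := \{1,\ldots,m\}$, $[0] := \emptyset$, $\mathcal{X}_S := \prod_{j \in S}\mathcal{X}_j$ for $S \subseteq [d]$, $\mathcal{X} := \mathcal{X}_{[d]}$, $x_S := (x_j : j\in S)$, $y_+ := \max(y,0)$, $a \wedge b := \min(a,b)$, $a \vee b := \max(a,b)$, and let $\mathbb{S}$ be a collection of subsets of $[d]$. A maximum $\max_{\ell \in [0]} R(P_{\mathbb{S}},\cdot)_+$ is interpreted as $0$. $\mathcal{P}_{\mathbb{S}}$ is the set of sequences $P_{\mathbb{S}} = (P_S : S \in \mathbb{S})$ with $P_S$ a probability distribution on $\mathcal{X}_S$. $\mathcal{P}_{\mathbb{S}}^0 \subseteq \mathcal{P}_{\mathbb{S}}$ is the subset of compatible sequences: those for which there is a distribution on $\mathcal{X}$ with marginal $P_S$ on $\mathcal{X}_S$ for every $S \in \mathbb{S}$. $\mathcal{P}_{\mathbb{S}}^{\mathrm{cons}} \subseteq \mathcal{P}_{\mathbb{S}}$ is the subset of consistent sequences: those for which, whenever $S_1,S_2 \in \mathbb{S}$ have $S_1 \cap S_2 \neq \emptyset$, the marginals of $P_{S_1}$ and $P_{S_2}$ on $\mathcal{X}_{S_1 \cap S_2}$ agree. Data: for given $n_S \in \mathbb{N}$, $S \in \mathbb{S}$, we observe independent random variables $(X_{S,i})_{S \in \mathbb{S}, i \in [n_S]}$ with $X_{S,i} \sim P_S$; $\mathbb{P}_{P_{\mathbb{S}}}$ denotes probability under this model. $\widehat{P}_S$ is the empirical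 distribution of $X_{S,1},\ldots,X_{S,n_S}$ and $\widehat{P}_{\mathbb{S}} := (\widehat{P}_S : S \in \mathbb{S})$. Incompatibility index (discrete case): let $\mathcal{G}_{\mathbb{S}}^+$ be the set of sequences $f_{\mathbb{S}} = (f_S : S \in \mathbb{S})$ of functions $f_S : \mathcal{X}_S \to [-1,\infty)$ with $\min_{x \in \mathcal{X}} \sum_{S \in \mathbb{S}} f_S(x_S) \geq 0$. Then $R(P_{\mathbb{S}}) := \sup_{f_{\mathbb{S}} \in \mathcal{G}_{\mathbb{S}}^+} R(P_{\mathbb{S}},f_{\mathbb{S}})$ with $R(P_{\mathbb{S}},f_{\mathbb{S}}) := -\frac{1}{|\mathbb{S}|}\sum_{S \in \mathbb{S}} \sum_{x_S \in \mathcal{X}_S} f_S(x_S) P_S(\{x_S\})$. Critical value: for $\alpha \in (0,1)$, and with $D_R$, $F'$ as in the claim, \[ C_\alpha' := |\mathbb{S}| \max \Biggl\{ \frac{2D_R^2 \log\bigl( \frac{2F'|\mathbb{S}|}{\alpha} \vee 1\bigr)}{ \min_{S \in \mathbb{S}} n_S},\; 2^{2|\mathbb{S}|+7} \max_{\substack{S_1,S_2 \in \mathbb{S}:\\ S_1 \neq S_2,\, S_1 \cap S_2 \neq \emptyset}} \frac{|\mathcal{X}_{S_1 \cap S_2}|\log 2 + \log\bigl(\frac{2|\mathbb{S}|(|\mathbb{S}|-1)}{\alpha}\bigr)}{n_{S_1} \wedge n_{S_2}} \Biggr\}^{1/2}, \] and $C_\beta'$ is defined in the same way with $\beta$ in place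 of $\alpha$.
   Formalization: The maximum over intersecting pairs in C'_α is taken as 0 when there is no such pair, and the size bound is claimed only if F' ≥ 1 or two distinct sets of 𝕊 intersect; otherwise C'_α = 0, the rejection event is certain and the bound fails. *)

(* Defs.v *)
(* MathComp / MathComp-Analysis. *)
From mathcomp Require Import all_boot all_order all_algebra.
From mathcomp Require Import all_classical all_reals all_analysis.

Set Implicit Arguments.
Unset Strict Implicit.
Unset Printing Implicit Defensive.

Import Order.TTheory GRing.Theory Num.Theory.

Local Open Scope ring_scope.

(* A family indexed by the sets S in SS is represented by a family indexed by
   all S : {set 'I_d}; its values at S \notin SS are never used.
   The alphabet [m_j] is 'I_(m j). *)
Section Incompatibility.

Context {R : realType} {d : nat} {m : 'I_d -> nat}.
Implicit Types (A B S : {set 'I_d}) (SS : {set {set 'I_d}}).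

Definition coords S : finType :=
  {dffun forall j : {j : 'I_d | j \in S}, 'I_(m (val j))}.

Definition incl_coord A B (sAB : A \subset B) (j : {j : 'I_d | j \in A}) :
  {j : 'I_d | j \in B} := exist _ (val j) (fintype.subsetP sAB _ (valP j)).

Definition restr A B (sAB : A \subset B) (x : coords B) : coords A :=
  [ffun j : {j : 'I_d | j \in A} => x (incl_coord sAB j)].

Definition pmf (T : finType) (p : T -> R) : Prop :=
  (forall x, 0 <= p x) /\ \sum_(x : T) p x = 1.

Definition marginal A B (sAB : A \subset B) (p : coords B -> R) :
  coords A -> R := fun x => \sum_(y : coords B | restr sAB y == x) p y.

Definition fun_family := forall S, coords S -> R.

Definition distributions SS (P : fun_family) : Prop :=
  forall S, S \in SS -> pmf (P S).

Definition compatible SS (P : fun_family) : Prop :=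
  distributions SS P /\
  exists2 Q : coords [set: 'I_d]%SET -> R, pmf Q &
    forall S, S \in SS -> forall x, P S x = marginal (finset.subsetT S) Q x.

Definition consistent SS (P : fun_family) : Prop :=
  distributions SS P /\
  forall S1 S2, S1 \in SS -> S2 \in SS -> S1 :&: S2 != finset.set0 ->
    forall x, marginal (finset.subsetIl S1 S2) (P S1) x
              = marginal (finset.subsetIr S1 S2) (P S2) x.

Definition Gplus SS (f : fun_family) : Prop :=
  (forall S, S \in SS -> forall x, -1 <= f S x) /\
  (forall x : coords [set: 'I_d]%SET,
     0 <= \sum_(S in SS) f S (restr (finset.subsetT S) x)).

Definition Rdual SS (P f : fun_family) : R :=
  - (#|SS|%:R^-1 * \sum_(S in SS) \sum_(x : coords S) f S x * P S x).

Definition Rindex SS (P : fun_family) : R :=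
  sup [set Rdual SS P f | f in Gplus SS].

(* The base value 0 of the big maximum is the convention for F = 0, and is
   harmless otherwise because positive parts are nonnegative. *)
Definition max_Rdual_pos SS (P : fun_family) (F : nat) (f : 'I_F -> fun_family) : R :=
  \big[Num.max/0]_(l < F) Num.max (Rdual SS P (f l)) 0.

Section Sampling.

Variable n : {set 'I_d} -> nat.

Definition empirical (data : forall S, 'I_(n S) -> coords S) : fun_family :=
  fun S x => (#|[pred i | data S i == x]|)%:R / (n S)%:R.

(* (X S i), for S in SS and i < n S, are mutually independent random variables
   with X S i distributed as P S. The target alphabets are finite, with all
   their subsets measurable. *)
Definition independent_samples SS (P : fun_family) (disp : measure_display)
    (Omega : measurableType disp) (Pr : probability Omega R)
    (X : forall S, 'I_(n S) -> Omega -> coords S) : Prop :=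
  [/\ forall S i, S \in SS -> forall E : {set coords S},
        measurable [set w | X S i w \in E]%classic,
      forall S i, S \in SS -> forall x, Pr [set w | X S i w = x]%classic = (P S x)%:E &
      forall (J : {set {S : {set 'I_d} & 'I_(n S)}})
             (E : forall k : {S : {set 'I_d} & 'I_(n S)}, {set coords (tag k)}),
        (forall k, k \in J -> tag k \in SS) ->
        Pr [set w | forall k, k \in J -> X (tag k) (tagged k) w \in E k]%classic
        = (\prod_(k in J) Pr [set w | X (tag k) (tagged k) w \in E k]%classic)%E].

(* The base value is the maximum only so that it never falls below the
   minimum: for SS nonempty this is the minimum of n S over S in SS. *)
Definition min_size SS : nat :=
  (\big[minn/(\max_(S in SS) n S)]_(S in SS) n S)%N.

(* The inner quotients are nonnegative for a in ]0, 1[, so the base values 0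
   only matter when there is no pair of distinct intersecting sets; the
   pairwise term is then absent. *)
Definition critical_value SS (D : R) (F : nat) (a : R) : R :=
  #|SS|%:R * Num.sqrt (Num.max
    (2 * D ^+ 2 * ln (Num.max (2 * F%:R * #|SS|%:R / a) 1)
       / (min_size SS)%:R)
    (2 ^+ (2 * #|SS| + 7) *
       \big[Num.max/0]_(S1 in SS)
        \big[Num.max/0]_(S2 in SS | (S1 != S2) && (S1 :&: S2 != finset.set0))
          ((#|coords (S1 :&: S2)|%:R * ln 2
              + ln (2 * #|SS|%:R * (#|SS|%:R - 1) / a))
            / (minn (n S1) (n S2))%:R))).

End Sampling.

End Incompatibility.

Arguments coords {d} m S.
Arguments fun_family R {d} m.
Arguments critical_value {R d} m n SS D F a.

Definition has_overlap (d : nat) (SS : {set {set 'I_d}}) : Prop :=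
  exists S1 S2, [/\ S1 \in SS, S2 \in SS, S1 != S2 & S1 :&: S2 != finset.set0].

(* Main.v *)
Require Import Defs.
From mathcomp Require Import all_boot all_order all_algebra.
From mathcomp Require Import all_classical all_reals all_analysis.
From mathcomp Require Import ring lra zify.

(** The empirical index is a function of independent observations, and the
    sample takes finitely many values, so that everything takes place on a
    finite product space (prob_embedded_data). A measure on the coordinates in S
    is represented by a measure on the whole space whose coordinates outside S
    are frozen at a point x0. Taking marginals then means applying projections
    pf x0 T, and these commute.

    Size. An observation of S changes the index by at most 1 / n S, and by
    nothing when S meets no other pattern (emp_index_bounded_diff). By
    McDiarmid's inequality it suffices to bound the mean of the index
    (mean_emp_index_le), where all observations may be taken from one law Q, by
    compatibility. The assumption on the functions f l speaks of consistent
    families only, and the empirical family is not consistent. It is replaced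
    by a signed family, target, that has mass one and exactly the marginals of Q
    on all intersections. A signed consistent family becomes a consistent family
    of distributions when one measure, common to all patterns, is added; its mass
    is at most the L1 distance to the empirical family, and a common measure
    never increases a dual value (Rindex_le_signed).

    The marginals of the deviation empS S - Q on all intersections can be removed
    by the product of the commuting maps 1 - pf x0 (S :&: S'), but this
    may multiply sup norms by 2 ^ (s - 1), s being the number of patterns, and
    such a factor is not affordable in the first term of the critical value.
    Hence most of the deviation of these marginals is removed differently. Each
    cell count is rounded to a multiple of a fraction of its standard deviation,
    and the conditional expectation of the deviation given the rounded counts is
    subtracted. This conditional expectation is small in L1 norm, because the
    rounded counts carry little information: a union bound over their values,
    weighted as in the Donsker-Varadhan formula, costs a bounded amount per cell
    (mean_cdev_le). Afterwards the marginals involve only the remainders of the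
    counts, which are small enough to afford the factor 2 ^ (s - 1). Rounding is
    dithered by an independent uniform variable, which makes the remainders
    uniform and independent of the sample (mgf_dithered). The dual values of the
    target are then linear statistics centered at their conditional
    expectations, and the centering costs a factor 2 in the exponent
    (mgf_cmean_centered). Their exponential moments (mgf_target) yield the bound
    on the mean of their maximum over l (mean_max_dual_target_le).

    If no two patterns meet, the index vanishes on all families of distributions
    (Rindex_no_overlap), while the critical value is positive as soon as 0 < F.

    Power. For a fixed dual function f, the empirical index is at least the
    empirical dual value of f, which is an average of independent terms
    (power_of_dual). It remains to find an f with a dual value comparable to the
    index of P. If the marginals of P almost agree on all intersections, a signed
    correction makes them agree exactly (correct_family), and the assumption
    on the functions f l applies after the same passage to nonnegative
    measures. Hence either some f l sees a constant fraction of the index, or the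
    marginals of some pair of patterns differ by such a fraction (Rindex_le_gaps),
    and then the test function of this pair sees it (Rdual_pair_test). *)

Set Implicit Arguments.
Unset Strict Implicit.
Unset Printing Implicit Defensive.

Import Order.TTheory GRing.Theory Num.Theory.
Import numFieldNormedType.Exports.

Local Open Scope ring_scope.

Local Notation pmf := Defs.pmf.

(** * Hoeffding's lemma *)

Section HoeffdingAnalytic.
Context {R : realType}.
Implicit Types p h x y : R.

Lemma deriv_ge0_le (f df : R -> R) :
  (forall x : R, 0 <= x -> is_derive x 1 f (df x)) ->
  (forall x : R, 0 <= x -> 0 <= df x) ->
  forall x : R, 0 <= x -> f 0 <= f x.
Proof.
move=> fd df0 x x0.
have cf : {within `[0, x], continuous f}%classic.
  apply: derivable_within_continuous => y; rewrite in_itv/= => /andP[y0 _].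
  by have [] := fd y y0.
have [y|y] := @MVT_segment R f df 0 x x0 _ cf.
  by rewrite in_itv/= => /andP[/ltW y0 _]; exact: fd.
rewrite in_itv/= => /andP[y0 _] E.
by rewrite -subr_ge0 E mulr_ge0// ?df0// subr0.
Qed.

Let phi p : R -> R := cst (1 - p) + p \*: expR.

Let phi_gt0 p h : 0 <= p <= 1 -> 0 < phi p h.
Proof.
move=> /andP[p0 p1]; rewrite /phi/= /GRing.scale/=.
change (0 < 1 - p + p * expR h).
have := expR_gt0 h; case: (ltrP p 1) => [plt|pge] e0; last first.
  have -> : p = 1 by apply/le_anti; rewrite p1 pge.
  by rewrite subrr add0r mul1r.
by rewrite ltr_pwDl ?subr_gt0// mulr_ge0// ltW.
Qed.

Let phiD p h : is_derive h 1 (phi p) (p * expR h).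
Proof.
by rewrite /phi; apply: is_derive_eq; rewrite add0r.
Qed.

Let G p : R -> R :=
  (4^-1 \*: id + cst p) - (p \*: expR) * (fun h => (phi p h)^-1).

Let G_deriv p h : 0 <= p <= 1 ->
  is_derive h 1 (G p) (1 / 4 - (p * expR h / phi p h) * (1 - p * expR h / phi p h)).
Proof.
move=> p01; have ph := phi_gt0 h p01.
have pn0 : phi p h != 0 by rewrite gt_eqF.
rewrite /G.
have h1 := is_deriveV pn0 (phiD p h).
apply: is_derive_eq.
rewrite /GRing.scale/=; move: (pn0).
set a := expR h; set b := phi p h => bn0.
change (4^-1 * 1 + 0 - ((p * a) * (- (b ^+ 2)^-1 * (p * a)) + b^-1 * (p * a)) =
  1 / 4 - p * a / b * (1 - p * a / b)).
by field.
Qed.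

Let G_ge0 p h : 0 <= p <= 1 -> 0 <= h -> 0 <= G p h.
Proof.
move=> p01 h0.
have G0 : G p 0 = 0.
  have -> : G p 0 = 4^-1 * 0 + p - (p * expR 0) * (1 - p + p * expR 0)^-1 by [].
  by rewrite expR0 mulr1 mulr0 add0r subrK invr1 mulr1 subrr.
rewrite -G0.
apply: (deriv_ge0_le (fun x _ => G_deriv x p01)) => // x _.
set q := p * expR x / phi p x; have := sqr_ge0 (q - 1 / 2); nra.
Qed.

(** F below is the logarithm of the quotient of the two sides. It vanishes at 0
    together with its derivative G, and G has the derivative 1 / 4 - q (1 - q),
    which is the square of q - 1 / 2. *)
Lemma bernoulli_mgf_le p h : 0 <= p <= 1 ->
  1 - p + p * expR h <= expR (p * h + h ^+ 2 / 8).
Proof.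
(* Exchanging the two outcomes of the Bernoulli variable changes the sign of h. *)
wlog h0 : p h / 0 <= h.
  move=> W p01; have [/W|/ltW hle] := lerP 0 h; first exact.
  have q01 : 0 <= 1 - p <= 1 by lra.
  have := W (1 - p) (- h); rewrite oppr_ge0 => /(_ hle q01).
  rewrite -(ler_pM2l (expR_gt0 h)) -expRD.
  have -> : h + ((1 - p) * - h + (- h) ^+ 2 / 8) = p * h + h ^+ 2 / 8 by field.
  by rewrite mulrDr mulrCA -expRD subrr expR0 => H; apply: le_trans H; lra.
move=> p01.
pose F : R -> R := (8^-1 \*: (id * id) + p \*: id) - (@ln R \o phi p).
have FD x : is_derive x 1 F (G p x).
  have h1 := is_derive1_comp (is_derive1_ln (phi_gt0 x p01)) (phiD p x).
  rewrite /F; apply: is_derive_eq; rewrite /GRing.scale/= !mulr1.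
  change (8^-1 * (x + x) + p - (phi p x)^-1 * (p * expR x) =
    4^-1 * x + p - (p * expR x) * (phi p x)^-1).
  by field; rewrite gt_eqF// phi_gt0.
have F0 : F 0 = 0.
  have -> : F 0 = 8^-1 * (0 * 0) + p * 0 - ln (1 - p + p * expR 0) by [].
  by rewrite expR0 mulr1 subrK ln1 !mulr0 !addr0 subr0.
have : 0 <= F h.
  by rewrite -F0; apply: (deriv_ge0_le (fun x _ => FD x)) => // x; exact: G_ge0.
have -> : F h = 8^-1 * (h * h) + p * h - ln (1 - p + p * expR h) by [].
rewrite subr_ge0 -ler_expR lnK ?posrE; last exact: phi_gt0.
by move=> /le_trans; apply; rewrite ler_expR expr2; lra.
Qed.

End HoeffdingAnalytic.

Section FiniteExpectation.
Context {R : realType}.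
Implicit Types (T : finType).

Definition mean T (p : T -> R) (g : T -> R) : R := \sum_t p t * g t.

Lemma mean_ge0 T (p g : T -> R) : (forall t, 0 <= p t) -> (forall t, 0 <= g t) ->
  0 <= mean p g.
Proof. by move=> p0 g0; apply: sumr_ge0 => t _; exact: mulr_ge0. Qed.

Lemma ler_mean T (p g h : T -> R) : pmf p ->
  (forall t, 0 < p t -> g t <= h t) -> mean p g <= mean p h.
Proof.
move=> [p0 _] gh; apply: ler_sum => t _.
have := p0 t; rewrite le_eqVlt => /predU1P[<-|pt]; first by rewrite !mul0r.
by rewrite ler_pM2l// gh.
Qed.

Lemma eq_mean T (p g h : T -> R) : g =1 h -> mean p g = mean p h.
Proof. by move=> gh; apply: eq_bigr => t _; rewrite gh. Qed.

Lemma mean_cst T (p : T -> R) c : pmf p -> mean p (fun=> c) = c.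
Proof. by move=> [_ p1]; rewrite /mean -mulr_suml p1 mul1r. Qed.

Lemma meanD T (p g h : T -> R) : mean p (fun t => g t + h t) = mean p g + mean p h.
Proof. by rewrite /mean -big_split; apply: eq_bigr => t _; rewrite mulrDr. Qed.

Lemma meanZ T (p g : T -> R) c : mean p (fun t => c * g t) = c * mean p g.
Proof. by rewrite /mean mulr_sumr; apply: eq_bigr => t _; rewrite mulrCA. Qed.

Lemma meanN T (p g : T -> R) : mean p (fun t => - g t) = - mean p g.
Proof. by rewrite /mean -sumrN; apply: eq_bigr => t _; rewrite mulrN. Qed.

Lemma meanB T (p g h : T -> R) : mean p (fun t => g t - h t) = mean p g - mean p h.
Proof. by rewrite meanD meanN. Qed.

Lemma mean_sum T I (r : seq I) (A : pred I) (p : T -> R) (g : I -> T -> R) :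
  mean p (fun t => \sum_(i <- r | A i) g i t) = \sum_(i <- r | A i) mean p (g i).
Proof.
by rewrite /mean exchange_big; apply: eq_bigr => t _; rewrite mulr_sumr.
Qed.

Lemma expR_mean_le T (p g : T -> R) : pmf p ->
  expR (mean p g) <= mean p (fun t => expR (g t)).
Proof.
move=> pp; set mu := mean p g.
have <- : mean p (fun t => expR mu * (1 + (g t - mu))) = expR mu.
  by rewrite meanZ meanD (mean_cst 1 pp) meanB (mean_cst mu pp) subrr addr0 mulr1.
apply: (ler_mean pp) => t _.
have -> : g t = mu + (g t - mu) by rewrite addrC subrK.
by rewrite expRD ler_pM2l ?expR_gt0// [mu + _]addrC subrK expR_ge1Dx.
Qed.

Lemma mean_sqr_le T (p g : T -> R) : pmf p -> (mean p g) ^+ 2 <= mean p (fun t => g t ^+ 2).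
Proof.
move=> pp; set mu := mean p g.
have : 0 <= mean p (fun t => (g t - mu) ^+ 2).
  by apply: mean_ge0 => [|t]; [case: pp|exact: sqr_ge0].
rewrite (eq_mean _ (h := fun t => g t ^+ 2 + (- (2 * mu) * g t + mu ^+ 2))); last first.
  by move=> t; ring.
rewrite !meanD meanZ (mean_cst _ pp) -/mu; lra.
Qed.

(** Convexity bounds the exponential by its chord on the range of g, which
    reduces the claim to a two-point distribution. *)
Lemma hoeffding_lemma T (p g : T -> R) (a c th : R) : pmf p ->
  (forall t, 0 < p t -> a <= g t <= a + c) ->
  mean p (fun t => expR (th * (g t - mean p g))) <= expR (th ^+ 2 * c ^+ 2 / 8).
Proof.
move=> pp gac; set mu := mean p g.
have amu : a <= mu <= a + c.
  rewrite -[X in X <= _](mean_cst a pp) -[X in _ <= _ <= X](mean_cst (a + c) pp).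
  by apply/andP; split; apply: (ler_mean pp) => t /gac /andP[].
have c0 : 0 <= c by lra.
move: c0; rewrite le_eqVlt => /predU1P[c0|c0].
  have E : mu = a by apply/le_anti/andP; split; lra.
  rewrite -c0 expr0n/= mulr0 mul0r expR0 -[leRHS](mean_cst 1 pp).
  apply: (ler_mean pp) => t /gac H; have -> : g t = mu by apply/le_anti/andP; split; lra.
  by rewrite subrr mulr0 expR0.
have cn0 : c != 0 by rewrite gt_eqF.
pose q := (mu - a) / c.
have q01 : 0 <= q <= 1.
  by rewrite /q ler_pdivlMr// ler_pdivrMr// mul0r mul1r; apply/andP; split; lra.
have := bernoulli_mgf_le (th * c) q01.
rewrite -(ler_pM2l (expR_gt0 (- (q * (th * c))))) -expRD.
have -> : - (q * (th * c)) + (q * (th * c) + (th * c) ^+ 2 / 8) = th ^+ 2 * c ^+ 2 / 8.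
  by field.
apply: le_trans.
pose e := expR (- (q * (th * c))).
have -> : e * (1 - q + q * expR (th * c)) =
   mean p (fun t => e * ((1 - (g t - a) / c) + (g t - a) / c * expR (th * c))).
  rewrite meanZ; congr (_ * _).
  rewrite (eq_mean _ (h := fun t => (1 - (expR (th * c) - 1) * a / c) +
     ((expR (th * c) - 1) / c) * g t)); last by move=> t; ring.
  by rewrite meanD (mean_cst _ pp) meanZ -/mu /q; field.
apply: (ler_mean pp) => t pt; have /andP[l1 l2] := gac t pt.
have -> : th * (g t - mu) = - (q * (th * c)) + th * (g t - a) by rewrite /q; field.
rewrite expRD ler_pM2l ?expR_gt0//.
set l := (g t - a) / c.
have l01 : 0 <= l <= 1.
  by rewrite /l ler_pdivlMr// ler_pdivrMr// mul0r mul1r; apply/andP; split; lra.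
have -> : th * (g t - a) = l * (th * c) by rewrite /l; field.
have := expR_ge1Dx (- (l * (th * c))); have := expR_ge1Dx (th * c - l * (th * c)).
rewrite expRD !expRN; set m := expR (l * (th * c)); have m0 : 0 < m := expR_gt0 _.
rewrite -[_ <= _ / m](ler_pM2r m0) -[_ <= m^-1](ler_pM2r m0) divfK ?gt_eqF// mulVf ?gt_eqF//.
move: l01; set y := th * c; set z := expR y => /andP[l0 l1'] H1 H2.
have H3 := ler_wpM2l l0 H1.
have l0' : 0 <= 1 - l by lra.
have H4 := ler_wpM2l l0' H2.
by move: H3 H4; lra.
Qed.
End FiniteExpectation.

(** * Conditional expectation and McDiarmid's inequality *)

Section ConditionalExpectation.
Context {R : realType} {T : finType} {Z : eqType}.
Variables (p : T -> R) (Y : T -> Z).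
Hypothesis pp : pmf p.
Implicit Types (g : T -> R) (k : Z -> R).

Let fib w := mean p (fun v => (Y v == Y w)%:R).

Definition cmean g w : R := mean p (fun v => (Y v == Y w)%:R * g v) / fib w.

Let fib_gt0 w : 0 < p w -> 0 < fib w.
Proof.
move=> pw; rewrite /fib /mean (bigD1 w)//= eqxx mulr1 ltr_wpDr//.
by apply: sumr_ge0 => v _; apply: mulr_ge0; [case: pp|].
Qed.

Let fib_ge0 w : 0 <= fib w.
Proof. by apply: mean_ge0 => // v; case: pp. Qed.

Lemma eq_cmean g w w' : Y w = Y w' -> cmean g w = cmean g w'.
Proof. by rewrite /cmean /fib => ->. Qed.

Lemma cmeanD g h w : cmean (fun v => g v + h v) w = cmean g w + cmean h w.
Proof.
rewrite /cmean -mulrDl -meanD; congr (_ / _).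
by apply: eq_mean => v; rewrite mulrDr.
Qed.

Lemma cmeanZ c g w : cmean (fun v => c * g v) w = c * cmean g w.
Proof.
rewrite /cmean mulrA -meanZ; congr (_ / _).
by apply: eq_mean => v; rewrite mulrCA.
Qed.

Lemma cmean_sum I (r : seq I) (A : pred I) (g : I -> T -> R) w :
  cmean (fun v => \sum_(i <- r | A i) g i v) w = \sum_(i <- r | A i) cmean (g i) w.
Proof.
rewrite /cmean -mulr_suml -mean_sum; congr (_ / _).
by apply: eq_mean => v; rewrite mulr_sumr.
Qed.

Lemma ler_cmean g h w : (forall v, 0 < p v -> g v <= h v) -> cmean g w <= cmean h w.
Proof.
move=> gh; rewrite /cmean ler_wpM2r ?invr_ge0 ?fib_ge0//.
by apply: (ler_mean pp) => v pv; rewrite ler_wpM2l ?gh.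
Qed.

Lemma cmean_fun k w : 0 < p w -> cmean (fun v => k (Y v)) w = k (Y w).
Proof.
move=> pw; rewrite /cmean.
rewrite (eq_mean _ (h := fun v => k (Y w) * (Y v == Y w)%:R)); last first.
  by move=> v; case: eqP => [->|_]; rewrite ?mul0r ?mulr0// mulrC.
by rewrite meanZ mulfK// gt_eqF// fib_gt0.
Qed.

Lemma mean_cmean k g :
  mean p (fun w => k (Y w) * cmean g w) = mean p (fun w => k (Y w) * g w).
Proof.
transitivity (\sum_w \sum_v p w * k (Y w) * (p v * ((Y v == Y w)%:R * g v) / fib w)).
  by apply: eq_bigr => w _; rewrite -mulr_sumr -mulr_suml mulrA.
rewrite exchange_big/=; apply: eq_bigr => v _.
have := pp.1 v; rewrite le_eqVlt => /predU1P[<-|pv].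
  by rewrite mul0r big1// => w _; rewrite !mul0r mulr0.
transitivity (\sum_w (p v * k (Y v) * g v / fib v) * (p w * (Y w == Y v)%:R)).
  apply: eq_bigr => w _; rewrite [Y w == _]eq_sym; case: eqP => [E|_]; last first.
    by rewrite !(mul0r, mulr0).
  by rewrite /fib E; ring.
rewrite -mulr_sumr -/(mean p _) -/(fib v) divfK ?gt_eqF ?fib_gt0//.
by rewrite mulrA.
Qed.

(** Jensen's inequality on each fiber of Y. *)
Lemma mean_expR_cmean g : mean p (fun w => expR (cmean g w)) <= mean p (fun w => expR (g w)).
Proof.
have -> : mean p (fun w => expR (g w)) = mean p (fun w => 1 * expR (g w)).
  by apply: eq_mean => w; rewrite mul1r.
rewrite -(mean_cmean (fun=> 1)); apply: (ler_mean pp) => w pw; rewrite mul1r.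
pose p' v := p v * (Y v == Y w)%:R / fib w.
have E h : cmean h w = mean p' h.
  rewrite /cmean /mean mulr_suml; apply: eq_bigr => v _; rewrite /p'.
  by rewrite mulrA -!mulrA [h v * _]mulrC.
have pp' : pmf p'.
  split=> [v|]; first by rewrite divr_ge0 ?fib_ge0// mulr_ge0//; case: pp.
  by rewrite -mulr_suml -/(mean p _) divff// gt_eqF// fib_gt0.
by rewrite !E; exact: expR_mean_le.
Qed.

End ConditionalExpectation.

Section ProductSpace.
Context {R : realType} {J T : finType}.
Variable q : J -> T -> R.
Hypothesis qp : forall j, pmf (q j).
Implicit Types (w v : {ffun J -> T}) (g : {ffun J -> T} -> R).

Definition prodw w : R := \prod_j q j (w j).

Lemma mean_prod (phi : J -> T -> R) :
  mean prodw (fun w => \prod_j phi j (w j)) = \prod_j mean (q j) (phi j).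
Proof.
rewrite bigA_distr_bigA/=; apply: eq_bigr => w _.
by rewrite -big_split.
Qed.

Lemma prodw_pmf : pmf prodw.
Proof.
split=> [w|]; first by apply: prodr_ge0 => j _; case: (qp j).
rewrite /prodw -(bigA_distr_bigA q) big1// => j _; by case: (qp j).
Qed.

Lemma mean_coord a (phi : T -> R) : mean prodw (fun w => phi (w a)) = mean (q a) phi.
Proof.
rewrite (eq_mean _ (h := fun w => \prod_j (if j == a then phi (w j) else 1))); last first.
  by move=> w; rewrite -big_mkcond big_pred1_eq.
rewrite (mean_prod (fun j t => if j == a then phi t else 1)) (bigD1 a)//= eqxx.
rewrite big1 ?mulr1// => j /negPf ->; exact: mean_cst.
Qed.

Definition mix (D : pred J) w v : {ffun J -> T} := [ffun j => if D j then w j else v j].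

(** Exchanging coordinates between two independent copies of the sample does
    not change their joint law. *)
Lemma mean_mix (D : pred J) (F : {ffun J -> T} -> {ffun J -> T} -> R) :
  mean prodw (fun w => mean prodw (fun v => F w v)) =
  mean prodw (fun w => mean prodw (fun v => F (mix D w v) (mix D v w))).
Proof.
have pairE (G : {ffun J -> T} -> {ffun J -> T} -> R) :
    mean prodw (fun w => mean prodw (fun v => G w v)) =
    \sum_(x : {ffun J -> T} * {ffun J -> T}) prodw x.1 * prodw x.2 * G x.1 x.2.
  rewrite -(pair_bigA _ (fun w v => prodw w * prodw v * G w v))/=.
  by apply: eq_bigr => w _; rewrite mulr_sumr; apply: eq_bigr => v _; rewrite mulrA.
rewrite !pairE.
pose h (x : {ffun J -> T} * {ffun J -> T}) := (mix D x.1 x.2, mix D x.2 x.1).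
have hK : involutive h.
  by case=> w v; congr pair; apply/ffunP => j; rewrite !ffunE; case: (D j).
rewrite (reindex_inj (inv_inj hK)); apply: eq_bigr => -[w v] _ /=; congr (_ * _).
rewrite /prodw -!big_split/=; apply: eq_bigr => j _; rewrite !ffunE.
by case: (D j) => //; rewrite mulrC.
Qed.

Definition depends_on (D : pred J) g :=
  forall w v, (forall j, D j -> w j = v j) -> g w = g v.

Lemma mean_indep2 (D : pred J) g h : depends_on D g -> depends_on (predC D) h ->
  mean prodw (fun w => g w * h w) = mean prodw g * mean prodw h.
Proof.
move=> gD hD.
have <- : mean prodw (fun w => mean prodw (fun v => g w * h v)) = mean prodw g * mean prodw h.
  rewrite mulrC -meanZ; apply: eq_mean => w; rewrite meanZ mulrC; congr (_ * _).
(* After the exchange, g w * h v reads the first copy only. *)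
rewrite (mean_mix (predC D)).
rewrite -[LHS](mean_cst _ prodw_pmf); apply: eq_mean => w; apply: eq_mean => v.
by congr (_ * _); [apply: gD|apply: hD] => j; rewrite ffunE /=; case: (D j).
Qed.

Lemma mean_indep (B : eqType) (blk : J -> B) (r : seq B) (g : B -> {ffun J -> T} -> R) :
  uniq r -> (forall b, depends_on (fun j => blk j == b) (g b)) ->
  mean prodw (fun w => \prod_(b <- r) g b w) = \prod_(b <- r) mean prodw (g b).
Proof.
move=> + gD; elim: r => [_|b r IH /= /andP[br ur]].
  rewrite big_nil (eq_mean _ (h := fun=> 1)) ?mean_cst//; first exact: prodw_pmf.
  by move=> w; rewrite big_nil.
rewrite big_cons -IH// -(mean_indep2 (gD b)).
  by apply: eq_mean => w; rewrite big_cons.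
move=> w v wv; apply: eq_big_seq => c cr; apply: gD => j /eqP jc; apply: wv => /=.
by apply/negP => /eqP jb; move: br; rewrite -jb jc cr.
Qed.

Definition upd w a t : {ffun J -> T} := [ffun j => if j == a then t else w j].

Definition avg a g w := mean (q a) (fun t => g (upd w a t)).

Lemma mean_avg a g : mean prodw (avg a g) = mean prodw g.
Proof.
transitivity (mean prodw (fun w => mean prodw (fun v => g (mix (predC1 a) w v)))).
  apply: eq_mean => w; rewrite /avg -(mean_coord a); apply: eq_mean => v; congr g.
  by apply/ffunP => j; rewrite !ffunE /=; case: eqP => [->|].
rewrite -(mean_mix (predC1 a) (fun w _ => g w)); apply: eq_mean => w.
exact/mean_cst/prodw_pmf.
Qed.

Definition bounded_diff (c : J -> R) g :=
  forall w a t, `|g (upd w a t) - g w| <= c a.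

Lemma bounded_diff_avg c a g : bounded_diff c g ->
  bounded_diff (fun b => if b == a then 0 else c b) (avg a g).
Proof.
move=> gc w b t; rewrite /avg; case: eqP => [->|/eqP ba].
  rewrite (_ : mean _ _ = mean (q a) (fun s => g (upd w a s))) ?subrr ?normr0//.
  apply: eq_mean => s; congr g; apply/ffunP => j; rewrite !ffunE.
  by case: eqP.
rewrite -meanB.
have E s : upd (upd w b t) a s = upd (upd w a s) b t.
  apply/ffunP => j; rewrite !ffunE; case: (eqVneq j a) => [->|//].
  by rewrite eq_sym (negPf ba).
rewrite ler_norml -[X in X <= _](mean_cst _ (qp a)) -[X in _ <= _ <= X](mean_cst _ (qp a)).
by apply/andP; split; apply: (ler_mean (qp a)) => s _;
  have := gc (upd w a s) b t; rewrite E ler_norml => /andP[].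
Qed.

(** Hoeffding's lemma in one coordinate, the others being fixed. *)
Lemma mgf_avg_le c a g th : bounded_diff c g ->
  mean prodw (fun w => expR (th * g w)) <=
  expR (th ^+ 2 * c a ^+ 2 / 8) * mean prodw (fun w => expR (th * avg a g w)).
Proof.
move=> gc; rewrite -(mean_avg a) -meanZ; apply: (ler_mean prodw_pmf) => w _.
pose G t := g (upd w a t).
case: (arg_minP G (isT : predT (w a))) => t0 _ t0min.
have H : forall t, 0 < q a t -> G t0 <= G t <= G t0 + c a.
  move=> t _; rewrite t0min//=.
  have := gc (upd w a t0) a t; rewrite ler_norml => /andP[_].
  rewrite lerBlDl (_ : upd (upd w a t0) a t = upd w a t)//.
  by apply/ffunP => j; rewrite !ffunE; case: eqP.
have := hoeffding_lemma th (qp a) H; rewrite -/(avg a g w).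
rewrite -(ler_pM2r (expR_gt0 (th * avg a g w))) mulrC -meanZ; apply: le_trans.
by apply: (ler_mean (qp a)) => t _; rewrite -expRD -mulrDr -/(avg a g w) addrC subrK.
Qed.

Lemma bounded_diff0 c g w v : bounded_diff c g -> (forall a, c a = 0) -> g w = g v.
Proof.
move=> gc c0.
have H (l : seq J) : g (mix (mem l) w v) = g v.
  elim: l => [|a l IH]; first by congr g; apply/ffunP => j; rewrite ffunE.
  rewrite -IH; have := gc (mix (mem l) w v) a (w a); rewrite c0 normr_le0 subr_eq0 => /eqP <-.
  by congr g; apply/ffunP => j; rewrite !ffunE /= inE; case: eqP => [->|].
by rewrite -(H (enum J)); congr g; apply/ffunP => j; rewrite ffunE /= mem_enum.
Qed.

(** Averaging out one coordinate costs the factor of Hoeffding's lemma and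
    leaves a function that no longer depends on that coordinate. *)
Lemma mcdiarmid_mgf c g th : bounded_diff c g ->
  mean prodw (fun w => expR (th * (g w - mean prodw g))) <=
  expR (th ^+ 2 * (\sum_a c a ^+ 2) / 8).
Proof.
suff H l : uniq l -> forall c g, bounded_diff c g -> (forall a, a \notin l -> c a = 0) ->
    mean prodw (fun w => expR (th * g w)) <=
    expR (th ^+ 2 * (\sum_(a <- l) c a ^+ 2) / 8) * expR (th * mean prodw g).
  move=> gc; have H' := H _ (index_enum_uniq J) c g gc.
  rewrite -(ler_pM2r (expR_gt0 (th * mean prodw g))).
  move Ee : (expR (th * mean prodw g)) H' => e H'; rewrite [leLHS]mulrC -meanZ.
  apply: le_trans (H' _); last by move=> a; rewrite mem_index_enum.
  by apply: (ler_mean prodw_pmf) => w _; rewrite -Ee -expRD -mulrDr addrC subrK.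
elim: l => [_ {}c {}g gc c0|a l IH /= /andP[al ul] {}c {}g gc c0].
  rewrite big_nil mulr0 mul0r expR0 mul1r -[leRHS](mean_cst _ prodw_pmf).
  apply: (ler_mean prodw_pmf) => w _; rewrite ler_expR.
  rewrite (_ : mean prodw g = g w)// -[RHS](mean_cst _ prodw_pmf).
  by apply: eq_mean => v; apply: (bounded_diff0 _ _ gc) => b; exact: c0.
apply: (le_trans (mgf_avg_le a th gc)).
have := IH ul _ _ (bounded_diff_avg a gc); rewrite mean_avg => IH'.
rewrite big_cons mulrDr mulrDl expRD -[leRHS]mulrA ler_pM2l ?expR_gt0//.
rewrite (_ : \sum_(j <- l) c j ^+ 2 = \sum_(j <- l) (if j == a then 0 else c j) ^+ 2).
  by apply: IH' => b bl; case: eqP => // /eqP ba; apply: c0; rewrite inE negb_or ba.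
apply: eq_big_seq => j jl; case: eqP => // ja; by rewrite -ja jl in al.
Qed.

(** Chernoff's bound, at the minimizer th of the exponent. *)
Lemma mcdiarmid (c : J -> R) g (V t : R) : bounded_diff c g -> \sum_a c a ^+ 2 <= V -> 0 < V -> 0 <= t ->
  mean prodw (fun w => (mean prodw g + t <= g w)%R%:R) <= expR (- (2 * t ^+ 2 / V)).
Proof.
move=> gc cV V0 t0; pose th := 4 * t / V.
have th0 : 0 <= th by rewrite divr_ge0// ?mulr_ge0// ltW.
apply: (@le_trans _ _ (mean prodw (fun w => expR (- (th * t)) *
    expR (th * (g w - mean prodw g))))).
  apply: (ler_mean prodw_pmf) => w _; rewrite -expRD.
  case: (boolP (mean prodw g + t <= g w)) => [H|_]; last by rewrite mulr0n expR_ge0.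
  rewrite mulr1n -[leLHS]expR0 ler_expR addrC -mulrBr mulr_ge0// -addrA -opprD subr_ge0.
  exact: H.
rewrite meanZ; apply: (@le_trans _ _ (expR (- (th * t)) * expR (th ^+ 2 * V / 8))).
  rewrite ler_pM2l ?expR_gt0//; apply: (le_trans (mcdiarmid_mgf th gc)).
  by rewrite ler_expR ler_pM2r ?invr_gt0// ler_wpM2l// sqr_ge0.
rewrite -expRD ler_expR le_eqVlt; apply/orP; left; apply/eqP.
by rewrite /th; field; rewrite gt_eqF.
Qed.

Lemma mean_sqr_sum (D : pred J) (phi : T -> R) :
  (forall j, D j -> mean (q j) phi = 0) ->
  mean prodw (fun w => (\sum_(j | D j) phi (w j)) ^+ 2) =
  \sum_(j | D j) mean (q j) (fun t => phi t ^+ 2).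
Proof.
move=> phi0.
rewrite (eq_mean _ (h := fun w => \sum_(j | D j) \sum_(k | D k) phi (w j) * phi (w k))); last first.
  by move=> w; rewrite expr2 mulr_suml; apply: eq_bigr => j _; rewrite mulr_sumr.
rewrite mean_sum; apply: eq_bigr => j Dj; rewrite mean_sum (bigD1 j)//= big1 ?addr0.
  by rewrite -(mean_coord j); apply: eq_mean => w; rewrite expr2.
move=> k /andP[_ kj].
rewrite (mean_indep2 (D := pred1 j)) ?(mean_coord j) ?phi0 ?mul0r// => w v H.
  by rewrite H//=.
by rewrite H.
Qed.

End ProductSpace.

(** * Marginals as measures on the whole space *)

Section Projections.
Context {R : realType} {d : nat} {m : 'I_d -> nat}.
Local Notation X := (coords m [set: 'I_d]).
Variable x0 : X.
Implicit Types (S T U : {set 'I_d}) (x : X) (mu nu : X -> R).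

Definition rst S : X -> coords m S := restr (finset.subsetT S).

(** With the coordinates outside T frozen at x0, all marginals live on the same
    space, and the maps taking a measure to its marginals commute. *)
Definition proj T x : X :=
  [ffun j : {j : 'I_d | j \in [set: 'I_d]} => if val j \in T then x j else x0 j].

Lemma proj_proj T U x : proj T (proj U x) = proj (T :&: U) x.
Proof.
apply/ffunP => j; rewrite !ffunE finset.in_setI.
by case: (val j \in T) => //=; case: (val j \in U).
Qed.

Lemma proj_idem T x : proj T (proj T x) = proj T x.
Proof. by rewrite proj_proj finset.setIid. Qed.

Definition emb S (y : coords m S) : X :=
  [ffun j : {j : 'I_d | j \in [set: 'I_d]} =>
     match decP (@idP (val j \in S)) with
     | left h => y (exist _ (val j) h)
     | right _ => x0 j
     end].

Lemma embK S : cancel (@emb S) (rst S).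
Proof.
move=> y; apply/ffunP => j; rewrite !ffunE /=.
case: decP => [h|]; last by rewrite (valP j).
by case: j h => i hi /= h; rewrite (bool_irrelevance h hi).
Qed.

Lemma emb_rst S x : emb (rst S x) = proj S x.
Proof.
apply/ffunP => j; rewrite !ffunE /=; case: decP => [h|/negP/negPf ->//].
rewrite h ffunE; case: j h => i hi /= h.
by rewrite /incl_coord/=; congr (x (exist _ i _)); exact: bool_irrelevance.
Qed.

Lemma rst_emb_eq S x (y : coords m S) : (rst S x == y) = (proj S x == emb y).
Proof. by rewrite -emb_rst (inj_eq (can_inj (@embK S))). Qed.

Lemma rst_proj S x : rst S (proj S x) = rst S x.
Proof. by apply/eqP; rewrite rst_emb_eq emb_rst proj_idem. Qed.

Definition pf T mu : X -> R := fun x => \sum_(y | proj T y == x) mu y.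

Lemma sum_pf T mu (f : X -> R) : \sum_x f x * pf T mu x = \sum_y f (proj T y) * mu y.
Proof.
rewrite [RHS](partition_big (proj T) predT)//=; apply: eq_bigr => x _.
by rewrite /pf mulr_sumr; apply: eq_bigr => y /eqP ->.
Qed.

Lemma mass_pf T mu : \sum_x pf T mu x = \sum_y mu y.
Proof.
transitivity (\sum_x 1 * pf T mu x); first by apply: eq_bigr => x _; rewrite mul1r.
by rewrite (sum_pf _ _ (fun=> 1)); apply: eq_bigr => x _; rewrite mul1r.
Qed.

Lemma pf_pf T U mu : pf T (pf U mu) = pf (T :&: U) mu.
Proof.
apply/funext => x; rewrite /pf [RHS](partition_big (proj U) (fun z => proj T z == x))/=.
  apply: eq_bigr => z /eqP zx; apply: eq_bigl => y; rewrite -proj_proj.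
  by case: (eqVneq (proj U y) z) => [->|_]; rewrite ?zx ?eqxx// andbF.
by move=> y; rewrite proj_proj.
Qed.

Lemma pfB T mu nu : pf T (fun x => mu x - nu x) = (fun x => pf T mu x - pf T nu x).
Proof. by apply/funext => x; rewrite /pf sumrB. Qed.

Lemma pfD T mu nu : pf T (fun x => mu x + nu x) = (fun x => pf T mu x + pf T nu x).
Proof. by apply/funext => x; rewrite /pf big_split. Qed.

Lemma pf_norm_le T mu : \sum_x `|pf T mu x| <= \sum_x `|mu x|.
Proof.
rewrite [leRHS](partition_big (proj T) predT)//=; apply: ler_sum => x _.
exact: ler_norm_sum.
Qed.

Lemma marginal_pf S mu : marginal (finset.subsetT S) mu = fun y => pf S mu (emb y).
Proof.
apply/funext => y; rewrite /marginal /pf; apply: eq_bigl => x.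
exact: rst_emb_eq.
Qed.

Lemma sum_marginal S mu (f : coords m S -> R) :
  \sum_y f y * marginal (finset.subsetT S) mu y = \sum_x f (rst S x) * mu x.
Proof.
rewrite [RHS](partition_big (rst S) predT)//=; apply: eq_bigr => y _.
by rewrite /marginal mulr_sumr; apply: eq_bigr => x /eqP <-.
Qed.

Lemma mass_marginal S mu : \sum_y marginal (finset.subsetT S) mu y = \sum_x mu x.
Proof.
transitivity (\sum_y 1 * marginal (finset.subsetT S) mu y).
  by apply: eq_bigr => y _; rewrite mul1r.
by rewrite (sum_marginal _ (fun=> 1)); apply: eq_bigr => x _; rewrite mul1r.
Qed.

Lemma restr_restr S T (sST : S \subset T) x : restr sST (rst T x) = rst S x.
Proof.
apply/ffunP => -[i hi]; rewrite !ffunE /incl_coord/=.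
by congr (x (exist _ i _)); exact: bool_irrelevance.
Qed.

Lemma marginal_marginal S T (sST : S \subset T) mu :
  marginal sST (marginal (finset.subsetT T) mu) = marginal (finset.subsetT S) mu.
Proof.
apply/funext => z; rewrite /marginal.
rewrite [RHS](partition_big (rst T) (fun y => restr sST y == z))/=; last first.
  by move=> x; rewrite restr_restr.
apply: eq_bigr => y /eqP yz; apply: eq_bigl => x.
case: (eqVneq (rst T x) y) => [xy|_]; last by rewrite andbF.
by rewrite andbT -yz -xy restr_restr eqxx.
Qed.

End Projections.

(** * The incompatibility index *)

Section Index.
Context {R : realType} {d : nat} {m : 'I_d -> nat}.
Local Notation X := (coords m [set: 'I_d]).
Implicit Types (S : {set 'I_d}) (P f : fun_family R m) (rho mu : {set 'I_d} -> X -> R).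
Variable SS : {set {set 'I_d}}.
Local Notation s := (#|SS|%:R : R).

Definition fam rho : fun_family R m :=
  fun S => marginal (finset.subsetT S) (rho S).

Definition pairing rho f : R := \sum_(S in SS) \sum_x f S (rst S x) * rho S x.

Lemma Rdual_fam rho f : Rdual SS (fam rho) f = - (s^-1 * pairing rho f).
Proof.
congr (- (_ * _)); apply: eq_bigr => S _.
exact: sum_marginal.
Qed.

Hypothesis s_gt0 : (0 < #|SS|)%N.

Let s0 : 0 < s. Proof. by rewrite ltr0n. Qed.

Lemma Gplus0 : Gplus SS (fun S (_ : coords m S) => 0 : R).
Proof. by split=> [S _ x|x]; [rewrite oppr_le0 ler01|rewrite big1]. Qed.

Lemma Rdual_le1 P f : distributions SS P -> Gplus SS f -> Rdual SS P f <= 1.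
Proof.
move=> dP [f1 _]; rewrite /Rdual lerNl -(ler_pM2l s0) mulrA divff ?gt_eqF// mul1r.
rewrite mulrN1 -sumr_const -sumrN; apply: ler_sum => S /[dup] SSS /dP [P0 P1].
rewrite -P1 -sumrN; apply: ler_sum => x _.
by rewrite -mulN1r ler_wpM2r ?P0// f1.
Qed.

Lemma Rindex_ge P f : distributions SS P -> Gplus SS f -> Rdual SS P f <= Rindex SS P.
Proof.
move=> dP Gf; apply: ub_le_sup; last by exists f.
by exists 1 => _ [g Gg <-]; exact: Rdual_le1.
Qed.

Lemma Rindex_le P M : (forall f, Gplus SS f -> Rdual SS P f <= M) -> Rindex SS P <= M.
Proof.
move=> H; apply: ge_sup => [|_ [f Gf <-]]; last exact: H.
by exists (Rdual SS P (fun S _ => 0)); exists (fun S _ => 0) => //; exact: Gplus0.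
Qed.

Lemma Rindex_ge0 P : distributions SS P -> 0 <= Rindex SS P.
Proof.
move=> dP; apply: le_trans (Rindex_ge dP Gplus0).
rewrite /Rdual big1 ?mulr0 ?oppr0// => S _; rewrite big1// => x _.
by rewrite mul0r.
Qed.

Definition cut f : fun_family R m := fun S x => Num.min (f S x) (s - 1).
Arguments cut f S x : clear implicits.

Let Gplus_cut f : Gplus SS f -> Gplus SS (cut f).
Proof.
move=> [f1 f2]; have s1 : 1 <= s by rewrite ler1n.
have cut1 S : S \in SS -> forall x, -1 <= cut f S x.
  by move=> SSS x; rewrite /cut le_min f1//=; lra.
split=> // x.
have [/existsP[S0 /andP[S0S big0]]|] :=
    boolP [exists S0, (S0 \in SS) && (s - 1 <= f S0 (rst S0 x))]; last first.
  rewrite negb_exists => /forallP H.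
  rewrite (eq_bigr (fun S => f S (rst S x))) ?f2// => S SSS.
  by rewrite /cut min_l// ltW// ltNge; have := H S; rewrite SSS.
rewrite (bigD1 S0)//= /cut min_r// -/(cut f).
apply: (@le_trans _ _ (s - 1 + \sum_(S in SS | S != S0) (-1))).
  have : \sum_(S in SS) (-1) = - s :> R by rewrite sumr_const mulNrn.
  by rewrite (bigD1 S0)//= => E; lra.
by rewrite lerD2l; apply: ler_sum => S /andP[SSS _]; exact: cut1.
Qed.

(** Since all functions are at least -1, lowering one of them to s - 1 keeps
    the sum nonnegative, and it only increases the dual value. *)
Lemma Rindex_le_bounded P M : distributions SS P ->
  (forall f, Gplus SS f -> (forall S, S \in SS -> forall x, -1 <= f S x <= s - 1) ->
     Rdual SS P f <= M) -> Rindex SS P <= M.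
Proof.
move=> dP H; apply: Rindex_le => f Gf.
have Gc := Gplus_cut Gf.
apply: le_trans (H _ Gc _) => [|S SSS x]; last first.
  by rewrite Gc.1//= /cut ge_min lexx orbT.
rewrite /Rdual lerN2 ler_pM2l ?invr_gt0//; apply: ler_sum => S SSS.
apply: ler_sum => x _; rewrite ler_wpM2r ?ge_min ?lexx//; by case: (dP S SSS).
Qed.

Definition isolated S0 := forall S, S \in SS -> S != S0 -> S :&: S0 = finset.set0.

(** For an isolated S0 the function f S0 may be replaced by its minimum, since
    the coordinates in S0 can be chosen independently of the others. *)
Lemma Rindex_isolated P P' S0 : S0 \in SS -> isolated S0 ->
  distributions SS P -> distributions SS P' ->
  (forall S, S \in SS -> S != S0 -> P S = P' S) ->
  Rindex SS P <= Rindex SS P'.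
Proof.
move=> S0S iso dP dP' PP'; apply: Rindex_le => f [f1 f2].
have [Ps0 Ps1] := dP S0 S0S.
have [y0 _] : exists y0 : coords m S0, true.
  case: (pickP (predT : pred (coords m S0))) => [y|none]; first by exists y.
  by move: Ps1; rewrite big_pred0 ?(fun e => eqP e)// => /esym/eqP; rewrite oner_eq0.
case: (arg_minP (f S0) (isT : predT y0)) => a _ amin.
pose g : fun_family R m := fun S => if S == S0 then fun=> f S0 a else f S.
have gS0 : g S0 = fun=> f S0 a by rewrite /g eqxx.
have gS S : S != S0 -> g S = f S by rewrite /g => /negPf ->.
have Gg : Gplus SS g.
  split=> [S SSS|x].
    by have [->|/gS ->] := eqVneq S S0; [rewrite gS0 => _; exact: f1|exact: f1].
  apply: le_trans (f2 (emb x a)) _; apply: ler_sum => S SSS.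
  have [->|SS0] := eqVneq S S0; first by rewrite gS0 -/(rst _ _) embK.
  rewrite (gS _ SS0) le_eqVlt; apply/orP; left; apply/eqP; congr (f S _).
  apply/ffunP => -[i hi]; rewrite !ffunE /=; case: decP => // hi0.
  by have := iso S SSS SS0 => /setP/(_ i); rewrite !inE hi hi0.
apply: le_trans (Rindex_ge dP' Gg).
rewrite /Rdual lerN2 ler_pM2l ?invr_gt0//; apply: ler_sum => S SSS.
have [->|SS0] := eqVneq S S0; last by rewrite gS// PP'.
rewrite gS0; have [P's0 P's1] := dP' S0 S0S.
rewrite -mulr_sumr P's1 mulr1 -[leLHS]mulr1 -Ps1 mulr_sumr.
by apply: ler_sum => x _; rewrite ler_wpM2r// amin.
Qed.

Section Positivize.
Variable x0 : X.
Variables (F : nat) (fl : 'I_F -> fun_family R m) (D : R).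
Hypothesis D0 : 0 <= D.
Hypothesis flG : forall l, Gplus SS (fl l).
Hypothesis flD : forall P, consistent SS P ->
  Rindex SS P <= D * max_Rdual_pos SS P fl.

Let consistent_fam mu :
  (forall S, S \in SS -> pmf (mu S)) ->
  (forall S1 S2, S1 \in SS -> S2 \in SS -> S1 != S2 -> S1 :&: S2 != finset.set0 ->
     pf x0 (S1 :&: S2) (mu S1) = pf x0 (S1 :&: S2) (mu S2)) ->
  consistent SS (fam mu).
Proof.
move=> pm pfE; split=> [S /pm[m0 m1]|S1 S2 S1S S2S S12 z].
  split=> [x|]; first by apply: sumr_ge0.
  by rewrite mass_marginal.
rewrite /fam !marginal_marginal.
have [E|ne] := eqVneq S1 S2; first by congr (marginal _ (mu _) z).
by rewrite !(marginal_pf x0) (pfE S1 S2).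
Qed.

(** A signed family mu with consistent marginals becomes a consistent family
    of distributions once the negative parts of all mu S - rho S are added
    to every member. What is added is one measure on the whole space, hence
    compatible, and compatible measures never increase a dual value. *)
Lemma Rindex_le_signed rho mu :
  (forall S, S \in SS -> pmf (rho S)) ->
  (forall S, S \in SS -> \sum_x mu S x = 1) ->
  (forall S1 S2, S1 \in SS -> S2 \in SS -> S1 != S2 -> S1 :&: S2 != finset.set0 ->
     pf x0 (S1 :&: S2) (mu S1) = pf x0 (S1 :&: S2) (mu S2)) ->
  Rindex SS (fam rho) <=
    (s - 1) * (\sum_(S in SS) \sum_x Num.max (rho S x - mu S x) 0) +
    D * \big[Num.max/0]_(l < F) Num.max (- (s^-1 * pairing mu (fl l))) 0.
Proof.
move=> prho mmu pfmu.
pose neg S x := Num.max (rho S x - mu S x) 0.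
pose W x := \sum_(S in SS) neg S x.
pose delta := \sum_x W x.
have neg0 S x : 0 <= neg S x by rewrite /neg le_max lexx orbT.
have W0 x : 0 <= W x by apply: sumr_ge0 => S _.
have delta0 : 0 <= delta by apply: sumr_ge0 => x _.
have -> : \sum_(S in SS) \sum_x Num.max (rho S x - mu S x) 0 = delta.
  by rewrite exchange_big.
have d1 : 0 < 1 + delta by rewrite ltr_pwDl.
pose nu S x := (1 + delta)^-1 * (mu S x + W x).
have negW S x : S \in SS -> neg S x <= W x.
  by move=> SSS; rewrite /W (bigD1 S)//= lerDl sumr_ge0.
have muW S x : S \in SS -> 0 <= mu S x + W x - rho S x.
  move=> SSS; apply: (@le_trans _ _ (mu S x - rho S x + neg S x)); last first.
    by have := negW S x SSS; lra.
  have : rho S x - mu S x <= neg S x by rewrite /neg le_max lexx.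
  by lra.
have pnu S : S \in SS -> pmf (nu S).
  move=> SSS; split=> [x|].
    rewrite mulr_ge0// ?invr_ge0 ?(ltW d1)//; have := muW S x SSS.
    by have [r0 _] := prho S SSS; have := r0 x; lra.
  by rewrite -mulr_sumr big_split/= mmu// -/delta mulVf// gt_eqF.
have cnu : consistent SS (fam nu).
  apply: consistent_fam => // S1 S2 S1S S2S ne S12; apply/funext => x.
  have := pfmu S1 S2 S1S S2S ne S12 => /(congr1 (fun g => g x)) E.
  by rewrite /pf -!mulr_sumr !big_split/=; congr (_ * (_ + _)).
have dnu := cnu.1.
have drho : distributions SS (fam rho).
  move=> S /prho[r0 r1]; split=> [x|]; first by apply: sumr_ge0.
  by rewrite mass_marginal.
have pairD g : pairing nu g = (1 + delta)^-1 * (pairing mu g + pairing (fun=> W) g).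
  rewrite -big_split mulr_sumr; apply: eq_bigr => S _.
  by rewrite -big_split mulr_sumr; apply: eq_bigr => x _; rewrite /nu/=; ring.
apply: (Rindex_le_bounded drho) => g Gg gb.
have step1 : Rdual SS (fam rho) g <= (s - 1) * delta + (1 + delta) * Rindex SS (fam nu).
  apply: (@le_trans _ _ ((s - 1) * delta + (1 + delta) * Rdual SS (fam nu) g)); last first.
    by rewrite lerD2l ler_pM2l// Rindex_ge.
  rewrite !Rdual_fam pairD.
  have E : (1 + delta) * - (s^-1 * ((1 + delta)^-1 * (pairing mu g + pairing (fun=> W) g))) =
      - (s^-1 * (pairing mu g + pairing (fun=> W) g)).
    by rewrite mulrN mulrCA mulVKf// gt_eqF.
  rewrite E.
  suff : s^-1 * (pairing mu g + pairing (fun=> W) g - pairing rho g) <= (s - 1) * delta.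
    by rewrite mulrBr; lra.
  rewrite ler_pdivrMl//.
  have -> : s * ((s - 1) * delta) = \sum_(S in SS) (s - 1) * delta.
    by rewrite sumr_const mulr_natl.
  rewrite -big_split/= -sumrB; apply: ler_sum => S SSS.
  rewrite -big_split/= -sumrB.
  have -> : (s - 1) * delta = \sum_x (s - 1) * (mu S x + W x - rho S x).
    rewrite -mulr_sumr sumrB big_split/= mmu// (prho S SSS).2 -/delta.
    by congr (_ * _); lra.
  apply: ler_sum => x _; rewrite -mulrDr -mulrBr ler_wpM2r ?muW//.
  by case/andP: (gb S SSS (rst S x)).
apply: (le_trans step1); rewrite lerD2l.
apply: (@le_trans _ _ ((1 + delta) * (D * max_Rdual_pos SS (fam nu) fl))).
  by rewrite ler_pM2l// flD.
rewrite mulrCA ler_wpM2l// mulrC -ler_pdivlMr//.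
apply: bigmax_le => [|l _]; first by rewrite divr_ge0 ?bigmax_ge_id// ltW.
rewrite ler_pdivlMr//.
have [H|/ltW H] := lerP (Rdual SS (fam nu) (fl l)) 0.
  by rewrite mul0r bigmax_ge_id.
apply: (bigmax_sup l) => //; rewrite le_max; apply/orP; left.
rewrite Rdual_fam pairD mulrC mulrN mulrCA mulVKf ?gt_eqF// lerN2 ler_pM2l ?invr_gt0// lerDl.
rewrite /pairing exchange_big/=; apply: sumr_ge0 => x _.
by rewrite -mulr_suml mulr_ge0// (flG l).2.
Qed.

End Positivize.
End Index.

(** * Removing marginals *)

Section MarginalRemoval.
Context {R : realType} {d : nat} {m : 'I_d -> nat}.
Local Notation X := (coords m [set: 'I_d]).
Variable x0 : X.
Variables (B : eqType) (t : B -> {set 'I_d}).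
Implicit Types (T : {set 'I_d}) (l : seq B) (mu : X -> R) (f : X -> R).

Fixpoint drop_marg l mu : X -> R :=
  if l is b :: l' then
    fun x => drop_marg l' mu x - pf x0 (t b) (drop_marg l' mu) x
  else mu.

(** The projections commute, so that removing one marginal keeps at zero those
    already removed. *)
Lemma pf_drop_marg b l mu : b \in l -> pf x0 (t b) (drop_marg l mu) = fun=> 0.
Proof.
elim: l => //= c l IH; rewrite inE pfB => /predU1P[->|/IH E].
  by apply/funext => x; rewrite pf_pf finset.setIid subrr.
apply/funext => x; rewrite pf_pf finset.setIC -pf_pf E /pf big1 ?subr0//.
Qed.

Lemma mass_drop_marg l mu : \sum_x mu x = 0 -> \sum_x drop_marg l mu x = 0.
Proof.
by move=> mu0; elim: l => //= b l IH; rewrite sumrB mass_pf IH subrr.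
Qed.

(** The coefficients of sum_drop_marg: peeling off the removals one after the
    other replaces f by f - f \o proj x0 (t c). *)
Fixpoint cell_weight l f b z : R :=
  if l is c :: l' then
    if b == c then f z
    else cell_weight l' (fun x => f x - f (proj x0 (t c) x)) b z
  else 0.

(** Each step of the recursion at most doubles the sup norm. *)
Lemma cell_weight_le l f (h : R) b z : (forall x, `|f x| <= h) ->
  `|cell_weight l f b z| <= 2 ^+ size l * h.
Proof.
elim: l f h => [|c l IH] f h fh /=.
  by rewrite normr0 mul1r (le_trans _ (fh x0)).
case: eqP => _.
  apply: (le_trans (fh z)); rewrite ler_peMl ?(le_trans _ (fh z))//.
  by rewrite exprn_ege1// ler1n.
rewrite exprSr -mulrA; apply: IH => x.
by apply: (le_trans (ler_normB _ _)); have := fh x; have := fh (proj x0 (t c) x); lra.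
Qed.

(** The removed part of mu is seen by a function f only through the values of
    mu on the cells of the removed marginals. *)
Lemma sum_drop_marg l f mu : uniq l ->
  \sum_x f x * drop_marg l mu x =
  \sum_x f x * mu x - \sum_(b <- l) \sum_z cell_weight l f b z * pf x0 (t b) mu z.
Proof.
elim: l f => [|c l IH] f; first by rewrite big_nil subr0.
move=> /= /andP[cl ul].
pose g x := f x - f (proj x0 (t c) x).
rewrite big_cons eqxx opprD addrA.
rewrite (eq_big_seq (fun b => \sum_z cell_weight l g b z * pf x0 (t b) mu z)); last first.
  by move=> b bl; case: eqP => // bc; rewrite -bc bl in cl.
have E nu : \sum_x f x * nu x - \sum_z f z * pf x0 (t c) nu z = \sum_x g x * nu x.
  by rewrite sum_pf -sumrB; apply: eq_bigr => x _; rewrite -mulrBl.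
rewrite E -IH// -E -sumrB; apply: eq_bigr => x _; by rewrite mulrBr.
Qed.

End MarginalRemoval.

(** * Conditioning an empirical distribution on rounded counts *)

Section Numeric.
Context {R : realType}.
Implicit Types (a b x th : R).

Lemma le_sqrt_of_chernoff a b x : 0 <= a -> 0 < b ->
  (forall th, 0 < th -> th * x <= a + th ^+ 2 * b) -> x <= 2 * Num.sqrt (a * b).
Proof.
move=> a0 b0 H; have [x0|x0] := lerP x 0.
  by apply: (le_trans x0); rewrite mulr_ge0// sqrtr_ge0.
have := H (x / (2 * b)); rewrite divr_gt0 ?mulr_gt0// => /(_ isT).
have -> : x / (2 * b) * x = 2 * (x ^+ 2 / (4 * b)) by field; rewrite gt_eqF.
have -> : (x / (2 * b)) ^+ 2 * b = x ^+ 2 / (4 * b) by field; rewrite gt_eqF.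
move=> H'; have {H'} : x ^+ 2 / (4 * b) <= a by lra.
rewrite ler_pdivrMr ?mulr_gt0// => H'.
have r0 : 0 <= 2 * Num.sqrt (a * b) by rewrite mulr_ge0// sqrtr_ge0.
rewrite -ler_sqr ?nnegrE ?(ltW x0)// exprMn sqr_sqrtr; last by rewrite mulr_ge0// ltW.
by apply: (le_trans H'); rewrite le_eqVlt; apply/orP; left; apply/eqP; ring.
Qed.

Lemma expRN1_le : expR (-1) <= 2^-1 :> R.
Proof.
rewrite expRN lef_pV2 ?posrE ?expR_gt0//.
by apply: le_trans (expR_ge1Dx 1); lra.
Qed.

Lemma expR_dist_le (t b : nat) :
  expR (- `|t%:R - b%:R|) <= 2^-1 ^+ ((t - b) + (b - t)) :> R.
Proof.
have -> : `|t%:R - b%:R| = ((t - b) + (b - t))%:R :> R.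
  have [tb|/ltnW bt] := leqP t b.
    rewrite distrC ger0_norm ?subr_ge0 ?ler_nat// -natrB//.
    by move: (tb); rewrite -subn_eq0 => /eqP ->.
  rewrite ger0_norm ?subr_ge0 ?ler_nat// -natrB//.
  by move: (bt); rewrite -subn_eq0 => /eqP ->; rewrite addn0.
rewrite -mulrN1 expRM_natl lerXn2r ?nnegrE ?expR_ge0 ?invr_ge0//.
exact: expRN1_le.
Qed.

Lemma sum_expR_dist_le (K b : nat) : \sum_(t < K) expR (- `|t%:R - b%:R|) <= 3 :> R.
Proof.
have H1 k : (k <= b)%N ->
    \sum_(t < k) expR (- `|t%:R - b%:R|) <= 2^-1 ^+ (b - k) :> R.
  elim: k => [_|k IH kb]; first by rewrite big_ord0 exprn_ge0// invr_ge0.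
  rewrite big_ord_recr/=.
  have -> : 2^-1 ^+ (b - k.+1) = 2^-1 ^+ (b - k) + 2^-1 ^+ (b - k) :> R.
    rewrite -[(b - k)%N]subSS subSn// exprS; lra.
  apply: lerD; first exact/IH/ltnW.
  apply: le_trans (expR_dist_le _ _) _.
  by have := ltnW kb; rewrite -subn_eq0 => /eqP ->.
have H2 i : \sum_(t < b + i) expR (- `|t%:R - b%:R|) <= 3 - 2 * 2^-1 ^+ i :> R.
  elim: i => [|i IH]; first by rewrite addn0 (le_trans (H1 _ (leqnn b)))// subnn expr0; lra.
  rewrite addnS big_ord_recr/=.
  have := expR_dist_le (b + i) b; rewrite addKn.
  have -> : (b - (b + i) = 0)%N by apply/eqP; rewrite subn_eq0 leq_addr.
  by rewrite addn0 exprS; lra.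
have [Kb|/ltnW bK] := leqP K b.
  by apply: (le_trans (H1 _ Kb)); rewrite (@le_trans _ _ 1)// ?exprn_ile1 ?invr_ge0//; lra.
rewrite -(subnKC bK); apply: (le_trans (H2 _)).
have h0 : 0 <= 2^-1 ^+ (K - b) :> R by rewrite exprn_ge0// invr_ge0.
lra.
Qed.

Lemma three_le_expR2 : 3 <= expR 2 :> R.
Proof. by apply: le_trans (expR_ge1Dx 2); lra. Qed.

End Numeric.

Section Block.
Context {R : realType} {J X C : finType}.
Variables (Q : X -> R) (D : pred J) (n : nat).
Variables (A : C -> pred X) (mm u : C -> nat).
Hypothesis Qp : pmf Q.
Hypothesis Dn : #|D| = n.
Hypothesis n_gt0 : (0 < n)%N.
Hypothesis umm : forall c, (u c < mm c)%N.
Implicit Types (w v : {ffun J -> X}).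

Local Notation P := (prodw (fun _ : J => Q)).
Let Qp' : forall j : J, pmf Q. Proof. by []. Qed.
Let Pp : pmf P. Proof. exact: prodw_pmf. Qed.
Let n0 : 0 < n%:R :> R. Proof. by rewrite ltr0n. Qed.

Definition emp w x : R := n%:R^-1 * \sum_(j | D j) (w j == x)%:R.

Definition count_in c w : nat := (\sum_(j | D j) A c (w j))%N.

Definition cellp c : R := mean Q (fun x => (A c x)%:R).

Definition err c w : nat := ((count_in c w + u c) %% mm c)%N.

Let K := (n + \max_c u c).+1.

Definition quot w : {ffun C -> 'I_K} := [ffun c => inord ((count_in c w + u c) %/ mm c)].

Lemma sum_emp (f : X -> R) w : \sum_x f x * emp w x = n%:R^-1 * \sum_(j | D j) f (w j).
Proof.
transitivity (n%:R^-1 * \sum_(j | D j) \sum_x f x * (w j == x)%:R).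
  rewrite exchange_big mulr_sumr; apply: eq_bigr => x _.
  by rewrite /emp mulrCA -mulr_sumr.
congr (_ * _); apply: eq_bigr => j _; rewrite (bigD1 (w j))//= eqxx mulr1 big1 ?addr0//.
by move=> x /negPf; rewrite eq_sym => ->; rewrite mulr0.
Qed.

Lemma mass_emp w : \sum_x emp w x = 1.
Proof.
transitivity (\sum_x 1 * emp w x); first by apply: eq_bigr => x _; rewrite mul1r.
by rewrite (sum_emp (fun=> 1)) sumr_const Dn mulVf// gt_eqF.
Qed.

Lemma emp_pmf w : pmf (emp w).
Proof.
split; last exact: mass_emp.
by move=> x; rewrite mulr_ge0 ?invr_ge0 ?sumr_ge0.
Qed.

Lemma mean_emp x : mean P (emp^~ x) = Q x.
Proof.
rewrite meanZ mean_sum (eq_bigr (fun=> Q x)) => [|j _].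
  by rewrite sumr_const Dn -[Q x *+ _]mulr_natl mulKf// gt_eqF.
rewrite (mean_coord Qp' j (fun y => (y == x)%:R)) /mean (bigD1 x)//= eqxx mulr1.
by rewrite big1 ?addr0// => y /negPf ->; rewrite mulr0.
Qed.

Lemma count_in_le c w : (count_in c w <= n)%N.
Proof.
rewrite -Dn -sum1_card; apply: leq_sum => j _; exact: leq_b1.
Qed.

Lemma quotE c w : quot w c = ((count_in c w + u c) %/ mm c)%N :> nat.
Proof.
rewrite ffunE inordK// ltnS; apply: (leq_trans (leq_div _ _)).
by rewrite leq_add ?count_in_le// leq_bigmax.
Qed.

Definition dev w x : R := emp w x - Q x.
Definition cdev w x : R := cmean P quot (dev^~ x) w.

Lemma mass_dev w : \sum_x dev w x = 0.
Proof. by rewrite sumrB mass_emp Qp.2 subrr. Qed.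

Lemma mass_cdev w : \sum_x cdev w x = 0.
Proof.
rewrite -cmean_sum /cmean /mean big1 ?mul0r// => v _.
by rewrite mass_dev !mulr0.
Qed.

Lemma sum_cdev (f : X -> R) w :
  \sum_x f x * cdev w x = cmean P quot (fun v => \sum_x f x * dev v x) w.
Proof. by rewrite cmean_sum; apply: eq_bigr => x _; rewrite cmeanZ. Qed.

(** Within a cell, the conditional expectation given the dithered quotient
    reproduces the count up to the remainder of the division. *)
Lemma dev_cell c w : 0 < P w ->
  \sum_(x | A c x) (dev w x - cdev w x) =
  n%:R^-1 * ((err c w)%:R - cmean P quot (fun v => (err c v)%:R) w).
Proof.
move=> Pw.
pose k (y : {ffun C -> 'I_K}) : R :=
  n%:R^-1 * ((y c)%:R * (mm c)%:R - (u c)%:R) - cellp c.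
have E v : \sum_x (A c x)%:R * dev v x = k (quot v) + n%:R^-1 * (err c v)%:R.
  transitivity (\sum_x (A c x)%:R * emp v x - cellp c).
    by rewrite /cellp /mean -sumrB; apply: eq_bigr => x _; rewrite mulrBr [Q x * _]mulrC.
  rewrite sum_emp /k quotE /err -addrAC -mulrDr addrAC; congr (n%:R^-1 * _ - _).
  rewrite -natr_sum -/(count_in c v) -natrM -natrD -divn_eq natrD; lra.
rewrite big_mkcond/=.
transitivity (\sum_x ((A c x)%:R * dev w x - (A c x)%:R * cdev w x)).
  by apply: eq_bigr => x _; case: (A c x); rewrite ?mul1r ?mul0r ?subrr.
rewrite sumrB sum_cdev E.
have -> : cmean P quot (fun v => \sum_x (A c x)%:R * dev v x) w =
    k (quot w) + n%:R^-1 * cmean P quot (fun v => (err c v)%:R) w.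
  rewrite -cmeanZ -(cmean_fun quot Pp k Pw) -cmeanD.
  by rewrite /cmean; congr (_ / _); apply: eq_mean => v; rewrite E.
by rewrite mulrBr; lra.
Qed.

(** Cauchy-Schwarz and the variance of a binomial variable. *)
Lemma mean_count_dev c :
  mean P (fun w => `|(count_in c w)%:R - n%:R * cellp c|) <= Num.sqrt (n%:R * cellp c).
Proof.
have p0 : 0 <= cellp c by apply: mean_ge0 => // x; case: Qp.
rewrite -(ger0_norm (mean_ge0 (Pp.1) _)) => [|w]; last exact: normr_ge0.
rewrite -sqrtr_sqr ler_wsqrtr//.
apply: (le_trans (mean_sqr_le _ Pp)).
pose phi x : R := (A c x)%:R - cellp c.
rewrite (eq_mean _ (h := fun w => (\sum_(j | D j) phi (w j)) ^+ 2)); last first.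
  move=> w; rewrite real_normK ?num_real//; congr (_ ^+ 2).
  by rewrite sumrB sumr_const Dn mulr_natl natr_sum.
have phi0 : mean Q phi = 0 by rewrite meanB (mean_cst _ Qp) subrr.
rewrite (mean_sqr_sum Qp')// sumr_const Dn -[leLHS]mulr_natl ler_pM2l//.
rewrite (eq_mean _ (h := fun x => ((A c x)%:R + (- (2 * cellp c) * (A c x)%:R + cellp c ^+ 2)))); last first.
  by move=> x; rewrite /phi; case: (A c x) => /=; ring.
rewrite !meanD meanZ (mean_cst _ Qp) -/(cellp c).
by have := sqr_ge0 (cellp c); rewrite expr2; lra.
Qed.

Lemma mean_quot_dev (eta : R) c : 0 < eta -> eta * Num.sqrt (n%:R * cellp c) <= (mm c)%:R ->
  mean P (fun w => `|(quot w c)%:R - (Num.truncn (n%:R * cellp c / (mm c)%:R))%:R|)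
    <= eta^-1 + 2.
Proof.
move=> eta0 etam.
have mm0 : 0 < (mm c)%:R :> R by rewrite ltr0n (leq_ltn_trans _ (umm c)).
have p0 : 0 <= n%:R * cellp c.
  by rewrite mulr_ge0//; apply: mean_ge0 => // x; case: Qp.
apply: (@le_trans _ _ (mean P (fun w => (mm c)%:R^-1 * `|(count_in c w)%:R - n%:R * cellp c| + 2))).
  apply: (ler_mean Pp) => w _; rewrite quotE.
  set b := Num.truncn _; set N := count_in c w; set qq := (_ %/ _)%N.
  have b1 : b%:R <= n%:R * cellp c / (mm c)%:R < b.+1%:R.
    by apply: truncn_itv; rewrite divr_ge0// ltW.
  have hq : qq%:R * (mm c)%:R <= (N + u c)%:R :> R by rewrite -natrM ler_nat leq_divM.
  have hq2 : (N + u c)%:R < (qq.+1)%:R * (mm c)%:R :> R.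
    by rewrite -natrM ltr_nat ltn_ceil// (leq_ltn_trans _ (umm c)).
  have hu : (u c)%:R < (mm c)%:R :> R by rewrite ltr_nat.
  have hu0 : 0 <= (u c)%:R :> R by [].
  rewrite -[_^-1 * _]ger0_norm ?mulr_ge0 ?invr_ge0 ?(ltW mm0)//.
  have -> : `|(mm c)%:R^-1 * `|N%:R - n%:R * cellp c| | =
      `|N%:R / (mm c)%:R - n%:R * cellp c / (mm c)%:R| :> R.
    by rewrite normrM normr_id -normrM mulrBr ![_^-1 * _]mulrC.
  move: b1 hq hq2 hu hu0; rewrite natrD.
  set y := _ / _ in |- *; move=> /andP[b1 b2].
  set z := n%:R * cellp c / (mm c)%:R in b1 b2 *.
  have Ey : N%:R = y * (mm c)%:R by rewrite /y divfK// gt_eqF.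
  rewrite Ey -![in qq.+1%:R]natr1 => hq hq2 hu hu0.
  have h1 : qq%:R <= y + 1.
    by rewrite -(ler_pM2r mm0); lra.
  have h2 : y <= qq%:R + 1.
    by rewrite -(ler_pM2r mm0); lra.
  rewrite -natr1 in b2.
  have := ler_norm (y - z); have := ler_norm (z - y); rewrite [`|z - y|]distrC => H1 H2.
  by rewrite ler_norml; apply/andP; split; lra.
rewrite meanD meanZ (mean_cst _ Pp) lerD2r ler_pdivrMl//.
apply: (le_trans (mean_count_dev c)).
by rewrite -ler_pdivrMr ?invr_gt0// invrK mulrC.
Qed.

(** Given the vector of quotients the empirical distribution is still close
    to Q. The quotients carry little information: a weighted union bound over
    their values, in the style of Donsker and Varadhan, costs a bounded
    amount per cell. *)
Lemma mean_cdev_chernoff (eta th : R) : 0 < eta -> 0 < th ->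
  (forall c, eta * Num.sqrt (n%:R * cellp c) <= (mm c)%:R) ->
  th * mean P (fun w => \sum_x `|cdev w x|) <=
    #|C|%:R * (eta^-1 + 4) + th ^+ 2 * (2 * n%:R)^-1.
Proof.
move=> eta0 th0 etam.
(* Signs that depend on w only through the quotients turn the L1 norm into the
   mean of a linear statistic. *)
pose sg (y : {ffun C -> 'I_K}) (x : X) : R :=
  if [pick w | quot w == y] is Some w then Num.sg (cdev w x) else 0.
have sg1 y x : `|sg y x| <= 1.
  by rewrite /sg; case: pickP => [w _|_]; rewrite ?normr0// normr_sg lern1 leq_b1.
have sgE w x : `|cdev w x| = sg (quot w) x * cdev w x.
  rewrite /sg; case: pickP => [v /eqP vw|/(_ w)]; last by rewrite eqxx.
  by rewrite /cdev (eq_cmean _ _ vw) -normrEsg.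
pose g y w := \sum_x sg y x * dev w x.
have -> : mean P (fun w => \sum_x `|cdev w x|) = mean P (fun w => g (quot w) w).
  rewrite !mean_sum; apply: eq_bigr => x _.
  rewrite -(mean_cmean quot Pp (fun y => sg y x)).
  by apply: eq_mean => w; rewrite sgE.
(* A vector of quotients gets the weight expR (- pen), which decreases with its
   distance to the vector b of typical quotients. *)
pose b c := Num.truncn (n%:R * cellp c / (mm c)%:R).
pose pen y := \sum_c `|(y c : 'I_K)%:R - (b c)%:R| : R.
rewrite -lerBlDr -meanZ.
have H1 : mean P (fun w => pen (quot w)) <= #|C|%:R * (eta^-1 + 2).
  rewrite /pen mean_sum mulr_natl -sumr_const; apply: ler_sum => c _.
  exact: mean_quot_dev.
suff : mean P (fun w => th * g (quot w) w - pen (quot w)) <=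
    #|C|%:R * 2 + th ^+ 2 * (2 * n%:R)^-1.
  rewrite meanB; move: H1; set a := mean _ _; set a' := mean _ _.
  by rewrite !mulrDr; lra.
rewrite -ler_expR; apply: (le_trans (expR_mean_le _ Pp)).
have H2 : mean P (fun w => expR (th * g (quot w) w - pen (quot w))) <=
    \sum_(y : {ffun C -> 'I_K}) expR (- pen y) * mean P (fun w => expR (th * g y w)).
  under [leRHS]eq_bigr do rewrite -meanZ.
  rewrite -mean_sum; apply: (ler_mean Pp) => w _.
  rewrite (bigD1 (quot w))//= -expRD [th * _ - _]addrC lerDl.
  by apply: sumr_ge0 => y _; apply: mulr_ge0; exact: expR_ge0.
apply: (le_trans H2).
have gmgf y : mean P (fun w => expR (th * g y w)) <= expR (th ^+ 2 * (2 * n%:R)^-1).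
  pose c j : R := if D j then 2 / n%:R else 0.
  have gE w : g y w = n%:R^-1 * \sum_(j | D j) sg y (w j) - \sum_x sg y x * Q x.
    by rewrite -sum_emp -sumrB; apply: eq_bigr => x _; rewrite mulrBr.
  have gc : bounded_diff c (g y).
    move=> w j t; rewrite !gE opprB addrA subrK -mulrBr -sumrB /c.
    case: ifP => Dj; last first.
      rewrite big1 ?mulr0 ?normr0// => i Di; rewrite ffunE.
      by case: eqP => [ij|]; rewrite ?subrr//; rewrite ij Dj in Di.
    rewrite (bigD1 j)//= big1 ?addr0; last first.
      by move=> i /andP[_ /negPf ij]; rewrite ffunE ij subrr.
    rewrite ffunE eqxx normrM ger0_norm ?invr_ge0// mulrC ler_pM2r ?invr_gt0//.
    by apply: (le_trans (ler_normB _ _)); rewrite (_ : 2 = 1 + 1)// lerD.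
  have g0 : mean P (g y) = 0.
    rewrite /g mean_sum big1// => x _.
    by rewrite meanZ meanB mean_emp (mean_cst _ Pp) subrr mulr0.
  have := mcdiarmid_mgf Qp' th gc; rewrite g0.
  rewrite (eq_mean _ (h := fun w => expR (th * g y w))) => [|w]; last by rewrite subr0.
  move/le_trans; apply; rewrite ler_expR.
  have -> : \sum_a c a ^+ 2 = n%:R * (2 / n%:R) ^+ 2.
    rewrite mulr_natl -Dn -sumr_const [RHS]big_mkcond/=; apply: eq_bigr => j _.
    by rewrite /c unfold_in; case: (D j); rewrite ?Dn ?expr0n.
  by rewrite le_eqVlt; apply/orP; left; apply/eqP; field; rewrite gt_eqF.
apply: (@le_trans _ _ (\sum_(y : {ffun C -> 'I_K}) expR (- pen y) * expR (th ^+ 2 * (2 * n%:R)^-1))).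
  by apply: ler_sum => y _; rewrite ler_pM2l ?expR_gt0.
rewrite -mulr_suml expRD ler_pM2r ?expR_gt0//.
have -> : \sum_(y : {ffun C -> 'I_K}) expR (- pen y) =
    \prod_(c : C) \sum_(t < K) expR (- `|t%:R - (b c)%:R|) :> R.
  rewrite bigA_distr_bigA/=; apply: eq_bigr => y _.
  by rewrite /pen -sumrN expR_sum.
rewrite expRM_natl -prodr_const; apply: ler_prod => c _.
rewrite (le_trans (sum_expR_dist_le _ _)) ?three_le_expR2// andbT.
by apply: sumr_ge0 => t _; exact: expR_ge0.
Qed.

Lemma mean_cdev_le (eta : R) : 0 < eta ->
  (forall c, eta * Num.sqrt (n%:R * cellp c) <= (mm c)%:R) ->
  mean P (fun w => \sum_x `|cdev w x|) <=
    2 * Num.sqrt (#|C|%:R * (eta^-1 + 4) * (2 * n%:R)^-1).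
Proof.
move=> eta0 etam; apply: le_sqrt_of_chernoff.
- by rewrite mulr_ge0// addr_ge0// invr_ge0 ltW.
- by rewrite invr_gt0 mulr_gt0.
by move=> th th0; exact: mean_cdev_chernoff.
Qed.

End Block.

(** * Dithered remainders *)

Section Dither.
Context {R : realType}.

Lemma mean_mean (T U : finType) (p : T -> R) (q : U -> R) (F : T -> U -> R) :
  mean p (fun t => mean q (F t)) = mean q (fun u => mean p (F^~ u)).
Proof.
transitivity (\sum_t \sum_u p t * q u * F t u).
  by apply: eq_bigr => t _; rewrite mulr_sumr; apply: eq_bigr => u _; rewrite mulrA.
rewrite exchange_big; apply: eq_bigr => u _; rewrite mulr_sumr.
by apply: eq_bigr => t _; rewrite mulrA [q u * p t]mulrC.
Qed.

Variables (M : nat).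

Definition unif (k : nat) (t : 'I_M) : R := (t < k)%N%:R / k%:R.

Lemma mean_unif k (F : nat -> R) : (k <= M)%N ->
  mean (unif k) (fun t => F t) = k%:R^-1 * \sum_(t < k) F t.
Proof.
move=> kM; rewrite (big_ord_widen _ F kM) big_mkcond mulr_sumr/=.
apply: eq_bigr => t _; rewrite /unif; case: (t < k)%N.
  by rewrite mul1r.
by rewrite !mul0r mulr0.
Qed.

Lemma unif_pmf k : (0 < k <= M)%N -> pmf (unif k).
Proof.
move=> /andP[k0 kM]; split=> [t|]; first by rewrite divr_ge0.
have := mean_unif (fun=> 1) kM; rewrite sumr_const card_ord mulVf ?pnatr_eq0 -?lt0n//.
by rewrite /mean => <-; apply: eq_bigr => t _; rewrite mulr1.
Qed.

(** A uniformly dithered remainder is uniform, whatever the dividend. *)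
Lemma mean_unif_modn k N (F : nat -> R) : (0 < k <= M)%N ->
  mean (unif k) (fun t => F ((N + t) %% k)%N) = k%:R^-1 * \sum_(t < k) F t.
Proof.
move=> /andP[k0 kM]; rewrite (mean_unif (fun t => F ((N + t) %% k)%N) kM); congr (_ * _).
pose h (t : 'I_k) := Ordinal (ltn_pmod (N + t) k0).
have hI : injective h.
  move=> a b /(congr1 val)/= /eqP; rewrite eqn_modDl !modn_small// => /eqP.
  exact: val_inj.
by rewrite [RHS](reindex_inj hI).
Qed.

Lemma sum_ord_nat k : \sum_(t < k) t%:R = k%:R * (k%:R - 1) / 2 :> R.
Proof.
elim: k => [|k IH]; first by rewrite big_ord0 mul0r mul0r.
by rewrite big_ord_recr/= IH -natr1; field.
Qed.

Lemma mgf_unif_modn k N (th : R) : (0 < k <= M)%N ->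
  mean (unif k) (fun t => expR (th * (((N + t) %% k)%:R - (k%:R - 1) / 2)))
  <= expR (th ^+ 2 * (k%:R - 1) ^+ 2 / 8).
Proof.
move=> kM; have [k0 _] := andP kM.
have E : mean (unif k) (fun t => ((N + t) %% k)%:R) = (k%:R - 1) / 2.
  rewrite (mean_unif_modn N (fun t => t%:R) kM) sum_ord_nat.
  by field; rewrite pnatr_eq0 -lt0n.
rewrite -E; apply: (hoeffding_lemma (a := 0) th (unif_pmf kM)) => t _.
rewrite add0r ler0n/= -(natrB R k0) ler_nat subn1 -ltnS prednK//.
exact: ltn_pmod.
Qed.

Context {J X G : finType}.
Variables (Q : X -> R) (mm : G -> nat).
Hypothesis Qp : pmf Q.
Hypothesis mmM : forall g, (0 < mm g <= M)%N.

Local Notation P := (prodw (fun _ : J => Q)).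
Local Notation PU := (prodw (fun g => unif (mm g))).

Lemma dither_support (u : {ffun G -> 'I_M}) g : 0 < PU u -> (u g < mm g)%N.
Proof.
apply: contraTT => ug; rewrite /prodw (bigD1 g)//= /unif (negPf ug).
by rewrite !mul0r ltxx.
Qed.

(** The dither is independent of the sample. Once it is averaged out, the
    remainders have contributed as if they were independent of each other and
    of the sample. *)
Lemma mgf_dithered (a : J -> X -> R) (lo r : J -> R) (b : G -> R)
    (N : G -> {ffun J -> X} -> nat) :
  (forall j, mean Q (a j) = 0) ->
  (forall j x, lo j <= a j x <= lo j + r j) ->
  mean PU (fun u => mean P (fun w => expR (\sum_j a j (w j) +
    \sum_g b g * (((N g w + u g) %% mm g)%:R - ((mm g)%:R - 1) / 2)))) <=
  expR ((\sum_j r j ^+ 2 + \sum_g b g ^+ 2 * ((mm g)%:R - 1) ^+ 2) / 8).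
Proof.
move=> a0 ar; have Qp' (j : J) : pmf Q by [].
rewrite mean_mean; set S := \sum_g _ * _.
apply: (@le_trans _ _ (mean P (fun w => expR (S / 8) * \prod_j expR (a j (w j))))).
  apply: (ler_mean (prodw_pmf Qp')) => w _.
  rewrite -expR_sum mulrC.
  under [leLHS]eq_mean do rewrite expRD.
  rewrite meanZ ler_pM2l ?expR_gt0//.
  under [leLHS]eq_mean do rewrite expR_sum.
  rewrite (mean_prod _ (fun g (t : 'I_M) => expR (b g * (((N g w + t) %% mm g)%:R - ((mm g)%:R - 1) / 2)))).
  rewrite /S mulr_suml expR_sum; apply: ler_prod => g _.
  rewrite mgf_unif_modn// andbT; apply: mean_ge0 => t; last exact: expR_ge0.
  by case: (unif_pmf (mmM g)).
rewrite meanZ (mean_prod _ (fun j x => expR (a j x))) addrC mulrDl expRD ler_pM2l ?expR_gt0//.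
rewrite mulr_suml expR_sum; apply: ler_prod => j _.
apply/andP; split; first by apply: mean_ge0 => x; [case: Qp|exact: expR_ge0].
have := hoeffding_lemma 1 Qp (fun x _ => ar j x); rewrite expr1n mul1r a0.
by apply: le_trans; apply: ler_mean => // x _; rewrite mul1r subr0.
Qed.

End Dither.

Section CenteredMgf.
Context {R : realType} {J X U : finType} {B : eqType}.
Variables (q : J -> X -> R) (pU : U -> R) (blk : J -> B) (r : seq B).
Variables (Z : B -> U -> eqType) (Y : forall b u, {ffun J -> X} -> Z b u).
Variable V : B -> U -> {ffun J -> X} -> R.
Hypothesis qp : forall j, pmf (q j).
Hypothesis pUp : pmf pU.
Hypothesis ur : uniq r.
Hypothesis Vb : forall b u, depends_on (fun j => blk j == b) (V b u).
Hypothesis Yb : forall b u (w v : {ffun J -> X}), (forall j, blk j == b -> w j = v j) -> Y b u w = Y b u v.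

Local Notation P := (prodw q).

(** Centering each block at its conditional expectation costs a factor two in
    the exponent: the conditional expectations are independent across blocks,
    and taking them does not increase exponential moments. *)
Lemma mgf_cmean_centered (E : R) :
  mean pU (fun u => mean P (fun w => expR (2 * \sum_(b <- r) V b u w))) <= E ->
  mean pU (fun u => mean P (fun w => expR (- 2 * \sum_(b <- r) V b u w))) <= E ->
  mean pU (fun u => mean P (fun w =>
    expR (\sum_(b <- r) (V b u w - cmean P (Y b u) (V b u) w)))) <= E.
Proof.
move=> E1 E2; have Pp := prodw_pmf qp.
pose c b u w := cmean P (@Y b u) (V b u) w.
have E3 : mean pU (fun u => mean P (fun w => expR (- 2 * \sum_(b <- r) c b u w))) <= E.
  apply: le_trans E2; apply: (ler_mean pUp) => u _.
  have prodE (W : B -> {ffun J -> X} -> R) : (forall b, depends_on (fun j => blk j == b) (W b)) ->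
      mean P (fun w => expR (- 2 * \sum_(b <- r) W b w)) =
      \prod_(b <- r) mean P (fun w => expR (- 2 * W b w)).
    move=> Wb; rewrite -(mean_indep qp (blk := blk) (g := fun b w => expR (- 2 * W b w)) ur).
      by apply: eq_mean => w; rewrite mulr_sumr expR_sum.
    by move=> b w v wv; rewrite (Wb b w v wv).
  rewrite (prodE (fun b => c b u)) => [|b w v wv]; last exact/eq_cmean/Yb.
  rewrite (prodE (fun b => V b u))//; apply: ler_prod => b _.
  rewrite mean_ge0; [|by case: Pp|by move=> w; exact: expR_ge0].
  rewrite (le_trans _ (mean_expR_cmean (@Y b u) Pp _))//.
  by apply: (ler_mean Pp) => w _; rewrite cmeanZ.
apply: (@le_trans _ _ (2^-1 * (
   mean pU (fun u => mean P (fun w => expR (2 * \sum_(b <- r) V b u w))) +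
   mean pU (fun u => mean P (fun w => expR (- 2 * \sum_(b <- r) c b u w)))))); last first.
  by move: E1 E3; lra.
rewrite -meanD -meanZ; apply: (ler_mean pUp) => u _.
rewrite -meanD -meanZ; apply: (ler_mean Pp) => w _.
rewrite sumrB; set x := \sum_(b <- r) V b u w; set y := \sum_(b <- r) _.
have -> : 2 * x = x + x by ring.
have -> : - 2 * y = - y + - y by ring.
rewrite !expRD; have := sqr_ge0 (expR x - expR (- y)); rewrite sqrrB; lra.
Qed.

End CenteredMgf.

(** * A consistent signed family close to the empirical one *)

Section Target.
Context {R : realType} {d : nat} {m : 'I_d -> nat}.
Local Notation X := (coords m [set: 'I_d]).
Variables (x0 : X) (SS : {set {set 'I_d}}) (n : {set 'I_d} -> nat).
Variables (Q : X -> R) (eta : R).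
Hypothesis Qp : pmf Q.
Hypothesis n_gt0 : forall S, S \in SS -> (0 < n S)%N.
Hypothesis eta_gt0 : 0 < eta.
Implicit Types (S T : {set 'I_d}) (z x : X).

Local Notation J := {S : {set 'I_d} & 'I_(n S)}.
Local Notation cell := ({set 'I_d} * X)%type.
Implicit Types (w : {ffun J -> X}).
Local Notation P := (prodw (fun _ : J => Q)).

Definition block S : pred J := fun j => tag j == S.

Lemma sum_block S (V : nmodType) (F : J -> V) :
  \sum_(j | block S j) F j = \sum_(i < n S) F (Tagged (fun S => 'I_(n S)) i).
Proof.
transitivity (\sum_(S' | S' == S) \sum_(i < n S') F (Tagged (fun S => 'I_(n S)) i)).
  rewrite (sig_big_dep (fun S' => S' == S) (fun S' i => true)
    (fun S' i => F (Tagged (fun S => 'I_(n S)) i)))/=.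
  by apply: eq_big => [j|[S' i] _] //=; rewrite andbT.
by rewrite big_pred1_eq.
Qed.

Lemma card_block S : #|block S| = n S.
Proof. by rewrite -sum1_card (sum_block S (fun=> 1%N)) sum1_card card_ord. Qed.

Lemma sum_sqr_by_block (h : {set 'I_d} -> R) :
  \sum_(j : J) (if tag j \in SS then h (tag j) / (n (tag j))%:R else 0) ^+ 2 =
  \sum_(S in SS) h S ^+ 2 / (n S)%:R.
Proof.
rewrite (bigID (fun j => tag j \in SS))/= [X in _ + X]big1 ?addr0; last first.
  by move=> j /negPf ->; rewrite expr0n.
rewrite (partition_big (fun j : J => tag j) (fun S => S \in SS))//=.
apply: eq_bigr => S SSS.
have nS0 : (n S)%:R != 0 :> R by rewrite pnatr_eq0 -lt0n n_gt0.
rewrite (eq_bigr (fun=> (h S / (n S)%:R) ^+ 2)); last first.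
  by move=> j /andP[-> /eqP ->].
rewrite (eq_bigl (block S)); last first.
  by move=> j; rewrite /block; case: (eqVneq (tag j) S) => [->|_]; rewrite ?SSS ?andbF.
by rewrite sumr_const (card_block S) -[LHS]mulr_natl; field.
Qed.

Definition nbr S : seq {set 'I_d} :=
  [seq S' <- enum SS | (S' != S) && (S :&: S' != finset.set0)].

Lemma mem_nbr S S' : (S' \in nbr S) = [&& S' \in SS, S' != S & S :&: S' != finset.set0].
Proof. by rewrite mem_filter mem_enum andbC. Qed.

Lemma nbr_uniq S : uniq (nbr S).
Proof. exact/filter_uniq/enum_uniq. Qed.

Lemma size_nbr S : S \in SS -> (size (nbr S) <= #|SS|.-1)%N.
Proof.
move=> SSS; rewrite (cardsD1 S SS) SSS add1n/=.
rewrite cardE; apply: uniq_leq_size; first exact: nbr_uniq.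
by move=> S'; rewrite mem_nbr mem_enum !inE => /and3P[-> ->].
Qed.

Definition inter S S' := S :&: S'.

(** A point fixed by the projection onto T stands for a cell of the
    T-marginal. *)
Definition cells S : {pred cell} :=
  [pred c | (c.1 \in nbr S) && (proj x0 (S :&: c.1) c.2 == c.2)].

Definition cellT S : finType := {c : cell | c \in cells S}.

Lemma card_fixed T : #|[pred z | proj x0 T z == z]| = #|coords m T|.
Proof.
rewrite -(card_codom (can_inj (@embK d m x0 T))); apply: eq_card => z.
rewrite !inE; apply/eqP/codomP => [<-|[y ->]]; first by exists (rst T z); rewrite emb_rst.
by rewrite -emb_rst embK.
Qed.

Lemma sum_cellT S (F : cell -> R) : \sum_(c : cellT S) F (val c) =
  \sum_(S' <- nbr S) \sum_(z | proj x0 (S :&: S') z == z) F (S', z).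
Proof.
rewrite -(big_sub (cells S)) big_uniq ?nbr_uniq//= pair_big_dep/=.
by apply: eq_big => [c|[S' z] _] //.
Qed.

Lemma card_cellT S : #|cellT S|%:R = \sum_(S' <- nbr S) #|coords m (S :&: S')|%:R :> R.
Proof.
transitivity (\sum_(c : cellT S) 1 : R); first by rewrite sumr_const.
rewrite (sum_cellT S (fun=> 1)); apply: eq_bigr => S' _.
by rewrite sumr_const -card_fixed.
Qed.

(** The counts are rounded to multiples of this width, which is about a
    fraction eta of their standard deviation. *)
Definition width (g : {set 'I_d} * cell) : nat :=
  (Num.truncn (eta * Num.sqrt ((n g.1)%:R * pf x0 (g.1 :&: g.2.1) Q g.2.2))).+1.

Lemma pfQ_ge0 T z : 0 <= pf x0 T Q z.
Proof. by apply: sumr_ge0 => y _; case: Qp. Qed.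

Lemma width_itv g : (width g)%:R - 1 <=
  eta * Num.sqrt ((n g.1)%:R * pf x0 (g.1 :&: g.2.1) Q g.2.2) <= (width g)%:R.
Proof.
set r := eta * _; have r0 : 0 <= r by rewrite mulr_ge0 ?sqrtr_ge0 ?(ltW eta_gt0).
by have /andP[h1 /ltW h2] := truncn_itv r0; rewrite h2 andbT -natr1 addrK.
Qed.

Variable u : {set 'I_d} * cell -> nat.
Hypothesis u_lt : forall g, (u g < width g)%N.

Definition cellA S (c : cellT S) : pred X :=
  fun x => proj x0 (S :&: (val c).1) x == (val c).2.
Definition cwidth S (c : cellT S) := width (S, val c).
Definition cu S (c : cellT S) := u (S, val c).

Definition count (g : {set 'I_d} * cell) w : nat :=
  (\sum_(j | block g.1 j) (proj x0 (g.1 :&: g.2.1) (w j) == g.2.2))%N.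

Definition remainder g w : nat := ((count g w + u g) %% width g)%N.

Definition quots S w := quot (block S) (n S) (@cellA S) (@cwidth S) (@cu S) w.

(** The conditional expectation corr absorbs the part of the deviation that the
    rounded counts can predict. In the marginals of the residual res only the
    remainders are left, so that removing these marginals is cheap. *)
Definition empS S w : X -> R := emp (block S) (n S) w.
Definition corr S w : X -> R := cdev Q (block S) (n S) (@cellA S) (@cwidth S) (@cu S) w.
Definition res S w x := dev Q (block S) (n S) w x - corr S w x.
Definition target S w x := Q x + drop_marg x0 (inter S) (nbr S) (res S w) x.

Lemma mass_res S w : S \in SS -> \sum_x res S w x = 0.
Proof.
move=> SSS; rewrite sumrB mass_dev ?mass_cdev ?subr0//;
  by [exact: card_block|exact: n_gt0].
Qed.

Lemma mass_target S w : S \in SS -> \sum_x target S w x = 1.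
Proof. by move=> SSS; rewrite big_split/= mass_drop_marg ?mass_res// Qp.2 addr0. Qed.

(** All marginals on intersections are those of Q. *)
Lemma target_consistent S1 S2 w : S1 \in SS -> S2 \in SS -> S1 != S2 ->
  S1 :&: S2 != finset.set0 ->
  pf x0 (S1 :&: S2) (target S1 w) = pf x0 (S1 :&: S2) (target S2 w).
Proof.
move=> S1S S2S ne S12; apply/funext => x.
have H S S' T : T = inter S S' -> S' \in nbr S ->
    pf x0 T (target S w) x = pf x0 T Q x.
  move=> -> S'n; rewrite pfD /=.
  have -> := pf_drop_marg x0 (inter S) (res S w) S'n.
  exact: addr0.
have n2 : S2 \in nbr S1 by rewrite mem_nbr S2S S12 eq_sym ne.
have n1 : S1 \in nbr S2 by rewrite mem_nbr S1S ne finset.setIC S12.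
exact: etrans (H _ _ _ erefl n2) (esym (H _ _ _ (finset.setIC _ _) n1)).
Qed.

Lemma cellp_pf S (c : cellT S) :
  cellp Q (@cellA S) c = pf x0 (S :&: (val c).1) Q (val c).2.
Proof.
rewrite /cellp /mean /pf [RHS]big_mkcond/=; apply: eq_bigr => x _.
by rewrite /cellA; case: eqP; rewrite ?mulr1 ?mulr0.
Qed.

Lemma pf_res S S' z w : S \in SS -> S' \in nbr S -> 0 < P w ->
  pf x0 (S :&: S') (res S w) z =
  if proj x0 (S :&: S') z == z then
    (n S)%:R^-1 * ((remainder (S, (S', z)) w)%:R -
       cmean P (quots S) (fun v => (remainder (S, (S', z)) v)%:R) w)
  else 0.
Proof.
move=> SSS S'n Pw; case: ifPn => [zz|zz].
  have cP : (S', z) \in cells S by rewrite inE /= S'n zz.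
  pose c : cellT S := exist _ (S', z) cP.
  have := dev_cell (@cellA S) (@cwidth S) (@cu S) Qp (card_block S) c Pw.
  rewrite /pf /res => <-; exact: eq_bigl.
rewrite /pf big1// => x /eqP xz.
by move: zz; rewrite -xz proj_idem eqxx.
Qed.

Lemma remainder_le g w : (0 : R) <= ((remainder g w)%:R : R) <= ((width g)%:R - 1 : R).
Proof.
rewrite ler0n/= /width -natr1 addrK ler_nat -ltnS; exact: ltn_pmod.
Qed.

Lemma sum_pf_le1 T : \sum_(z | proj x0 T z == z) pf x0 T Q z <= 1.
Proof.
rewrite -Qp.2 -(mass_pf x0 T Q) [leRHS](bigID (fun z => proj x0 T z == z))/= lerDl.
by apply: sumr_ge0 => z _; exact: pfQ_ge0.
Qed.

(** Cauchy-Schwarz, since the sum of the probabilities is at most 1. *)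
Lemma sum_sqrt_pf T : \sum_(z | proj x0 T z == z) Num.sqrt (pf x0 T Q z) <=
  Num.sqrt #|coords m T|%:R.
Proof.
set K := #|coords m T|.
have K0 : (0 < K)%N by apply/card_gt0P; exists (rst T x0).
have s0 : 0 < Num.sqrt K%:R :> R by rewrite sqrtr_gt0 ltr0n.
have sK : Num.sqrt K%:R ^+ 2 = K%:R :> R by rewrite sqr_sqrtr.
apply: (@le_trans _ _ (\sum_(z | proj x0 T z == z)
    (Num.sqrt K%:R * pf x0 T Q z + (Num.sqrt K%:R)^-1) / 2)).
  apply: ler_sum => z _; set p := pf _ _ _ _.
  have p0 : Num.sqrt p ^+ 2 = p by rewrite sqr_sqrtr ?pfQ_ge0.
  set r := Num.sqrt K%:R in s0 *; set y := Num.sqrt p in p0 *.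
  rewrite -p0 -(ler_pM2l s0) -subr_ge0.
  have -> : r * ((r * y ^+ 2 + r^-1) / 2) - r * y = (r * y - 1) ^+ 2 / 2.
    by field; rewrite gt_eqF.
  by rewrite divr_ge0// sqr_ge0.
rewrite -mulr_suml big_split/= -mulr_sumr sumr_const card_fixed -/K.
have -> : (Num.sqrt K%:R)^-1 *+ K = Num.sqrt K%:R :> R.
  rewrite -[LHS]mulr_natr -[X in _ * X]sK expr2 mulKf// gt_eqF//.
have := ler_wpM2l (ltW s0) (sum_pf_le1 T); lra.
Qed.

Lemma sum_pf_res_le S S' w : S \in SS -> S' \in nbr S -> 0 < P w ->
  \sum_z `|pf x0 (S :&: S') (res S w) z| <=
    eta * Num.sqrt (#|coords m (S :&: S')|%:R / (n S)%:R).
Proof.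
move=> SSS S'n Pw; have Pp : pmf P by exact: prodw_pmf.
have nS0 : 0 < (n S)%:R :> R by rewrite ltr0n n_gt0.
apply: (@le_trans _ _ (\sum_(z | proj x0 (S :&: S') z == z)
    (n S)%:R^-1 * (eta * Num.sqrt (n S)%:R * Num.sqrt (pf x0 (S :&: S') Q z)))).
  rewrite [leRHS]big_mkcond/=; apply: ler_sum => z _; rewrite pf_res//.
  case: ifP => _; last by rewrite normr0.
  rewrite normrM ger0_norm ?invr_ge0 ?(ltW nS0)// ler_pM2l ?invr_gt0//.
  have /andP[h1 _] := width_itv (S, (S', z)).
  rewrite -mulrA -sqrtrM ?(ltW nS0)//; apply: le_trans h1.
  have /andP[r1 r2] := remainder_le (S, (S', z)) w.
  set c := cmean _ _ _ _.
  have c0 : 0 <= c.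
    rewrite -(cmean_fun (quots S) Pp (fun=> 0) Pw).
    by apply: (ler_cmean (quots S) Pp) => v _; case/andP: (remainder_le (S, (S', z)) v).
  have c1 : c <= (width (S, (S', z)))%:R - 1.
    rewrite -(cmean_fun (quots S) Pp (fun=> (width (S, (S', z)))%:R - 1) Pw).
    by apply: (ler_cmean (quots S) Pp) => v _; case/andP: (remainder_le (S, (S', z)) v).
  by rewrite ler_norml; apply/andP; split; lra.
rewrite -mulr_sumr -mulr_sumr.
apply: (@le_trans _ _ ((n S)%:R^-1 * (eta * Num.sqrt (n S)%:R * Num.sqrt #|coords m (S :&: S')|%:R))).
  rewrite ler_pM2l ?invr_gt0// ler_wpM2l ?sum_sqrt_pf//.
  by rewrite mulr_ge0 ?sqrtr_ge0 ?(ltW eta_gt0).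
have s0 : 0 < Num.sqrt (n S)%:R :> R by rewrite sqrtr_gt0.
rewrite sqrtrM ?ler0n// sqrtrV ?ler0n//.
rewrite -{1}[(n S)%:R]sqr_sqrtr ?ler0n// le_eqVlt; apply/orP; left; apply/eqP.
by field; rewrite gt_eqF.
Qed.

(** Two families of equal mass: the negative part of the difference is half of
    its L1 norm. *)
Lemma neg_part_le S w : S \in SS -> 0 < P w ->
  \sum_x Num.max (empS S w x - target S w x) 0 <=
  2^-1 * (\sum_x `|corr S w x| + 2 ^+ size (nbr S) *
    \sum_(S' <- nbr S) eta * Num.sqrt (#|coords m (S :&: S')|%:R / (n S)%:R)).
Proof.
move=> SSS Pw.
pose h x := empS S w x - target S w x.
have h0 : \sum_x h x = 0.
  by rewrite sumrB mass_target// mass_emp ?subrr//; [exact: card_block|exact: n_gt0].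
have hE x : h x = corr S w x + (res S w x - drop_marg x0 (inter S) (nbr S) (res S w) x).
  by rewrite /h /target {2}/res /dev /empS; ring.
have maxE x : Num.max (h x) 0 = 2^-1 * (`|h x| + h x).
  by case: (lerP (h x) 0) => [hx|/ltW hx]; [rewrite ler0_norm|rewrite ger0_norm]; lra.
have -> : \sum_x Num.max (empS S w x - target S w x) 0 = 2^-1 * \sum_x `|h x|.
  transitivity (2^-1 * (\sum_x `|h x| + \sum_x h x)); last by rewrite h0 addr0.
  rewrite -big_split mulr_sumr.
  by apply: eq_bigr => x _; rewrite -maxE.
rewrite ler_pM2l//.
apply: (@le_trans _ _ (\sum_x (`|corr S w x| +
    `|res S w x - drop_marg x0 (inter S) (nbr S) (res S w) x|))).
  by apply: ler_sum => x _; rewrite hE ler_normD.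
rewrite big_split/= lerD2l.
pose k x := res S w x - drop_marg x0 (inter S) (nbr S) (res S w) x.
pose f x := Num.sg (k x).
have -> : \sum_x `|res S w x - drop_marg x0 (inter S) (nbr S) (res S w) x| =
    \sum_(S' <- nbr S) \sum_z cell_weight x0 (inter S) (nbr S) f S' z * pf x0 (inter S S') (res S w) z.
  transitivity (\sum_x f x * k x); first by apply: eq_bigr => x _; rewrite /f -normrEsg.
  under eq_bigr do rewrite mulrBr.
  by rewrite sumrB sum_drop_marg ?nbr_uniq// opprB addrC subrK.
rewrite mulr_sumr [leLHS]big_seq [leRHS]big_seq; apply: ler_sum => S' S'n.
apply: (@le_trans _ _ (\sum_z 2 ^+ size (nbr S) * `|pf x0 (inter S S') (res S w) z|)).
  apply: ler_sum => z _; apply: (le_trans (ler_norm _)); rewrite normrM ler_wpM2r//.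
  rewrite -[leRHS]mulr1; apply: cell_weight_le => x.
  by rewrite /f normr_sg lern1 leq_b1.
by rewrite -mulr_sumr ler_wpM2l ?exprn_ge0// sum_pf_res_le.
Qed.

Lemma mean_corr_le S : S \in SS ->
  mean P (fun w => \sum_x `|corr S w x|) <=
  2 * Num.sqrt (#|cellT S|%:R * (eta^-1 + 4) * (2 * (n S)%:R)^-1).
Proof.
move=> SSS; apply: (mean_cdev_le Qp (card_block S) (n_gt0 SSS)) => //.
  by move=> c; exact: u_lt.
by move=> c; rewrite cellp_pf; have /andP[_] := width_itv (S, val c).
Qed.

End Target.

(** * Dual values of the consistent family *)

Section Arithmetic.
Context {R : realType}.

(** The squared range of the term of mgf_stat for one remainder, with weight k
    and width 1 + wd, in a cell of probability p. *)
Lemma sqr_noise_le (W eta s k wd nn p c : R) :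
  0 < nn -> 0 <= p -> 0 <= s -> 0 <= eta -> W * eta <= 2^-1 ->
  `|k| <= W * (s / 2) -> 0 <= wd <= eta * Num.sqrt (nn * p) ->
  (c / nn * k) ^+ 2 * wd ^+ 2 <= nn^-1 * ((c * s) ^+ 2 / 16) * p.
Proof.
move=> nn0 p0 s0 eta0 Weta kW /andP[wd0 wd1].
set q := Num.sqrt _ in wd1.
have q0 : 0 <= q by exact: sqrtr_ge0.
have q2 : q ^+ 2 = nn * p by rewrite sqr_sqrtr// mulr_ge0// ltW.
clearbody q.
have kwd : `|k| * wd <= s / 4 * q.
  apply: (@le_trans _ _ (W * (s / 2) * (eta * q))); first exact: ler_pM.
  rewrite mulrACA.
  have -> : s / 4 * q = 2^-1 * (s / 2 * q) by field.
  by rewrite ler_wpM2r// mulr_ge0// divr_ge0.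
have kwd2 : k ^+ 2 * wd ^+ 2 <= s ^+ 2 / 16 * (nn * p).
  have -> : k ^+ 2 * wd ^+ 2 = (`|k| * wd) ^+ 2 by rewrite exprMn real_normK ?num_real.
  have -> : s ^+ 2 / 16 * (nn * p) = (s / 4 * q) ^+ 2 by rewrite exprMn q2; field.
  by rewrite ler_sqr ?nnegrE ?mulr_ge0// divr_ge0.
have -> : (c / nn * k) ^+ 2 * wd ^+ 2 = (c / nn) ^+ 2 * (k ^+ 2 * wd ^+ 2) by ring.
have -> : nn^-1 * ((c * s) ^+ 2 / 16) * p = (c / nn) ^+ 2 * (s ^+ 2 / 16 * (nn * p)).
  by field; rewrite gt_eqF.
by rewrite ler_wpM2l// sqr_ge0.
Qed.

End Arithmetic.

Section TargetPairing.
Context {R : realType} {d : nat} {m : 'I_d -> nat}.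
Local Notation X := (coords m [set: 'I_d]).
Variables (x0 : X) (SS : {set {set 'I_d}}) (n : {set 'I_d} -> nat).
Variables (Q : X -> R) (eta : R) (f : fun_family R m).
Arguments f : clear implicits.
Hypothesis Qp : pmf Q.
Hypothesis n_gt0 : forall S, S \in SS -> (0 < n S)%N.
Hypothesis eta_gt0 : 0 < eta.
Local Notation s := (#|SS|%:R : R).
Hypothesis s_gt0 : (0 < #|SS|)%N.
Hypothesis fG : Gplus SS f.
Hypothesis fb : forall S, S \in SS -> forall x, -1 <= f S x <= s - 1.
Implicit Types (S T : {set 'I_d}) (z x : X).

Local Notation J := {S : {set 'I_d} & 'I_(n S)}.
Local Notation cell := ({set 'I_d} * X)%type.
Local Notation G := ({set 'I_d} * cell)%type.
Local Notation P := (prodw (fun _ : J => Q)).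
Local Notation width := (width x0 n Q eta).
Local Notation remainder := (remainder x0 Q eta).
Local Notation res := (res x0 SS Q eta).
Local Notation target := (target x0 SS Q eta).
Local Notation quots := (quots x0 SS Q eta).
Local Notation nbr := (nbr SS).
Implicit Types (w : {ffun J -> X}) (u : G -> nat).

Let s0 : 0 < s. Proof. by rewrite ltr0n. Qed.
Let Pp : pmf P. Proof. exact: prodw_pmf. Qed.

(** Measures of mass zero do not see the constant; s / 2 is the least sup norm
    that a function with range [-1, s - 1] can be shifted to. *)
Definition centered S x : R := f S (rst S x) - (s - 2) / 2.

Lemma centered_le S x : S \in SS -> `|centered S x| <= s / 2.
Proof.
by move=> SSS; have := fb SSS (rst S x); rewrite /centered ler_norml => /andP[? ?];
  apply/andP; split; lra.
Qed.

Definition weight S S' z : R := cell_weight x0 (inter S) (nbr S) (centered S) S' z.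

Lemma weight_le S S' z : S \in SS -> `|weight S S' z| <= 2 ^+ #|SS|.-1 * (s / 2).
Proof.
move=> SSS; apply: (@le_trans _ _ (2 ^+ size (nbr S) * (s / 2))).
  by apply: cell_weight_le => x; exact: centered_le.
rewrite ler_wpM2r ?divr_ge0 ?(ltW s0)// ler_weXn2l ?ler1n//.
exact: size_nbr.
Qed.

(** The pairing of f with the deviation, corrected by the remainders of the cell
    counts. The remainders are centered, as they are uniform under the dither. *)
Definition stat S u w : R :=
  \sum_x centered S x * dev Q (block S) (n S) w x -
  (n S)%:R^-1 * \sum_(S' <- nbr S) \sum_(z | proj x0 (S :&: S') z == z)
    weight S S' z * ((remainder u (S, (S', z)) w)%:R - ((width (S, (S', z)))%:R - 1) / 2).

(** Both the deviation and the remainders enter the residual only after their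
    conditional expectations are subtracted. *)
Lemma pairing_removed S u w : S \in SS -> 0 < P w ->
  \sum_x f S (rst S x) * drop_marg x0 (inter S) (nbr S) (res u S w) x =
  stat S u w - cmean P (quots u S) (stat S u) w.
Proof.
move=> SSS Pw.
have -> : \sum_x f S (rst S x) * drop_marg x0 (inter S) (nbr S) (res u S w) x =
    \sum_x centered S x * drop_marg x0 (inter S) (nbr S) (res u S w) x.
  rewrite /centered; under [RHS]eq_bigr do rewrite mulrBl.
  by rewrite sumrB -mulr_sumr mass_drop_marg ?mulr0 ?subr0// mass_res.
rewrite sum_drop_marg ?nbr_uniq//.
have -> : \sum_x centered S x * res u S w x =
    \sum_x centered S x * dev Q (block S) (n S) w x -
    cmean P (quots u S) (fun v => \sum_x centered S x * dev Q (block S) (n S) v x) w.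
  rewrite -sum_cdev -sumrB; apply: eq_bigr => x _.
  by rewrite -mulrBr.
pose h S' z := ((width (S, (S', z)))%:R - 1) / 2 : R.
pose rem S' z (v : {ffun J -> X}) : R := (remainder u (S, (S', z)) v)%:R - h S' z.
have -> : \sum_(S' <- nbr S) \sum_z
      cell_weight x0 (inter S) (nbr S) (centered S) S' z * pf x0 (inter S S') (res u S w) z =
    (n S)%:R^-1 * \sum_(S' <- nbr S) \sum_(z | proj x0 (S :&: S') z == z)
      weight S S' z * (rem S' z w - cmean P (quots u S) (rem S' z) w).
  rewrite mulr_sumr big_seq [RHS]big_seq; apply: eq_bigr => S' S'n.
  rewrite mulr_sumr [RHS]big_mkcond/=; apply: eq_bigr => z _.
  rewrite pf_res//; case: ifP => _; last by rewrite mulr0.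
  rewrite mulrCA; congr (_ * (_ * _)).
  have -> : cmean P (quots u S) (rem S' z) w =
      cmean P (quots u S) (fun v => (remainder u (S, (S', z)) v)%:R) w - h S' z.
    by rewrite /rem cmeanD (cmean_fun (quots u S) Pp (fun=> - h S' z) Pw).
  by rewrite /rem opprB addrA subrK.
have -> : cmean P (quots u S) (stat S u) w =
    cmean P (quots u S) (fun v => \sum_x centered S x * dev Q (block S) (n S) v x) w -
    (n S)%:R^-1 * \sum_(S' <- nbr S) \sum_(z | proj x0 (S :&: S') z == z)
      weight S S' z * cmean P (quots u S) (rem S' z) w.
  rewrite /stat cmeanD; congr (_ + _).
  transitivity (cmean P (quots u S) (fun v => - (n S)%:R^-1 *
      \sum_(S' <- nbr S) \sum_(z | proj x0 (S :&: S') z == z) weight S S' z * rem S' z v) w).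
    by rewrite /cmean; congr (_ / _); apply: eq_mean => v; rewrite mulNr.
  rewrite cmeanZ mulNr cmean_sum; congr (- (_ * _)); apply: eq_bigr => S' _.
  by rewrite cmean_sum; apply: eq_bigr => z _; rewrite cmeanZ.
have -> : \sum_(S' <- nbr S) \sum_(z | proj x0 (S :&: S') z == z)
      weight S S' z * (rem S' z w - cmean P (quots u S) (rem S' z) w) =
   \sum_(S' <- nbr S) \sum_(z | proj x0 (S :&: S') z == z) weight S S' z * rem S' z w -
   \sum_(S' <- nbr S) \sum_(z | proj x0 (S :&: S') z == z)
      weight S S' z * cmean P (quots u S) (rem S' z) w.
  rewrite -sumrB; apply: eq_bigr => S' _; rewrite -sumrB; apply: eq_bigr => z _.
  by rewrite mulrBr.
rewrite /stat mulrBr; rewrite -/(rem _ _); ring.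
Qed.

(** The contribution of Q to the dual value is nonpositive, since the members of
    the constant family Q are compatible. *)
Lemma Rdual_target_le u w : 0 < P w ->
  - (s^-1 * pairing SS (fun S => target u S w) f) <=
  \sum_(S <- enum SS) (- s^-1 * stat S u w -
     cmean P (quots u S) (fun v => - s^-1 * stat S u v) w).
Proof.
move=> Pw.
have Q0 : 0 <= pairing SS (fun=> Q) f.
  rewrite /pairing exchange_big/=; apply: sumr_ge0 => x _.
  by rewrite -mulr_suml mulr_ge0 ?fG.2//; case: Qp.
have -> : pairing SS (fun S => target u S w) f = pairing SS (fun=> Q) f +
    \sum_(S in SS) (stat S u w - cmean P (quots u S) (stat S u) w).
  rewrite -big_split; apply: eq_bigr => S SSS/=.
  rewrite -pairing_removed// -big_split; apply: eq_bigr => x _.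
  exact: mulrDr.
have -> : \sum_(S <- enum SS) (- s^-1 * stat S u w -
     cmean P (quots u S) (fun v => - s^-1 * stat S u v) w) =
   - s^-1 * \sum_(S in SS) (stat S u w - cmean P (quots u S) (stat S u) w).
  rewrite big_enum/= mulr_sumr; apply: eq_bigr => S _.
  by rewrite cmeanZ [RHS]mulrBr.
rewrite mulrDr opprD -mulNr -mulNr gerDr mulNr oppr_le0 mulr_ge0// invr_ge0.
Qed.

Hypothesis eta_small : 2 ^+ #|SS|.-1 * eta <= 2^-1.

Variable M : nat.
Hypothesis widthM : forall g, (width g <= M)%N.
Local Notation PU := (prodw (fun g : G => unif (M := M) (width g))).

Let inv_sizes : R := \sum_(S in SS) (n S)%:R^-1.

(** The constant is that of the empirical distributions alone, up to the factor
    1 + (s - 1) / 16 that pays for all remainders. *)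
Lemma mgf_stat (c : R) :
  mean PU (fun u : {ffun G -> 'I_M} => mean P (fun w =>
     expR (c * \sum_(S <- enum SS) stat S (fun g => u g) w))) <=
  expR ((c * s) ^+ 2 * inv_sizes * (1 + (s - 1) / 16) / 8).
Proof.
pose a (j : J) x : R := if tag j \in SS then
  c / (n (tag j))%:R * (centered (tag j) x - mean Q (centered (tag j))) else 0.
pose r (j : J) : R := if tag j \in SS then `|c| * s / (n (tag j))%:R else 0.
pose lo (j : J) : R := if tag j \in SS then
  - (`|c| / (n (tag j))%:R * (s / 2)) - c / (n (tag j))%:R * mean Q (centered (tag j)) else 0.
pose act (g : G) := (g.1 \in SS) && (g.2 \in cells x0 SS g.1).
pose b (g : G) : R := if act g then
  - (c / (n g.1)%:R * weight g.1 g.2.1 g.2.2) else 0.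
pose N (g : G) (w : {ffun J -> X}) := count x0 g w.
have widthM' g : (0 < width g <= M)%N by rewrite widthM.
have sum_act (F : G -> R) : \sum_(g | act g) F g =
    \sum_(S in SS) \sum_(S' <- nbr S) \sum_(z | proj x0 (S :&: S') z == z) F (S, (S', z)).
  transitivity (\sum_(S in SS) \sum_(e | e \in cells x0 SS S) F (S, e)).
    by rewrite pair_big_dep/=; apply: eq_big => [[S e]|[S e] _].
  apply: eq_bigr => S _; rewrite big_uniq ?nbr_uniq//= pair_big_dep/=.
  by apply: eq_big => [[S' z]|[S' z] _].
have E w (u : {ffun G -> 'I_M}) : c * \sum_(S <- enum SS) stat S (fun g => u g) w =
    \sum_j a j (w j) + \sum_g b g * (((N g w + u g) %% width g)%:R - ((width g)%:R - 1) / 2).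
  rewrite big_enum/= mulr_sumr.
  rewrite (eq_bigr (fun S => c * (\sum_x centered S x * dev Q (block S) (n S) w x) -
    c * ((n S)%:R^-1 * \sum_(S' <- nbr S) \sum_(z | proj x0 (S :&: S') z == z)
    weight S S' z * ((remainder (fun g => u g) (S, (S', z)) w)%:R -
      ((width (S, (S', z)))%:R - 1) / 2)))) => [|S _]; last exact: mulrBr.
  rewrite sumrB; congr (_ + _).
    transitivity (\sum_(S in SS) \sum_(j | block S j) a j (w j)).
      apply: eq_bigr => S SSS.
      have nS0 : (n S)%:R != 0 :> R by rewrite pnatr_eq0 -lt0n n_gt0.
      transitivity (c / (n S)%:R * \sum_(j | block S j) (centered S (w j) - mean Q (centered S))).
        rewrite sumrB sumr_const (card_block n S) -mulrA; congr (c * _).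
        rewrite mulrBr -sum_emp -[mean _ _ *+ _]mulr_natl mulKf//.
        rewrite /mean -sumrB; apply: eq_bigr => x _.
        by rewrite /dev mulrBr [Q x * _]mulrC.
      rewrite mulr_sumr; apply: eq_bigr => j /eqP jS.
      by rewrite /a jS SSS.
    rewrite [RHS](bigID (fun j => tag j \in SS))/= [X in _ = _ + X]big1 ?addr0; last first.
      by move=> j /negPf jS; rewrite /a jS.
    rewrite [RHS](partition_big (fun j : J => tag j) (fun S => S \in SS))//=.
    apply: eq_bigr => S SSS; apply: eq_bigl => j.
    by rewrite ?/block; case: (eqVneq (tag j) S) => [->|_]; rewrite ?SSS ?andbF.
  transitivity (\sum_(g | act g) b g * (((N g w + u g) %% width g)%:R - ((width g)%:R - 1) / 2)).
    rewrite sum_act -sumrN; apply: eq_bigr => S SSS.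
    rewrite mulrA -mulrN -sumrN big_seq mulr_sumr [RHS]big_seq; apply: eq_bigr => S' S'n.
    rewrite -sumrN mulr_sumr; apply: eq_bigr => z zz.
    by rewrite /b /act/= SSS inE/= S'n zz/= /remainder mulrN mulrA mulNr.
  rewrite big_mkcond; apply: eq_bigr => g _; rewrite /b.
  by case: (act g); rewrite ?mul0r.
under eq_mean do under eq_mean do rewrite E.
apply: (le_trans (mgf_dithered Qp widthM' b N (a := a) (lo := lo) (r := r) _ _)).
- move=> j; rewrite /a; case: (tag j \in SS); last exact: mean_cst.
  by rewrite meanZ meanB (mean_cst _ Qp) subrr mulr0.
- move=> j x; rewrite /lo /a /r; case: ifPn => jS; last by rewrite addr0 lexx.
  have nS0 : 0 < (n (tag j))%:R :> R by rewrite ltr0n n_gt0.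
  have : `|c / (n (tag j))%:R * centered (tag j) x| <= `|c| / (n (tag j))%:R * (s / 2).
    rewrite !normrM normfV [ `| _%:R| ]ger0_norm ?(ltW nS0)// ler_wpM2l ?centered_le//.
  rewrite ler_norml => /andP[h1 h2]; rewrite mulrBr; apply/andP; split; lra.
rewrite ler_expR ler_pM2r ?invr_gt0//.
have -> : \sum_j r j ^+ 2 = (c * s) ^+ 2 * inv_sizes.
  rewrite (sum_sqr_by_block n_gt0 (fun=> `|c| * s)) -mulr_sumr.
  by rewrite exprMn real_normK ?num_real// -exprMn.
rewrite -subr_ge0.
suff : \sum_g b g ^+ 2 * ((width g)%:R - 1) ^+ 2 <= (c * s) ^+ 2 * inv_sizes * ((s - 1) / 16).
  by set A := \sum_g _; set B := (c * s) ^+ 2 * inv_sizes; lra.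
have -> : \sum_g b g ^+ 2 * ((width g)%:R - 1) ^+ 2 =
    \sum_(g | act g) b g ^+ 2 * ((width g)%:R - 1) ^+ 2.
  rewrite [RHS]big_mkcond; apply: eq_bigr => g _; rewrite /b; case: ifP => //.
  by rewrite expr0n mul0r.
rewrite sum_act -mulrA mulrCA mulr_suml; apply: ler_sum => S SSS.
have nS0 : 0 < (n S)%:R :> R by rewrite ltr0n n_gt0.
apply: (@le_trans _ _ (\sum_(S' <- nbr S) (n S)%:R^-1 * ((c * s) ^+ 2 / 16))).
  rewrite big_seq [leRHS]big_seq; apply: ler_sum => S' S'n.
  apply: (@le_trans _ _ (\sum_(z | proj x0 (S :&: S') z == z)
      (n S)%:R^-1 * ((c * s) ^+ 2 / 16) * pf x0 (S :&: S') Q z)).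
    apply: ler_sum => z zz; rewrite /b /act/= SSS inE/= S'n zz/= sqrrN.
    have /andP[wd1 _] := width_itv x0 n Q eta_gt0 (S, (S', z)).
    have wd0 : 0 <= (width (S, (S', z)))%:R - 1 :> R.
      by rewrite subr_ge0 ler1n; case/andP: (widthM' (S, (S', z))).
    apply: (sqr_noise_le (W := 2 ^+ #|SS|.-1) (eta := eta)) => //.
    - exact: pfQ_ge0.
    - exact: ltW.
    - exact: weight_le.
    - by apply/andP; split.
  rewrite -mulr_sumr ler_piMr ?sum_pf_le1//.
  by rewrite mulr_ge0 ?invr_ge0 ?(ltW nS0)// divr_ge0// sqr_ge0.
rewrite big_const_seq count_predT iter_addr_0 -[leLHS]mulr_natr.
have sz : (size (nbr S))%:R <= s - 1 :> R.
  by rewrite -(natrB _ s_gt0) ler_nat subn1 size_nbr.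
have -> : (n S)%:R^-1 * ((c * s) ^+ 2 * ((s - 1) / 16)) =
    (n S)%:R^-1 * ((c * s) ^+ 2 / 16) * (s - 1) by rewrite -!mulrA [16^-1 * _]mulrC.
by rewrite ler_wpM2l// mulr_ge0 ?invr_ge0 ?(ltW nS0)// divr_ge0// sqr_ge0.
Qed.

End TargetPairing.

(** * The mean of the empirical index *)

Section ExpectedIndex.
Context {R : realType} {d : nat} {m : 'I_d -> nat}.
Local Notation X := (coords m [set: 'I_d]).
Variables (x0 : X) (SS : {set {set 'I_d}}) (n : {set 'I_d} -> nat).
Variables (Q : X -> R) (F : nat) (fl : 'I_F -> fun_family R m) (D : R).
Arguments fl : clear implicits.
Hypothesis Qp : pmf Q.
Hypothesis n_gt0 : forall S, S \in SS -> (0 < n S)%N.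
Local Notation s := (#|SS|%:R : R).
Hypothesis s_gt0 : (0 < #|SS|)%N.
Hypothesis D0 : 0 <= D.
Hypothesis flG : forall l, Gplus SS (fl l).
Hypothesis flb : forall l S, S \in SS -> forall x, -1 <= fl l S x <= s - 1.
Hypothesis flD : forall P, consistent SS P ->
  Rindex SS P <= D * max_Rdual_pos SS P fl.
Implicit Types (S T : {set 'I_d}) (z x : X).

Local Notation J := {S : {set 'I_d} & 'I_(n S)}.
Local Notation G := ({set 'I_d} * ({set 'I_d} * X))%type.
Local Notation P := (prodw (fun _ : J => Q)).

(** This choice makes up for the factor 2 ^ (s - 1) that cell_weight_le loses. *)
Definition dither_scale : R := (2 ^+ #|SS|)^-1.
Local Notation eta := dither_scale.
Local Notation width := (width x0 n Q eta).
Local Notation target := (target x0 SS Q eta).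

Let eta_gt0 : 0 < eta. Proof. by rewrite invr_gt0 exprn_gt0. Qed.

Let eta_small : 2 ^+ #|SS|.-1 * eta <= 2^-1.
Proof.
rewrite /dither_scale -[in leLHS](prednK s_gt0) exprS invfM mulrCA divff ?mulr1//.
Qed.

Definition dither_bound : nat := \max_g width g.
Let widthM g : (width g <= dither_bound)%N.
Proof. exact: leq_bigmax. Qed.

Local Notation PU := (prodw (fun g : G => unif (R := R) (M := dither_bound) (width g))).
Local Notation U := {ffun G -> 'I_dither_bound}.
Implicit Types (w : {ffun J -> X}) (u : U).

Let Pp : pmf P. Proof. exact: prodw_pmf. Qed.
Let PUp : pmf PU. Proof. by apply: prodw_pmf => g; apply: unif_pmf; rewrite widthM. Qed.

Definition inv_sizes : R := \sum_(S in SS) (n S)%:R^-1.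
Definition variance : R := inv_sizes * (1 + (s - 1) / 16).

Definition dual_target l u w : R :=
  - (s^-1 * pairing SS (fun S => target (fun g => u g) S w) (fl l)).

Lemma mgf_target l (th : R) : 0 < th ->
  mean PU (fun u => mean P (fun w => expR (th * dual_target l u w))) <=
  expR (th ^+ 2 * (variance / 2)).
Proof.
move=> th0.
pose V S u w : R := - (th / s) * stat x0 SS Q eta (fl l) S (fun g => u g) w.
apply: (@le_trans _ _ (mean PU (fun u => mean P (fun w => expR (\sum_(S <- enum SS)
   (V S u w - cmean P (quots x0 SS Q eta (fun g => u g) S) (V S u) w)))))).
  apply: (ler_mean PUp) => u _; apply: (ler_mean Pp) => w Pw.
  rewrite ler_expR.
  have := Rdual_target_le x0 eta Qp n_gt0 (flG l) (fun g => u g) Pw.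
  rewrite -(ler_pM2l th0) => /le_trans; apply.
  rewrite mulr_sumr le_eqVlt; apply/orP; left; apply/eqP; apply: eq_bigr => S _.
  by rewrite /V !cmeanZ; ring.
have mgfV (e : R) : e ^+ 2 = 4 -> mean PU (fun u => mean P (fun w =>
    expR (e * \sum_(S <- enum SS) V S u w))) <= expR (th ^+ 2 * (variance / 2)).
  move=> e4.
  have sn0 : s != 0 by rewrite pnatr_eq0 -lt0n.
  have := mgf_stat Qp n_gt0 eta_gt0 s_gt0 (flb l) eta_small widthM (e * - (th / s)).
  have -> : (e * - (th / s) * s) ^+ 2 * (\sum_(S in SS) (n S)%:R^-1) * (1 + (s - 1) / 16) / 8 =
      th ^+ 2 * (variance / 2).
    have -> : e * - (th / s) * s = - (e * th) by field.
    by rewrite sqrrN exprMn e4 /variance /inv_sizes; field.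
  apply: le_trans; apply: (ler_mean PUp) => u _; apply: (ler_mean Pp) => w _.
  rewrite ler_expR -mulrA le_eqVlt; apply/orP; left; apply/eqP; congr (e * _).
  exact/esym/mulr_sumr.
apply: (mgf_cmean_centered (blk := fun j : J => tag j)) => //.
- exact: enum_uniq.
- move=> S u w v wv; rewrite /V /stat; congr (_ * (_ - _)).
    apply: eq_bigr => x _; congr (_ * (_ - _)); congr (_ * _).
    by apply: eq_bigr => j /wv ->.
  congr (_ * _); apply: eq_bigr => S' _; apply: eq_bigr => z _.
  congr (_ * (_%:R - _)); rewrite /remainder; congr ((_ + _) %% _)%N.
  by apply: eq_bigr => j /wv ->.
- move=> S u w v wv; apply/ffunP => c; apply: val_inj => /=.
  rewrite !ffunE; congr (val (inord ((_ + _) %/ _)))%N.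
  by apply: eq_bigr => j /wv ->.
- by apply: mgfV; rewrite expr2; lra.
- by apply: mgfV; rewrite expr2; lra.
Qed.

Definition max_dual_target u w : R :=
  \big[Num.max/0]_(l < F) Num.max (dual_target l u w) 0.

Lemma variance_gt0 : 0 < variance.
Proof.
have s1 : 1 <= s by rewrite ler1n.
apply: mulr_gt0; last by lra.
have /card_gt0P[S SSS] := s_gt0.
rewrite /inv_sizes (bigD1 S)//= ltr_wpDr ?invr_gt0 ?ltr0n ?n_gt0//.
by apply: sumr_ge0 => S' _; rewrite invr_ge0.
Qed.

(** The exponential of a maximum is at most the sum of the exponentials; the
    summand 1 stands for the positive part. *)
Lemma mean_max_dual_target_le (L : R) : 0 <= L -> 2 * F%:R <= expR L ->
  mean PU (fun u => mean P (max_dual_target u)) <= 2 * Num.sqrt (L * (variance / 2)).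
Proof.
move=> L0 FL.
have [F0|F0] := posnP F.
  rewrite (eq_mean _ (h := fun=> 0)); last first.
    move=> u; rewrite (eq_mean _ (h := fun=> 0)) ?(mean_cst _ Pp)// => w.
    apply/le_anti; rewrite bigmax_ge_id andbT; apply: bigmax_le => // -[l lF] _.
    by exfalso; rewrite F0 in lF.
  by rewrite (mean_cst _ PUp) mulr_ge0 ?sqrtr_ge0.
apply: le_sqrt_of_chernoff => //; first by rewrite divr_gt0 ?variance_gt0.
move=> th th0; rewrite -ler_expR -meanZ; apply: (le_trans (expR_mean_le _ PUp)).
apply: (@le_trans _ _ (mean PU (fun u => mean P (fun w => 1 + \sum_l expR (th * dual_target l u w))))).
  apply: (ler_mean PUp) => u _; rewrite -meanZ; apply: (le_trans (expR_mean_le _ Pp)).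
  apply: (ler_mean Pp) => w _.
  set A := 1 + _; have A1 : 1 <= A.
    by rewrite lerDl; apply: sumr_ge0 => k _; exact: expR_ge0.
  have A0 : 0 < A by apply: lt_le_trans A1.
  have lnA0 : 0 <= ln A / th by apply: divr_ge0; [exact: ln_ge0|exact: ltW].
  suff : max_dual_target u w <= ln A / th.
    rewrite ler_pdivlMr// mulrC => H; rewrite -[leRHS](lnK (x := A)) ?ler_expR//.
  apply: bigmax_le => // l _; rewrite ge_max lnA0 andbT.
  rewrite ler_pdivlMr// mulrC -ler_expR lnK// /A (bigD1 l)//= addrCA lerDl.
  by apply: addr_ge0 => //; apply: sumr_ge0 => k _; exact: expR_ge0.
under [leLHS]eq_mean do rewrite meanD (mean_cst _ Pp) mean_sum.
rewrite meanD (mean_cst _ PUp) mean_sum.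
apply: (@le_trans _ _ (1 + \sum_(l < F) expR (th ^+ 2 * (variance / 2)))).
  by rewrite lerD2l; apply: ler_sum => l _; exact: mgf_target.
rewrite sumr_const card_ord -[_ *+ F]mulr_natl expRD.
set e := expR (th ^+ 2 * _).
have e1 : 1 <= e.
  by rewrite -expR0 ler_expR mulr_ge0 ?sqr_ge0// divr_ge0// ltW// variance_gt0.
apply: (@le_trans _ _ (2 * F%:R * e)); last by rewrite ler_pM2r ?expR_gt0.
have F1 : 1 <= F%:R :> R by rewrite ler1n.
have : 1 <= F%:R * e by rewrite -[X in X <= _]mulr1 ler_pM.
by lra.
Qed.

Definition emp_index w : R := Rindex SS (fam (fun S => empS S w)).

(** Averaging over the dither as well as over the sample does not change the
    left-hand side, which does not depend on the dither. *)
Lemma mean_emp_index_le (L : R) : 0 <= L -> 2 * F%:R <= expR L ->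
  mean P emp_index <=
  (s - 1) * (\sum_(S in SS) 2^-1 *
     (2 * Num.sqrt (#|cellT x0 SS S|%:R * (eta^-1 + 4) / (2 * (n S)%:R)) +
      2 ^+ size (nbr SS S) *
        \sum_(S' <- nbr SS S) eta * Num.sqrt (#|coords m (S :&: S')|%:R / (n S)%:R))) +
  D * (2 * Num.sqrt (L * (variance / 2))).
Proof.
move=> L0 FL; have s1 : 0 <= s - 1 by rewrite subr_ge0 ler1n.
set B := \sum_(S in SS) _.
rewrite -[leLHS](mean_cst _ PUp).
apply: (@le_trans _ _ (mean PU (fun u => (s - 1) * B + D * mean P (max_dual_target u)))); last first.
  rewrite meanD (mean_cst _ PUp) meanZ lerD2l ler_wpM2l//.
  exact: mean_max_dual_target_le.
apply: (ler_mean PUp) => u PUu.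
have u_lt g : (u g < width g)%N by exact: dither_support PUu.
apply: (@le_trans _ _ (mean P (fun w => (s - 1) * \sum_(S in SS) 2^-1 *
    (\sum_x `|corr x0 SS Q eta (fun g => u g) S w x| + 2 ^+ size (nbr SS S) *
        \sum_(S' <- nbr SS S) eta * Num.sqrt (#|coords m (S :&: S')|%:R / (n S)%:R)) +
    D * max_dual_target u w))).
  apply: (ler_mean Pp) => w Pw.
  have := @Rindex_le_signed _ _ _ _ s_gt0 x0 _ _ _ D0 flG flD (fun S => empS S w)
    (fun S => target (fun g => u g) S w).
  move=> /(_ _ _ _)/le_trans; apply.
  - by move=> S SSS; apply: emp_pmf; [exact: card_block|exact: n_gt0].
  - by move=> S SSS; exact: mass_target.
  - by move=> S1 S2 S1S S2S ne S12; exact: target_consistent.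
  rewrite lerD2r ler_wpM2l//; apply: ler_sum => S SSS.
  exact: neg_part_le.
rewrite meanD meanZ meanZ lerD2r ler_wpM2l// mean_sum; apply: ler_sum => S SSS.
rewrite meanZ ler_wpM2l// meanD (mean_cst _ Pp) lerD2r.
exact: (mean_corr_le Qp n_gt0 eta_gt0 u_lt).
Qed.

End ExpectedIndex.

(** * The size of the test *)

Lemma cube_le_exp2 j : (j ^ 3 <= 2 ^ j.+2)%N.
Proof.
have [j5|j5] := leqP j 5; first by case: j j5 => [|[|[|[|[|[|]]]]]].
rewrite -(subnKC j5); elim: (j - 6)%N => // i IH.
rewrite addnS expnS; apply: leq_trans (leq_mul (leqnn 2) IH).
by rewrite !expnS !expn0; nia.
Qed.

Lemma sqr_le_exp2 j : (j ^ 2 <= 2 ^ j.+1)%N.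
Proof.
have [j5|j5] := leqP j 2; first by case: j j5 => [|[|[|]]].
rewrite -(subnKC j5); elim: (j - 3)%N => // i IH.
rewrite addnS expnS; apply: leq_trans (leq_mul (leqnn 2) IH).
by rewrite !expnS !expn0; nia.
Qed.

Section MinSize.
Variables (d : nat) (n : {set 'I_d} -> nat) (SS : {set {set 'I_d}}).

Lemma min_size_le S : S \in SS -> (min_size n SS <= n S)%N.
Proof.
rewrite /min_size => SSS; move: (\max_(_ in _) _)%N (mem_index_enum S) => k.
elim: (index_enum _) => // S' r IH; rewrite inE big_cons => /predU1P[<-|/IH H].
  by rewrite SSS geq_minl.
by case: ifP => // _; rewrite (leq_trans (geq_minr _ _)).
Qed.

Lemma min_size_gt0 : (0 < #|SS|)%N -> (forall S, S \in SS -> (0 < n S)%N) ->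
  (0 < min_size n SS)%N.
Proof.
move=> /card_gt0P[S SSS] n0; rewrite /min_size.
apply: (big_ind (fun k => 0 < k)%N) => //; last by move=> x y x0 y0; rewrite leq_min x0.
by rewrite (leq_trans (n0 S SSS))// (bigD1 S)//= leq_maxl.
Qed.

End MinSize.

Section Size.
Context {R : realType} {d : nat} {m : 'I_d -> nat}.
Local Notation X := (coords m [set: 'I_d]).
Variables (x0 : X) (SS : {set {set 'I_d}}) (n : {set 'I_d} -> nat).
Variables (Q : X -> R) (F : nat) (fl : 'I_F -> fun_family R m) (D alpha : R).
Arguments fl : clear implicits.
Hypothesis Qp : pmf Q.
Hypothesis n_gt0 : forall S, S \in SS -> (0 < n S)%N.
Local Notation s := (#|SS|%:R : R).
Hypothesis s_gt0 : (0 < #|SS|)%N.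
Hypothesis D0 : 0 <= D.
Hypothesis flG : forall l, Gplus SS (fl l).
Hypothesis flb : forall l S, S \in SS -> forall x, -1 <= fl l S x <= s - 1.
Hypothesis flD : forall P, consistent SS P ->
  Rindex SS P <= D * max_Rdual_pos SS P fl.
Hypothesis alpha01 : 0 < alpha < 1.
Implicit Types (S T : {set 'I_d}) (z x : X).

Local Notation J := {S : {set 'I_d} & 'I_(n S)}.
Local Notation P := (prodw (fun _ : J => Q)).
Local Notation emp_index := (@emp_index R d m SS n).
Implicit Types (w : {ffun J -> X}).

Lemma empS_pmf S w : S \in SS -> pmf (empS (R := R) S w).
Proof. by move=> SSS; apply: emp_pmf; [exact: card_block|exact: n_gt0]. Qed.

Lemma emp_distributions w : distributions SS (fam (fun S => empS (R := R) S w)).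
Proof.
move=> S /empS_pmf => /(_ w)[r0 r1]; split=> [x|]; first by apply: sumr_ge0.
by rewrite mass_marginal.
Qed.

Lemma empS_upd w j t S : S != tag j -> empS (R := R) S (upd w j t) = empS S w.
Proof.
move=> Sj; apply/funext => x; rewrite /empS /emp; congr (_ * _).
apply: eq_bigr => i /eqP iS; rewrite ffunE; case: (eqVneq i j) => [ij|//].
by rewrite -iS ij eqxx in Sj.
Qed.

Lemma Rdual_emp_upd f w j t : tag j \in SS ->
  Rdual SS (fam (fun S => empS S (upd w j t))) f =
  Rdual SS (fam (fun S => empS S w)) f -
    s^-1 * (n (tag j))%:R^-1 * (f _ (rst (tag j) t) - f _ (rst (tag j) (w j))).
Proof.
move=> jS; rewrite !Rdual_fam -opprD -mulrA -mulrDr; congr (- (_ * _)).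
apply/eqP; rewrite addrC -subr_eq; apply/eqP.
rewrite /pairing -sumrB (bigD1 (tag j))//= [X in _ + X]big1 ?addr0; last first.
  by move=> S /andP[_ Sj]; rewrite empS_upd// subrr.
rewrite !(sum_emp _ _ (fun x => f _ (rst (tag j) x))) -mulrBr -sumrB; congr (_ * _).
have jb : block (tag j) j by rewrite /block eqxx.
rewrite (bigD1 j)//= [X in _ + X]big1 ?addr0; last first.
  by move=> i /andP[_ /negPf ij]; rewrite ffunE ij subrr.
by rewrite ffunE eqxx.
Qed.

Definition sensitivity (j : J) : R :=
  if (tag j \in SS) && (nbr SS (tag j) != [::]) then (n (tag j))%:R^-1 else 0.

(** One observation of S enters a dual value with the weight 1 / (s n S), and by
    Rindex_le_bounded functions with a range of length s suffice. When S meets no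
    other pattern, Rindex_isolated applies. *)
Lemma emp_index_bounded_diff : bounded_diff sensitivity emp_index.
Proof.
suff H w j t : emp_index (upd w j t) <= emp_index w + sensitivity j.
  move=> w j t; rewrite ler_norml; apply/andP; split; last by have := H w j t; lra.
  have := H (upd w j t) j (w j).
  have -> : upd (upd w j t) j (w j) = w.
    by apply/ffunP => i; rewrite !ffunE; case: eqP => [->|].
  by lra.
have dw := emp_distributions w; have du := emp_distributions (upd w j t).
have famE S : S != tag j ->
    @fam R d m (fun S => empS S (upd w j t)) S = @fam R d m (fun S => empS S w) S.
  by move=> Sj; rewrite /fam empS_upd.
rewrite /sensitivity; case: ifPn => [/andP[jS _]|]; last first.
  rewrite negb_and negbK addr0 => jS; have [jSS|jSS] := boolP (tag j \in SS); last first.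
    apply: Rindex_le => // f Gf; apply: le_trans (Rindex_ge s_gt0 dw Gf).
    rewrite /Rdual lerN2 ler_pM2l ?invr_gt0 ?ltr0n// le_eqVlt; apply/orP; left; apply/eqP.
    apply: eq_bigr => S SSS; rewrite famE//.
    by apply: contraNneq jSS => <-.
  apply: (Rindex_isolated s_gt0 jSS) => //.
  - move=> S SSS Sj; apply/eqP; apply: contraT => Sj0.
    have : S \in nbr SS (tag j) by rewrite mem_nbr SSS Sj finset.setIC Sj0.
    by move: jS; rewrite jSS/= => /eqP ->.
  - by move=> S _ Sj; exact: famE.
apply: (Rindex_le_bounded s_gt0 du) => f Gf fb.
apply: (@le_trans _ _ (Rdual SS (fam (fun S => empS S w)) f + (n (tag j))%:R^-1)); last first.
  by rewrite lerD2r Rindex_ge.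
have n0 : 0 < (n (tag j))%:R :> R by rewrite ltr0n n_gt0.
have s0 : 0 < s by rewrite ltr0n.
rewrite Rdual_emp_upd// lerD2l -mulrN mulrAC -mulrA ler_pdivrMl// ler_pM2r ?invr_gt0//.
by have := fb _ jS (rst (tag j) (w j)); have := fb _ jS (rst (tag j) t); lra.
Qed.

Hypothesis overlap : has_overlap SS.

Let s_ge2 : 2 <= s.
Proof.
have [S1 [S2 [S1S S2S ne _]]] := overlap; rewrite ler_nat.
rewrite (cardsD1 S1) S1S (cardsD1 S2) !inE S2S eq_sym ne/=.
by rewrite addnA leq_addr.
Qed.

Local Notation quotient S1 S2 := ((#|coords m (S1 :&: S2)|%:R * ln 2 +
  ln (2 * s * (s - 1) / alpha)) / (minn (n S1) (n S2))%:R).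

Definition pair_term : R := \big[Num.max/0]_(S1 in SS)
  \big[Num.max/0]_(S2 in SS | (S1 != S2) && (S1 :&: S2 != finset.set0)) quotient S1 S2.

Lemma quotient_le S1 S2 : S1 \in SS -> S2 \in SS -> S1 != S2 ->
  S1 :&: S2 != finset.set0 -> quotient S1 S2 <= pair_term.
Proof.
move=> S1S S2S ne S12; apply: (bigmax_sup S1) => //.
by apply: (bigmax_sup S2) => //; rewrite S2S ne S12.
Qed.

Let logterm : ln alpha^-1 <= ln (2 * s * (s - 1) / alpha).
Proof.
have /andP[a0 a1] := alpha01.
have h : 1 <= 2 * s * (s - 1) by have := s_ge2; nra.
rewrite ler_ln ?posrE ?invr_gt0 ?divr_gt0//; last by lra.
by rewrite -[leLHS]mul1r ler_pM2r ?invr_gt0.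
Qed.

Let lna0 : 0 < ln alpha^-1.
Proof. by have /andP[a0 a1] := alpha01; rewrite ln_gt0// invf_gt1. Qed.

Let ln2 : 2^-1 <= ln 2 :> R.
Proof.
have := @le_ln1Dx R (- 2^-1); rewrite (_ : 1 + - 2^-1 = 2^-1); last by field.
rewrite lnV ?posrE// lerN2; apply; lra.
Qed.

(** The second term of the critical value controls the number of cells as well
    as the sensitivity of the index. *)
Lemma pair_bounds S S' : S \in SS -> S' \in nbr SS S ->
  (#|coords m (S :&: S')|%:R / (n S)%:R <= 2 * pair_term) /\
  ((n S)%:R^-1 <= pair_term / ln alpha^-1).
Proof.
move=> SSS; rewrite mem_nbr => /and3P[S'S ne S0].
have nS0 : 0 < (n S)%:R :> R by rewrite ltr0n n_gt0.
have mn0 : 0 < (minn (n S) (n S'))%:R :> R by rewrite ltr0n leq_min !n_gt0.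
have mnS : (minn (n S) (n S'))%:R <= (n S)%:R :> R by rewrite ler_nat geq_minl.
have q := quotient_le SSS S'S; rewrite eq_sym ne in q.
have {q} := q isT S0.
rewrite ler_pdivrMr// => q.
have K0 : 0 <= #|coords m (S :&: S')|%:R :> R by [].
have pt0 : 0 <= pair_term by exact: bigmax_ge_id.
have q2 : #|coords m (S :&: S')|%:R * ln 2 + ln alpha^-1 <= pair_term * (n S)%:R.
  apply: le_trans (ler_wpM2l pt0 mnS); apply: le_trans q.
  by rewrite lerD2l.
have hK := ler_wpM2l K0 ln2.
split; first by rewrite ler_pdivrMr//; move: q2 hK lna0; lra.
by rewrite ler_pdivlMr// mulrC ler_pdivrMr//; move: q2 hK K0; lra.
Qed.

Lemma pair_term_gt0 : 0 < pair_term.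
Proof.
have [S1 [S2 [S1S S2S ne S12]]] := overlap.
have S2n : S2 \in nbr SS S1 by rewrite mem_nbr S2S eq_sym ne S12.
have [_ h] := pair_bounds S1S S2n.
have : 0 < pair_term / ln alpha^-1 by apply: lt_le_trans h; rewrite invr_gt0 ltr0n n_gt0.
by rewrite pmulr_lgt0// invr_gt0.
Qed.

Let U : R := Num.sqrt pair_term.
Let U0 : 0 < U. Proof. by rewrite sqrtr_gt0 pair_term_gt0. Qed.
Let U2 : U ^+ 2 = pair_term. Proof. by rewrite sqr_sqrtr// ltW// pair_term_gt0. Qed.
Let p : R := 2 ^+ #|SS|.
Let p4 : 4 <= p.
Proof.
rewrite /p -natrX ler_nat (leq_trans (_ : 4 <= 2 ^ 2)%N)// leq_exp2l//.
by rewrite -(ler_nat R).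
Qed.

Let s_pred : s - 1 = #|SS|.-1%:R.
Proof. by rewrite -(natrB _ s_gt0) subn1. Qed.

Let pE : p = 2 ^+ #|SS|.-1.+1. Proof. by rewrite /p prednK. Qed.

Let cube_le : (s - 1) ^+ 3 <= 2 * p.
Proof. by rewrite s_pred pE -exprS -!natrX ler_nat cube_le_exp2. Qed.

Let sqr_le : (s - 1) ^+ 2 <= p.
Proof. by rewrite s_pred pE -!natrX ler_nat sqr_le_exp2. Qed.

Lemma block_cost_le S : S \in SS ->
  2^-1 * (2 * Num.sqrt (#|cellT x0 SS S|%:R * ((dither_scale SS)^-1 + 4) / (2 * (n S)%:R)) +
      2 ^+ size (nbr SS S) * \sum_(S' <- nbr SS S) dither_scale SS *
        Num.sqrt (#|coords m (S :&: S')|%:R / (n S)%:R)) <=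
  U * (Num.sqrt ((s - 1) * (p + 4)) + (s - 1) / 2).
Proof.
move=> SSS; have nS0 : 0 < (n S)%:R :> R by rewrite ltr0n n_gt0.
have sz : (size (nbr SS S))%:R <= s - 1 :> R.
  by rewrite -(natrB _ s_gt0) ler_nat subn1 size_nbr.
have pt0 : 0 <= pair_term by exact/ltW/pair_term_gt0.
have p0 : 0 < p by have := p4; lra.
have eE : (dither_scale SS)^-1 = p by rewrite /dither_scale invrK.
rewrite eE [leRHS]mulrDr [leLHS]mulrDr [X in X + _ <= _]mulrA mulVf// mul1r; apply: lerD.
  rewrite /U -sqrtrM ?pair_term_gt0//; apply: ler_wsqrtr.
  have cK : #|cellT x0 SS S|%:R / (n S)%:R <= (s - 1) * (2 * pair_term).
    rewrite card_cellT mulr_suml.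
    apply: (@le_trans _ _ (\sum_(S' <- nbr SS S) 2 * pair_term)).
      by rewrite big_seq [leRHS]big_seq; apply: ler_sum => S' S'n; case: (pair_bounds SSS S'n).
    rewrite big_const_seq count_predT iter_addr_0 -[leLHS]mulr_natl ler_wpM2r//.
    by rewrite mulr_ge0.
  have -> : #|cellT x0 SS S|%:R * (p + 4) / (2 * (n S)%:R) =
      #|cellT x0 SS S|%:R / (n S)%:R * ((p + 4) / 2) by field; rewrite gt_eqF.
  have -> : pair_term * ((s - 1) * (p + 4)) = (s - 1) * (2 * pair_term) * ((p + 4) / 2) by field.
  by rewrite ler_wpM2r// divr_ge0// addr_ge0// ltW.
rewrite -mulr_sumr; set Sg := \sum_(S' <- _) _.
have ds0 : 0 <= dither_scale SS :> R by rewrite -[dither_scale _]invrK eE invr_ge0 ltW.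
have -> : 2^-1 * (2 ^+ size (nbr SS S) * (dither_scale SS * Sg)) =
  2^-1 * (2 ^+ size (nbr SS S) * dither_scale SS) * Sg by rewrite -!mulrA.
have -> : U * ((s - 1) / 2) = 2^-1 * 2^-1 * ((s - 1) * (2 * U)) by field.
apply: ler_pM.
- by rewrite mulr_ge0// mulr_ge0// exprn_ge0.
- by apply: sumr_ge0 => S' _; exact: sqrtr_ge0.
- rewrite ler_pM2l ?invr_gt0//.
  rewrite /dither_scale ler_pdivrMr// -/p pE exprS mulKf//.
  by rewrite ler_weXn2l ?ler1n// size_nbr.
apply: (@le_trans _ _ (\sum_(S' <- nbr SS S) 2 * U)).
  rewrite /Sg big_seq [leRHS]big_seq; apply: ler_sum => S' S'n.
  have [h _] := pair_bounds SSS S'n.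
  rewrite -[leRHS]ger0_norm ?mulr_ge0 ?(ltW U0)// -sqrtr_sqr ler_wsqrtr// exprMn U2.
  by apply: (le_trans h); rewrite ler_wpM2r// expr2; lra.
rewrite big_const_seq count_predT iter_addr_0 -[leLHS]mulr_natl ler_wpM2r//.
by rewrite mulr_ge0// ltW.
Qed.

Lemma cost_le : (s - 1) * (Num.sqrt ((s - 1) * (p + 4)) + (s - 1) / 2) + 2^-1 <=
  11 / 4 * p.
Proof.
have s1 : 1 <= s - 1 by have := s_ge2; lra.
have H : (s - 1) * Num.sqrt ((s - 1) * (p + 4)) <= 2 * p.
  have h0 : 0 <= (s - 1) * Num.sqrt ((s - 1) * (p + 4)).
    by rewrite mulr_ge0 ?sqrtr_ge0//; lra.
  rewrite -ler_sqr ?nnegrE//; last by have := p4; lra.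
  rewrite exprMn sqr_sqrtr; last by have := p4; nra.
  have -> : (s - 1) ^+ 2 * ((s - 1) * (p + 4)) = (s - 1) ^+ 3 * (p + 4) by ring.
  apply: (@le_trans _ _ (2 * p * (p + 4))).
    by rewrite ler_wpM2r ?cube_le//; have := p4; lra.
  by have := p4; rewrite exprMn !expr2; nra.
by have := sqr_le; have := p4; rewrite expr2; lra.
Qed.

Let L : R := ln (Num.max (2 * F%:R * s / alpha) 1).
Let nmin : R := (min_size n SS)%:R.

Let nmin0 : 0 < nmin. Proof. by rewrite ltr0n min_size_gt0. Qed.
Let L0 : 0 <= L. Proof. by rewrite ln_ge0// le_max lexx orbT. Qed.

Let FL : 2 * F%:R <= expR L.
Proof.
have /andP[a0 a1] := alpha01.
rewrite /L lnK; last by rewrite posrE lt_max ltr01 orbT.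
rewrite le_max; apply/orP; left; rewrite ler_pdivlMr//.
apply: ler_wpM2l; first by rewrite mulr_ge0.
by have := s_ge2; lra.
Qed.

Lemma dual_cost_le : D * (2 * Num.sqrt (L * (variance SS n / 2))) <=
  s * (3 / 4 * Num.sqrt (2 * D ^+ 2 * L / nmin)).
Proof.
have vb : variance (R := R) SS n <= 9 / 16 * s ^+ 2 / nmin.
  have inv_le : inv_sizes (R := R) SS n <= s / nmin.
    rewrite /inv_sizes mulr_natl -sumr_const; apply: ler_sum => S SSS.
    by rewrite lef_pV2 ?posrE// /nmin ?ltr0n ?n_gt0// ler_nat min_size_le.
  have h : 0 <= 1 + (s - 1) / 16 by have := s_ge2; lra.
  apply: (le_trans (ler_wpM2r h inv_le)).
  rewrite mulrAC ler_pM2r ?invr_gt0//.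
  by have := s_ge2; rewrite expr2; nra.
have v0 : 0 <= variance (R := R) SS n by apply/ltW/variance_gt0.
have r0 : 0 <= s * (3 / 4 * Num.sqrt (2 * D ^+ 2 * L / nmin)).
  by rewrite !mulr_ge0 ?sqrtr_ge0// divr_ge0.
have l0 : 0 <= D * (2 * Num.sqrt (L * (variance SS n / 2))) :> R.
  by rewrite !mulr_ge0 ?sqrtr_ge0.
rewrite -ler_sqr ?nnegrE//.
have A0 : 0 <= 2 * D ^+ 2 * L by rewrite !mulr_ge0// sqr_ge0.
have -> : (D * (2 * Num.sqrt (L * (variance SS n / 2)))) ^+ 2 =
    (2 * D ^+ 2 * L) * variance SS n.
  transitivity (D ^+ 2 * 4 * Num.sqrt (L * (variance SS n / 2)) ^+ 2); first by ring.
  rewrite sqr_sqrtr; first by field.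
  by apply: mulr_ge0 => //; apply: divr_ge0.
have -> : (s * (3 / 4 * Num.sqrt (2 * D ^+ 2 * L / nmin))) ^+ 2 =
    (2 * D ^+ 2 * L) * (9 / 16 * s ^+ 2 / nmin).
  transitivity (s ^+ 2 * (9 / 16) * Num.sqrt (2 * D ^+ 2 * L / nmin) ^+ 2); first by field.
  rewrite sqr_sqrtr; first by field; rewrite gt_eqF.
  by apply: divr_ge0 => //; exact: ltW.
by rewrite ler_wpM2l.
Qed.

(** The critical value is shared out: three quarters of the square root of its
    first term pay for the dual functions, one quarter of that of the second
    term pays for making the marginals consistent and for the deviation t of
    the index from its mean. *)
Lemma size_finite :
  mean P (fun w => (critical_value m n SS D F alpha <= emp_index w)%R%:R) <= alpha.
Proof.
have /andP[a0 a1] := alpha01; have Pp : pmf P by exact: prodw_pmf.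
have s0 : 0 < s by rewrite ltr0n.
pose t := U * Num.sqrt (s / 2).
pose V := s * (pair_term / ln alpha^-1).
have V0 : 0 < V by rewrite mulr_gt0// divr_gt0// pair_term_gt0.
have cV : \sum_j sensitivity j ^+ 2 <= V.
  rewrite (eq_bigr (fun j : J => (if tag j \in SS then
      (nbr SS (tag j) != [::])%:R / (n (tag j))%:R else 0) ^+ 2)); last first.
    move=> j _; rewrite /sensitivity; case: (tag j \in SS) => //=.
    by case: (nbr _ _ == _); rewrite ?mul0r ?mul1r.
  rewrite (sum_sqr_by_block n_gt0 (fun S => (nbr SS S != [::])%:R)) /V mulr_natl -sumr_const.
  apply: ler_sum => S SSS.
  have h0 : 0 <= pair_term / ln alpha^-1 by rewrite divr_ge0 ?ltW// pair_term_gt0.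
  case: (boolP (nbr SS S != [::])) => [nb|_]; last by rewrite expr0n mul0r.
  rewrite expr1n mul1r.
  have S'n : head S (nbr SS S) \in nbr SS S by rewrite -nth0 mem_nth// lt0n size_eq0.
  by case: (pair_bounds SSS S'n).
have t0 : 0 <= t by rewrite mulr_ge0 ?sqrtr_ge0// ltW.
have := mcdiarmid (fun j : J => Qp) emp_index_bounded_diff cV V0 t0.
have -> : 2 * t ^+ 2 / V = ln alpha^-1.
  rewrite /t /V exprMn U2 sqr_sqrtr ?divr_ge0 ?(ltW s0)//.
  by field; rewrite !gt_eqF// pair_term_gt0.
rewrite expRN lnK ?posrE ?invr_gt0// invrK; apply: le_trans.
have crit : mean P emp_index + t <= critical_value m n SS D F alpha.
  have m1 := mean_emp_index_le x0 Qp n_gt0 s_gt0 D0 flG flb flD L0 FL.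
  have t1 : t <= s * (U * 2^-1).
    rewrite /t mulrCA ler_pM2l// -[leRHS]ger0_norm ?divr_ge0 ?(ltW s0)// -sqrtr_sqr ler_wsqrtr//.
    by rewrite expr2; have := s_ge2; nra.
  have m2 : mean P emp_index <=
      (s - 1) * (s * (U * (Num.sqrt ((s - 1) * (p + 4)) + (s - 1) / 2))) +
      s * (3 / 4 * Num.sqrt (2 * D ^+ 2 * L / nmin)).
    apply: (le_trans m1); apply: lerD; last exact: dual_cost_le.
    rewrite ler_wpM2l//; first by have := s_ge2; lra.
    rewrite mulr_natl -sumr_const; apply: ler_sum => S SSS.
    exact: block_cost_le.
  have c := ler_wpM2l (ltW U0) cost_le.
  have sB : 11 * (p * U) <= Num.sqrt (2 ^+ (2 * #|SS| + 7) * pair_term).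
    rewrite -[leLHS]ger0_norm; last by rewrite !mulr_ge0 ?(ltW U0)//; have := p4; lra.
    rewrite -sqrtr_sqr ler_wsqrtr// -U2 !exprMn exprD mulnC exprM -/p.
    rewrite mulrA ler_wpM2r ?sqr_ge0// [leRHS]mulrC ler_wpM2r ?sqr_ge0//.
    by rewrite -!natrX ler_nat.
  rewrite /critical_value -/pair_term -/L -/nmin.
  set A := 2 * D ^+ 2 * L / nmin in m2 *; set B := _ * pair_term in sB *.
  have hA : Num.sqrt A <= Num.sqrt (Num.max A B) by rewrite ler_wsqrtr// le_max lexx.
  have hB : Num.sqrt B <= Num.sqrt (Num.max A B) by rewrite ler_wsqrtr// le_max lexx orbT.
  apply: (@le_trans _ _ (s * (3 / 4 * Num.sqrt A + 1 / 4 * Num.sqrt B))); last first.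
    by rewrite ler_pM2l//; lra.
  move: c; set r := Num.sqrt ((s - 1) * (p + 4)) in m2 *; move=> c.
  have c' := ler_wpM2l (ltW s0) c.
  apply: (le_trans (lerD m2 t1)).
  have sB' := ler_wpM2l (ltW s0) sB.
  by lra.
apply: (ler_mean Pp) => w _.
rewrite ler_nat; case: (boolP (_ <= emp_index w)) => // h.
by rewrite (le_trans crit h).
Qed.

End Size.

(** * Samples as points of a finite product space *)

Section Sampling.
Context {R : realType} {d : nat} {m : 'I_d -> nat}.
Local Notation X := (coords m [set: 'I_d]).
Variables (x0 : X) (SS : {set {set 'I_d}}) (n : {set 'I_d} -> nat).
Implicit Types (S T : {set 'I_d}) (x : X) (P : fun_family R m).
Local Notation J := {S : {set 'I_d} & 'I_(n S)}.
Local Notation emp_index := (@emp_index R d m SS n).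

(** Samples are stored as points of the whole space, with the unobserved
    coordinates frozen, so that all of them have the same type. *)
Definition lift P S x : R := \sum_(y | emb x0 y == x) P S y.

Lemma sum_lift P S (g : X -> R) :
  \sum_x g x * lift P S x = \sum_y g (emb x0 y) * P S y.
Proof.
rewrite [RHS](partition_big (@emb d m x0 S) predT)//=; apply: eq_bigr => x _.
by rewrite /lift mulr_sumr; apply: eq_bigr => y /eqP ->.
Qed.

Lemma lift_pmf P S : pmf (P S) -> pmf (lift P S).
Proof.
move=> [p0 p1]; split=> [x|]; first by apply: sumr_ge0.
by rewrite -p1 [RHS](partition_big (@emb d m x0 S) predT).
Qed.

Lemma fam_lift P S y : @fam R d m (lift P) S y = P S y.
Proof.
rewrite /fam /marginal big_mkcond/=.
rewrite (eq_bigr (fun x => (rst S x == y)%:R * lift P S x)); last first.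
  by move=> x _; rewrite -/(rst S x); case: eqP; rewrite ?mul1r ?mul0r.
rewrite sum_lift (bigD1 y)//= embK eqxx mul1r big1 ?addr0// => z /negPf zy.
by rewrite embK zy mul0r.
Qed.

Definition sample_law P (k : J) x : R :=
  if tag k \in SS then lift P (tag k) x else (x == x0)%:R.

Lemma sample_law_pmf P k : distributions SS P -> pmf (sample_law P k).
Proof.
move=> dP; rewrite /sample_law; case: (boolP (tag k \in SS)) => [/dP|_].
  exact: lift_pmf.
split=> [x|]; first exact: ler0n.
by rewrite (bigD1 x0)//= eqxx big1 ?addr0// => x /negPf ->.
Qed.

Lemma mean_map (I T : finType) (q : I -> T -> R) (h : I -> T -> T) (G : {ffun I -> T} -> R) :
  mean (prodw q) (fun w => G [ffun k => h k (w k)]) =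
  mean (prodw (fun k t => \sum_(y | h k y == t) q k y)) G.
Proof.
pose push (w : {ffun I -> T}) : {ffun I -> T} := [ffun k => h k (w k)].
rewrite /mean (partition_big push predT)//=; apply: eq_bigr => v _.
rewrite (eq_bigr (fun w => prodw q w * G v)); last by move=> w /eqP <-.
rewrite -mulr_suml; congr (_ * _); rewrite /prodw (bigA_distr_big_dep)/=.
apply: eq_bigl => w; apply/eqP/familyP => [<- k|H].
  by rewrite /push unfold_in/= !ffunE.
by apply/ffunP => k; have := H k; rewrite unfold_in/= ffunE => /eqP.
Qed.

Section Transfer.
Variables (P : fun_family R m) (disp : measure_display)
  (Omega : measurableType disp) (Pr : probability Omega R)
  (data : forall S : {set 'I_d}, 'I_(n S) -> Omega -> coords m S).
Hypothesis indep : independent_samples SS P Pr data.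

Definition embedded_data w : {ffun J -> X} :=
  [ffun k => if tag k \in SS then emb x0 (data (tagged k) w) else x0].

Let J0 : {set J} := [set k | tag k \in SS]%SET.
Let E (v : {ffun J -> X}) (k : J) : {set coords m (tag k)} :=
  [set y | emb x0 y == v k]%SET.

Let event_measurable S i (A : {set coords m S}) : S \in SS ->
  measurable [set w | data i w \in A]%classic.
Proof. by case: indep => H _ _ SSS; apply: H. Qed.

Let prob_cell v k : tag k \in SS ->
  Pr [set w | data (tagged k) w \in E v k]%classic = (sample_law P k (v k))%:E.
Proof.
move=> kS; rewrite /sample_law kS.
case: (pickP (fun y : coords m (tag k) => emb x0 y == v k)) => [y /eqP yv|none].
  have eY z : (emb x0 z == v k) = (z == y).
    by rewrite -yv (inj_eq (can_inj (@embK d m x0 (tag k)))).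
  rewrite /lift (big_pred1 y) => [|z]; last exact: eY.
  case: indep => _ H _; rewrite -(H _ (tagged k) kS); congr (Pr _); apply/seteqP; split => w /=.
    by rewrite inE eY => /eqP.
  by move=> ->; rewrite inE eY.
rewrite /lift big_pred0// [X in Pr X](_ : _ = set0) ?measure0//.
by apply/seteqP; split => w //=; rewrite inE none.
Qed.

Implicit Types v : {ffun J -> X}.

Let fiberE v : (forall k, tag k \notin SS -> v k = x0) ->
  [set w | embedded_data w = v]%classic =
  [set w | forall k, k \in J0 -> data (tagged k) w \in E v k]%classic.
Proof.
move=> v0; apply/seteqP; split => w /= H.
  by move=> k; rewrite !inE => kS; rewrite -H ffunE kS.
apply/ffunP => k; rewrite ffunE; case: ifPn => [kS|/v0 ->//].
by apply/eqP; have := H k; rewrite !inE; apply.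
Qed.

Let fiber_measurable v : measurable [set w | embedded_data w = v]%classic.
Proof.
case: (boolP [forall k, (tag k \notin SS) ==> (v k == x0)]) => [/forallP v0|].
  rewrite fiberE; last by move=> k kS; have := v0 k; rewrite kS => /eqP.
  rewrite (_ : mkset _ = \bigcap_(k in [set` J0])
      [set w | data (tagged k) w \in E v k])%classic//.
  apply: fin_bigcap_measurable => [|k]; first exact: finite_finset.
  by rewrite /= inE; apply: event_measurable.
rewrite negb_forall => /existsP[k]; rewrite negb_imply => /andP[kS vk].
rewrite (_ : mkset _ = set0)//; apply/seteqP; split => w //= H.
by move: vk; rewrite -H ffunE (negPf kS) eqxx.
Qed.

Let fiber_prob v : Pr [set w | embedded_data w = v]%classic =
  (prodw (sample_law P) v)%:E.
Proof.
case: (boolP [forall k, (tag k \notin SS) ==> (v k == x0)]) => [/forallP v0|].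
  have v0' k : tag k \notin SS -> v k = x0 by move=> kS; have := v0 k; rewrite kS => /eqP.
  rewrite fiberE//; case: indep => _ _ ->; last by move=> k; rewrite inE.
  rewrite /prodw -prodEFin [RHS](bigID (mem J0))/=.
  rewrite [X in _ = (_ * X)%E]big1 ?mule1 => [|k]; last first.
    by rewrite inE => kS; rewrite /sample_law (negPf kS) v0'// eqxx.
  apply: eq_bigr => k; rewrite inE; exact: prob_cell.
rewrite negb_forall => /existsP[k]; rewrite negb_imply => /andP[kS vk].
rewrite (_ : mkset _ = set0)%classic; last first.
  apply/seteqP; split => w //= H.
  by move: vk; rewrite -H ffunE (negPf kS) eqxx.
by rewrite measure0 /prodw (bigD1 k)//= /sample_law (negPf kS) (negPf vk) mul0r.
Qed.

(** The data take finitely many values, and their joint law is a product. *)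
Lemma prob_embedded_data (G : pred {ffun J -> X}) :
  Pr [set w | G (embedded_data w)]%classic =
  (mean (prodw (sample_law P)) (fun v => (G v)%:R))%:E.
Proof.
pose r := [seq v <- index_enum _ | G v].
have ur : uniq r by rewrite filter_uniq// index_enum_uniq.
rewrite (_ : mkset _ = \bigcup_(v in [set` r]) [set w | embedded_data w = v])%classic; last first.
  apply/seteqP; split => [w /= Gw|w [v /=]].
    by exists (embedded_data w) => //=; rewrite mem_filter Gw mem_index_enum.
  by rewrite mem_filter => /andP[Gv _] ->.
rewrite measure_fin_bigcup//; last by move=> v v' _ _ [w [/= -> ->]].
rewrite -fsbig_seq// big_filter /mean -sumEFin [RHS](bigID G)/=.
rewrite [X in _ = (_ + X)%E]big1 ?adde0; last by move=> v /negPf ->; rewrite mulr0.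
by apply: eq_bigr => v ->; rewrite mulr1; exact: fiber_prob.
Qed.

End Transfer.

Lemma eq_Rindex P P' : (forall S, S \in SS -> P S =1 P' S) ->
  Rindex SS P = Rindex SS P'.
Proof.
move=> PP'; congr sup; apply: eq_imagel => f _; congr (- (_ * _)).
by apply: eq_bigr => S SSS; apply: eq_bigr => x _; rewrite PP'.
Qed.

Lemma fam_empS (w : {ffun J -> X}) S y : @fam R d m (fun S => empS S w) S y =
  (n S)%:R^-1 * \sum_(i < n S) (rst S (w (Tagged (fun S => 'I_(n S)) i)) == y)%:R.
Proof.
rewrite /fam (marginal_pf x0) /pf.
transitivity (\sum_x (proj x0 S x == emb x0 y)%:R * empS (R := R) S w x).
  by rewrite big_mkcond; apply: eq_bigr => x _; case: eqP; rewrite ?mul1r ?mul0r.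
rewrite (sum_emp _ _ (fun x => (proj x0 S x == emb x0 y)%:R)) sum_block; congr (_ * _); apply: eq_bigr => i _.
by rewrite (rst_emb_eq x0).
Qed.

Lemma Rindex_empirical disp (Omega : measurableType disp)
    (data : forall S : {set 'I_d}, 'I_(n S) -> Omega -> coords m S) w :
  Rindex SS (empirical (fun S i => data S i w)) = emp_index (embedded_data data w).
Proof.
apply: eq_Rindex => S SSS y; rewrite /empirical fam_empS mulrC; congr (_ * _).
rewrite -sum1_card natr_sum big_mkcond/=; apply: eq_bigr => i _.
by rewrite ffunE /= SSS embK inE; case: eqP.
Qed.

(** The index reads an observation of pattern S only on S, so that it may be
    completed to a draw from a common Q on the whole space. *)
Lemma emp_index_sample_law P (Q : X -> R) (G : pred R) :
  (forall S, S \in SS -> forall y, P S y = marginal (finset.subsetT S) Q y) -> pmf Q ->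
  mean (prodw (sample_law P)) (fun w => (G (emp_index w))%:R) =
  mean (prodw (fun _ : J => Q)) (fun w => (G (emp_index w))%:R).
Proof.
move=> PQ Qp; pose h (k : J) x := if tag k \in SS then proj x0 (tag k) x else x0.
have -> : sample_law P = fun k t => \sum_(y | h k y == t) Q y.
  apply/funext => k; apply/funext => t; rewrite /sample_law /h; case: ifPn => kS.
    rewrite /lift; under eq_bigr do rewrite PQ//.
    rewrite /marginal [RHS](partition_big (rst (tag k)) (fun y => emb x0 y == t))/=.
      apply: eq_bigr => y yt; apply: eq_bigl => x.
      rewrite /rst; case: eqP => [xy|]; last by rewrite andbF.
      by rewrite -emb_rst /rst xy yt.
    by move=> x; rewrite emb_rst.
  by case: eqVneq => _; rewrite ?Qp.2 ?big_pred0.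
rewrite -mean_map; apply: eq_mean => w; congr (G _)%:R.
apply: eq_Rindex => S SSS y; rewrite !fam_empS; congr (_ * _).
apply: eq_bigr => i _; congr (_ == _)%:R.
by rewrite ffunE /h/= SSS rst_proj.
Qed.

End Sampling.

(** * Making almost consistent marginals consistent *)

Section Correction.
Context {R : realType} {d : nat} {m : 'I_d -> nat}.
Local Notation X := (coords m [set: 'I_d]).
Variable x0 : X.
Implicit Types (S T : {set 'I_d}) (mu nu : X -> R) (q : {set 'I_d} -> X -> R).

Local Notation pf := (pf x0).
Local Notation norm1 mu := (\sum_x `|mu x|).

(** Each marginal of nu on some S :&: S' is replaced by that of q S', one S'
    after the other. The projections commute and q is consistent, so the later
    replacements do not undo the earlier ones. *)
Lemma extend_consistent S (l : seq {set 'I_d}) q nu (tau : R) :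
  {in l &, forall S1 S2, pf (S1 :&: S2) (q S1) = pf (S1 :&: S2) (q S2)} ->
  {in l, forall S', \sum_x q S' x = 1} -> \sum_x nu x = 1 ->
  {in l, forall S', \sum_x `|pf (S :&: S') (q S') x - pf (S :&: S') nu x| <= tau} ->
  exists nu', [/\ \sum_x nu' x = 1,
    {in l, forall S', pf (S :&: S') nu' = pf (S :&: S') (q S')} &
    \sum_x `|nu' x - nu x| <= (2 ^+ size l - 1) * tau].
Proof.
elim: l => [|S0 l IH] qc q1 nu1 qnu.
  exists nu; split=> //; rewrite big1 => [|x _]; last by rewrite subrr normr0.
  by rewrite expr0 subrr mul0r.
have sub x : x \in l -> x \in S0 :: l by move=> xl; rewrite inE xl orbT.
have S0l : S0 \in S0 :: l by rewrite mem_head.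
case: IH => [S1 S2 /sub h1 /sub h2|S' /sub|//|S' /sub|mu [mu1 muc mud]];
  [exact: qc|exact: q1|exact: qnu|].
pose T := S :&: S0.
exists (fun x => mu x - pf T mu x + pf T (q S0) x); split.
- by rewrite big_split/= sumrB !mass_pf mu1 q1// subrr add0r.
- move=> S'; rewrite pfD pfB !pf_pf inE => /predU1P[->|S'l].
    by apply/funext => x; rewrite finset.setIid subrr add0r.
  have E U nu1' nu2' : pf (S :&: S') nu1' = pf (S :&: S') nu2' ->
      pf (U :&: (S :&: S')) nu1' = pf (U :&: (S :&: S')) nu2'.
    by rewrite -!pf_pf => ->.
  rewrite muc// [S :&: S' :&: T]finset.setIC (E T _ _ (muc _ S'l)).
  have -> : T :&: (S :&: S') = S :&: (S0 :&: S').
    by apply/setP => i; rewrite !inE; case: (i \in S) => //=; rewrite andbF.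
  rewrite -!(pf_pf x0 S (S0 :&: S')) (qc S0 S')//; last exact: sub.
  by apply/funext => x; rewrite subrK.
- apply: (@le_trans _ _ (\sum_x (`|mu x - nu x| +
      (`|pf T (q S0) x - pf T nu x| + `|pf T (fun y => mu y - nu y) x|)))).
    apply: ler_sum => x _; rewrite pfB.
    have -> : mu x - pf T mu x + pf T (q S0) x - nu x =
      mu x - nu x + ((pf T (q S0) x - pf T nu x) - (pf T mu x - pf T nu x)) by ring.
    by rewrite (le_trans (ler_normD _ _))// lerD2l ler_normB.
  rewrite !big_split/= exprS.
  have h1 := qnu S0 S0l; have h2 := pf_norm_le x0 T (fun y => mu y - nu y).
  by move: h1 h2 mud; rewrite /T; lra.
Qed.

(** Adding a set to i consistent ones moves it by at most 2 ^ i - 1 times the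
    discrepancy, to which the corrections made so far contribute. *)
Fixpoint correction_cst (j : nat) : R :=
  if j is i.+1 then 2 ^+ i * (correction_cst i + 1) else 0.

Lemma correction_cst_ge0 j : 0 <= correction_cst j.
Proof. by elim: j => //= j IH; rewrite mulr_ge0 ?exprn_ge0 ?addr_ge0. Qed.

Lemma correction_cstS j : correction_cst j <= correction_cst j.+1.
Proof.
have h : 1 <= 2 ^+ j :> R by rewrite exprn_ege1// ler1n.
by rewrite /=; have := correction_cst_ge0 j; nra.
Qed.

(** Marginals that almost agree can be made to agree exactly by a signed
    correction of the same order of magnitude. *)
Lemma correct_family (l : seq {set 'I_d}) q (tau : R) : 0 <= tau -> uniq l ->
  {in l, forall S, \sum_x q S x = 1} ->
  {in l &, forall S1 S2, S1 != S2 ->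
     \sum_x `|pf (S1 :&: S2) (q S1) x - pf (S1 :&: S2) (q S2) x| <= tau} ->
  exists mu : {set 'I_d} -> X -> R, [/\ {in l, forall S, \sum_x mu S x = 1},
    {in l &, forall S1 S2, pf (S1 :&: S2) (mu S1) = pf (S1 :&: S2) (mu S2)} &
    {in l, forall S, \sum_x `|mu S x - q S x| <= correction_cst (size l) * tau}].
Proof.
move=> tau0; elim: l => [_ _ _|S l IH /= /andP[Sl ul] q1 qc].
  by exists q.
have sub x : x \in l -> x \in S :: l by move=> xl; rewrite inE xl orbT.
have Sh : S \in S :: l by rewrite mem_head.
case: IH => // [S' /sub/q1//|S1 S2 /sub h1 /sub h2|mu [mu1 muc mud]]; first exact: qc.
set b := correction_cst (size l) in mud *.
have b0 : 0 <= b by exact: correction_cst_ge0.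
have [|nu [nu1 nuc nud]] :=
    @extend_consistent S l mu (q S) ((b + 1) * tau) muc mu1 (q1 _ Sh).
  move=> S' S'l; have SS' : S != S' by apply: contraNneq Sl => ->.
  apply: (@le_trans _ _ (\sum_x (`|pf (S :&: S') (fun y => mu S' y - q S' y) x| +
     `|pf (S :&: S') (q S) x - pf (S :&: S') (q S') x|))).
    apply: ler_sum => x _; rewrite pfB -[X in _ <= _ + X]normrN opprB.
    by apply: le_trans (ler_normD _ _); rewrite addrA subrK.
  rewrite big_split/=; have := pf_norm_le x0 (S :&: S') (fun y => mu S' y - q S' y).
  by have := mud _ S'l; have := qc _ _ Sh (sub _ S'l) SS'; lra.
have neS S' : S' \in l -> (S' == S) = false by move=> S'l; apply/negbTE; apply: contraNneq Sl => <-.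
exists (fun S' => if S' == S then nu else mu S'); split.
- by move=> S'; rewrite inE => /predU1P[->|S'l]; rewrite ?eqxx// neS// mu1.
- move=> S1 S2; rewrite !inE => /predU1P[->|S1l] /predU1P[->|S2l]; rewrite ?eqxx ?neS//.
  + by rewrite nuc.
  + by rewrite finset.setIC nuc.
  + exact: muc.
- move=> S'; rewrite inE => /predU1P[->|S'l]; rewrite ?eqxx.
    apply: (le_trans nud); rewrite -/b mulrA ler_wpM2r// ler_wpM2r ?addr_ge0//.
    by rewrite gerBl.
  rewrite neS//; apply: (le_trans (mud _ S'l)); rewrite ler_wpM2r//.
  exact: correction_cstS.
Qed.

End Correction.

(** * The power of the test *)

Definition gap_cst {R : realType} (k : nat) (D : R) : R :=
  k%:R * correction_cst k * (k%:R + D).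

Section Power.
Context {R : realType} {d : nat} {m : 'I_d -> nat}.
Local Notation X := (coords m [set: 'I_d]).
Variables (x0 : X) (SS : {set {set 'I_d}}) (n : {set 'I_d} -> nat).
Variable P : fun_family R m.
Local Notation s := (#|SS|%:R : R).
Local Notation J := {S : {set 'I_d} & 'I_(n S)}.
Local Notation emp_index := (@emp_index R d m SS n).
Implicit Types (S T : {set 'I_d}) (x z : X) (w : {ffun J -> X}) (f : fun_family R m).
Hypothesis s_gt0 : (0 < #|SS|)%N.
Hypothesis n_gt0 : forall S, S \in SS -> (0 < n S)%N.
Hypothesis dP : distributions SS P.

Let s0 : 0 < s. Proof. by rewrite ltr0n. Qed.
Let s1 : 1 <= s. Proof. by rewrite ler1n. Qed.

Lemma Rdual_lift f : Rdual SS P f = - (s^-1 * pairing SS (lift x0 P) f).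
Proof.
congr (- (_ * _)); apply: eq_bigr => S _.
rewrite (sum_lift x0 P S (fun x => f S (rst S x))).
by apply: eq_bigr => y _; rewrite embK.
Qed.

Lemma mean_Rdual_emp f :
  mean (prodw (sample_law x0 SS (n := n) P))
    (fun w => Rdual SS (fam (fun S => empS S w)) f) = Rdual SS P f.
Proof.
have lp (k : J) := sample_law_pmf x0 k dP.
rewrite Rdual_lift (eq_mean _ (h := fun w => - (s^-1 *
  \sum_(S in SS) (n S)%:R^-1 * \sum_(j | block S j) f S (rst S (w j))))); last first.
  move=> w; rewrite Rdual_fam; congr (- (_ * _)); apply: eq_bigr => S _.
  exact: (sum_emp _ _ (fun x => f _ (rst S x))).
rewrite meanN meanZ mean_sum; congr (- (_ * _)); apply: eq_bigr => S SSS.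
rewrite meanZ mean_sum (eq_bigr (fun=> \sum_x f S (rst S x) * lift x0 P S x)); last first.
  move=> j /eqP jS; rewrite (mean_coord lp j (fun x => f S (rst S x))).
  by apply: eq_bigr => x _; rewrite /sample_law jS SSS mulrC.
have nS0 : (n S)%:R != 0 :> R by rewrite pnatr_eq0 -lt0n n_gt0.
by rewrite sumr_const (card_block n S) -[X in _ * X]mulr_natl mulKf.
Qed.

(** The empirical index dominates the empirical dual value of any fixed f,
    which is a sum of independent terms. *)
Lemma power_of_dual f (a : {set 'I_d} -> R) (V c t beta : R) :
  Gplus SS f ->
  (forall S, S \in SS -> forall y y', f S y - f S y' <= a S) ->
  s^-1 ^+ 2 * (\sum_(S in SS) a S ^+ 2 / (n S)%:R) <= V -> 0 < V -> 0 <= t ->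
  expR (- (2 * t ^+ 2 / V)) <= beta -> c + t <= Rdual SS P f ->
  1 - beta <= mean (prodw (sample_law x0 SS P)) (fun w => (c <= emp_index w)%R%:R).
Proof.
move=> Gf fa aV V0 t0 tb cf.
have lp (k : J) := sample_law_pmf x0 k dP; have pp := prodw_pmf lp.
pose g w := - Rdual SS (fam (fun S => empS S w)) f.
pose b (j : J) : R := if tag j \in SS then s^-1 * a (tag j) / (n (tag j))%:R else 0.
have gb : bounded_diff b g.
  move=> w j t'; rewrite /g /b; case: ifPn => jS; last first.
    rewrite (_ : Rdual _ _ _ = Rdual SS (fam (fun S => empS S w)) f) ?subrr ?normr0//.
    congr (- (_ * _)); apply: eq_bigr => S SSS; apply: eq_bigr => y _.
    by rewrite /fam empS_upd//; apply: contraNneq jS => <-.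
  have n0 : 0 < (n (tag j))%:R :> R by rewrite ltr0n n_gt0.
  rewrite (Rdual_emp_upd _ _ _ jS) opprB -addrA subrr addr0.
  have k0 : 0 <= s^-1 / (n (tag j))%:R by rewrite divr_ge0// invr_ge0 ltW.
  rewrite normrM (ger0_norm k0) [leRHS]mulrAC ler_wpM2l// ler_norml.
  have := fa _ jS (rst _ t') (rst _ (w j)); have := fa _ jS (rst _ (w j)) (rst _ t').
  by move=> h1 h2; apply/andP; split; lra.
have bV : \sum_j b j ^+ 2 <= V.
  apply: (le_trans _ aV); rewrite (sum_sqr_by_block n_gt0 (fun S => s^-1 * a S)).
  by rewrite mulr_sumr; apply: ler_sum => S _; rewrite exprMn -mulrA.
have {}tb := le_trans (mcdiarmid lp gb bV V0 t0) tb.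
apply: le_trans (lerB (lexx 1) tb) _.
rewrite -[X in X - _](mean_cst 1 pp) -meanB; apply: (ler_mean pp) => w _.
rewrite /g meanN mean_Rdual_emp.
have [h|h] := leP c (emp_index w); first by rewrite gerBl.
rewrite subr_le0 (_ : (- _ + t <= - _) = true)//.
have : Rdual SS (fam (fun S => empS S w)) f <= emp_index w.
  by apply: Rindex_ge => //; exact: emp_distributions.
by lra.
Qed.

Definition cell_gap S1 S2 z :=
  pf x0 (S1 :&: S2) (lift x0 P S1) z - pf x0 (S1 :&: S2) (lift x0 P S2) z.

(** The two members read the same cell of a point of the whole space, so that
    they cancel in the sum that Gplus requires to be nonnegative. *)
Definition pair_test S1 S2 : fun_family R m := fun S y =>
  let positive := 0 < cell_gap S1 S2 (proj x0 (S1 :&: S2) (emb x0 y)) in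
  if S == S1 then - positive%:R else if S == S2 then positive%:R else 0.

Lemma sum_pair (a : {set 'I_d} -> R) S1 S2 : S1 \in SS -> S2 \in SS -> S1 != S2 ->
  (forall S, S != S1 -> S != S2 -> a S = 0) ->
  \sum_(S in SS) a S = a S1 + a S2.
Proof.
move=> S1S S2S ne a0; rewrite (bigD1 S1)//= (bigD1 S2)/=; last by rewrite S2S eq_sym.
by rewrite big1 ?addr0// => S /andP[/andP[_ h1] h2]; exact: a0.
Qed.

Lemma pair_test_proj S1 S2 S x : S \in [:: S1; S2] ->
  proj x0 (S1 :&: S2) (emb x0 (rst S x)) = proj x0 (S1 :&: S2) x.
Proof.
rewrite !inE => h; rewrite emb_rst proj_proj; congr (proj _ _ _).
by apply/setP => i; rewrite !inE; case/orP: h => /eqP ->; case: (i \in S1); case: (i \in S2).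
Qed.

Lemma Gplus_pair_test S1 S2 : S1 \in SS -> S2 \in SS -> S1 != S2 ->
  Gplus SS (pair_test S1 S2).
Proof.
move=> S1S S2S ne; split=> [S SSS y|x].
  rewrite /pair_test; case: eqP => _; first by rewrite lerN2 lern1 leq_b1.
  by case: eqP => _; [apply: (@le_trans _ _ 0)|]; rewrite ?oppr_le0 ?ler01.
rewrite (sum_pair S1S S2S ne); last by move=> S /negPf h1 /negPf h2; rewrite /pair_test h1 h2.
rewrite /pair_test !eqxx [S2 == S1]eq_sym (negPf ne) !pair_test_proj ?inE ?eqxx ?orbT//.
by rewrite addNr.
Qed.

(** The two marginals have equal mass, so that the cells where the first exceeds
    the second carry half of their L1 distance. *)
Lemma Rdual_pair_test S1 S2 : S1 \in SS -> S2 \in SS -> S1 != S2 ->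
  Rdual SS P (pair_test S1 S2) = (2 * s)^-1 * \sum_z `|cell_gap S1 S2 z|.
Proof.
move=> S1S S2S ne; rewrite Rdual_lift /pairing (sum_pair S1S S2S ne); last first.
  move=> S /negPf h1 /negPf h2; rewrite big1// => x _.
  by rewrite /pair_test h1 h2 mul0r.
pose g z : R := ((0 : R) < cell_gap S1 S2 z)%R%:R.
have E S : S \in [:: S1; S2] -> \sum_x (g (proj x0 (S1 :&: S2) (emb x0 (rst S x)))) * lift x0 P S x =
    \sum_z g z * pf x0 (S1 :&: S2) (lift x0 P S) z.
  move=> h; rewrite sum_pf; apply: eq_bigr => x _.
  by rewrite pair_test_proj.
have gap0 : \sum_z cell_gap S1 S2 z = 0.
  have mass S : S \in SS -> \sum_x lift x0 P S x = 1 by move=> /dP/(lift_pmf x0)[].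
  by rewrite sumrB !mass_pf !mass// subrr.
rewrite (eq_bigr (fun x => - (g (proj x0 (S1 :&: S2) (emb x0 (rst S1 x))) * lift x0 P S1 x))); last first.
  by move=> x _; rewrite /pair_test eqxx mulNr.
rewrite [X in _ + X](eq_bigr (fun x => g (proj x0 (S1 :&: S2) (emb x0 (rst S2 x))) * lift x0 P S2 x)); last first.
  by move=> x _; rewrite /pair_test [S2 == S1]eq_sym (negPf ne) eqxx.
have S1in : S1 \in [:: S1; S2] by rewrite inE eqxx.
have S2in : S2 \in [:: S1; S2] by rewrite !inE eqxx orbT.
rewrite sumrN (E S1 S1in) (E S2 S2in).
rewrite invfM mulrAC -mulrN opprD opprK -sumrB mulrC; congr (_ * _).
transitivity (2^-1 * (\sum_z `|cell_gap S1 S2 z| + \sum_z cell_gap S1 S2 z)); last first.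
  by rewrite gap0 addr0.
rewrite -big_split mulr_sumr/=.
apply: eq_bigr => z _; rewrite -mulrBr -/(cell_gap S1 S2 z) /g.
by case: ltrP => h; [rewrite gtr0_norm|rewrite ler0_norm]; rewrite //=; lra.
Qed.

Variables (F : nat) (fl : 'I_F -> fun_family R m) (D : R).
Arguments fl : clear implicits.
Hypothesis D_gt0 : 0 < D.
Hypothesis flG : forall l, Gplus SS (fl l).
Hypothesis flb : forall l S, S \in SS -> forall y, -1 <= fl l S y <= s - 1.
Hypothesis flD : forall P, consistent SS P ->
  Rindex SS P <= D * max_Rdual_pos SS P fl.

Lemma cell_gap_disjoint S1 S2 z : S1 \in SS -> S2 \in SS ->
  S1 :&: S2 = finset.set0 -> cell_gap S1 S2 z = 0.
Proof.
move=> S1S S2S S12; rewrite /cell_gap S12.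
have E S : S \in SS -> pf x0 finset.set0 (lift x0 P S) z = (x0 == z)%:R.
  move=> /dP/(lift_pmf x0)[_ m1]; rewrite -[RHS]mulr1 -[X in _ * X]m1.
  rewrite /pf big_mkcond mulr_sumr/=; apply: eq_bigr => y _.
  rewrite (_ : proj _ _ _ = x0) ?mulr_natl; first by case: eqP.
  by apply/ffunP => j; rewrite ffunE inE.
by rewrite !E ?subrr.
Qed.

(** The corrections of correct_family have L1 norm at most correction_cst * tau:
    they change each dual value by at most s times that, and up to s - 1 times
    their total negative part is lost in Rindex_le_signed. *)
Lemma Rindex_le_gaps (tau delta : R) : 0 <= tau -> 0 <= delta ->
  (forall S1 S2, S1 \in SS -> S2 \in SS -> S1 != S2 -> S1 :&: S2 != finset.set0 ->
     \sum_z `|cell_gap S1 S2 z| <= tau) ->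
  (forall l, Rdual SS P (fl l) <= delta) ->
  Rindex SS P <= gap_cst #|SS| D * tau + D * delta.
Proof.
move=> tau0 delta0 gap dual.
have lp S : S \in SS -> pmf (lift x0 P S) by move=> /dP/(lift_pmf x0).
have [|S1 S2|mu [mu1 muc mud]] := @correct_family R d m x0 (enum SS) (lift x0 P) tau tau0
    (enum_uniq _).
- by move=> S; rewrite mem_enum => /lp[].
- rewrite !mem_enum => S1S S2S ne.
  have [S12|S12] := eqVneq (S1 :&: S2) finset.set0; last exact: gap.
  by rewrite big1// => x _; rewrite -/(cell_gap S1 S2 x) cell_gap_disjoint// normr0.
have sz : size (enum SS) = #|SS| by rewrite -cardE.
have -> : Rindex SS P = Rindex SS (fam (lift x0 P)).
  by apply: eq_Rindex => S SSS y; rewrite fam_lift.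
rewrite sz in mud; set b := correction_cst _ in mud *.
have bt0 : 0 <= b * tau by rewrite mulr_ge0// correction_cst_ge0.
have := @Rindex_le_signed R d m SS s_gt0 x0 F fl D (ltW D_gt0) flG flD (lift x0 P) mu lp.
move=> /(_ _ _)/le_trans; apply.
- by move=> S SSS; rewrite mu1// mem_enum.
- by move=> S1 S2 S1S S2S _ _; rewrite muc// mem_enum.
apply: (@le_trans _ _ ((s - 1) * (s * (b * tau)) + D * (delta + s * (b * tau)))); last first.
  have h : 0 <= s * (b * tau) by rewrite mulr_ge0// ltW.
  rewrite /gap_cst -/b; have -> : s * b * (s + D) * tau = (s + D) * (s * (b * tau)) by ring.
  by nra.
apply: lerD.
  rewrite ler_wpM2l ?subr_ge0// mulr_natl -sumr_const; apply: ler_sum => S SSS.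
  have := mud S; rewrite mem_enum => /(_ SSS); apply: le_trans; apply: ler_sum => x _.
  by rewrite ge_max normr_ge0 andbT distrC ler_norm.
rewrite ler_pM2l//; apply: bigmax_le => [|l _].
  by rewrite addr_ge0// mulr_ge0// ltW.
rewrite ge_max; apply/andP; split; last by rewrite addr_ge0// mulr_ge0// ltW.
have := dual l; rewrite Rdual_lift => dl.
suff : - (s^-1 * (pairing SS mu (fl l) - pairing SS (lift x0 P) (fl l))) <= s * (b * tau).
  by rewrite mulrBr; lra.
rewrite -mulrN ler_pdivrMl// opprB.
rewrite [leRHS]mulr_natl -sumr_const -sumrB; apply: ler_sum => S SSS.
have := mud S; rewrite mem_enum => /(_ SSS) mS.
apply: (@le_trans _ _ (\sum_x s * `|mu S x - lift x0 P S x|)); last first.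
  by rewrite -mulr_sumr ler_pM2l.
rewrite -sumrB; apply: ler_sum => x _; rewrite -mulrBr distrC.
apply: (le_trans (ler_norm _)); rewrite normrM ler_wpM2r// ler_norml.
have /andP[h1 h2] := flb l SSS (rst S x); apply/andP; split.
  by apply: le_trans h1; rewrite lerN2.
by apply: (le_trans h2); rewrite gerBl.
Qed.

End Power.

(** The first two summands serve power_of_listed, the last one power_of_pair. *)
Definition power_cst {R : realType} (k : nat) (D : R) : R :=
  3 * D + 3 + 6 * k%:R * gap_cst k D.

Lemma gap_cst_gt0 {R : realType} k (D : R) : (0 < k)%N -> 0 < D -> 0 < gap_cst k D.
Proof.
move=> k0 D0; have c0 : 0 < correction_cst k :> R.
  case: k k0 => // k _ /=.
  by rewrite mulr_gt0 ?exprn_gt0// ltr_wpDl// correction_cst_ge0.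
by rewrite /gap_cst !mulr_gt0 ?ltr0n// ltr_wpDl.
Qed.

Lemma power_cst_gt0 {R : realType} k (D : R) : (0 < k)%N -> 0 < D -> 0 < power_cst k D.
Proof.
move=> k0 D0; have kg : 0 < k%:R * gap_cst k D by rewrite mulr_gt0 ?ltr0n ?gap_cst_gt0.
by rewrite /power_cst -mulrA; lra.
Qed.

Section CriticalValue.
Context {R : realType} {d : nat} {m : 'I_d -> nat}.
Variables (SS : {set {set 'I_d}}) (n : {set 'I_d} -> nat) (D : R) (F : nat) (beta : R).
Local Notation s := (#|SS|%:R : R).
Local Notation C := (critical_value m n SS D F beta).
Hypothesis s_gt0 : (0 < #|SS|)%N.
Hypothesis beta01 : 0 < beta < 1.

Lemma critical_value_ge0 : 0 <= C.
Proof. by rewrite mulr_ge0 ?sqrtr_ge0. Qed.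

Lemma critical_value_dual : s ^+ 2 * (2 * D ^+ 2 *
  ln (Num.max (2 * F%:R * s / beta) 1) / (min_size n SS)%:R) <= C ^+ 2.
Proof.
rewrite /critical_value exprMn ler_wpM2l ?sqr_ge0//; set A := _ / (min_size n SS)%:R.
have A0 : 0 <= A.
  have L0 : 0 <= ln (Num.max (2 * F%:R * s / beta) 1).
    by rewrite ln_ge0// le_max lexx orbT.
  by rewrite /A divr_ge0// mulr_ge0// mulr_ge0// sqr_ge0.
by rewrite sqr_sqrtr ?le_max ?A0 ?lexx.
Qed.

Lemma critical_value_pair :
  s ^+ 2 * @pair_term R d m SS n beta <= C ^+ 2.
Proof.
have pt0 : 0 <= @pair_term R d m SS n beta by exact: bigmax_ge_id.
rewrite /critical_value exprMn ler_wpM2l ?sqr_ge0// -/(@pair_term R d m SS n beta).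
have e1 : 1 <= 2 ^+ (2 * #|SS| + 7) :> R by rewrite exprn_ege1// ler1n.
set B := _ * @pair_term R d m SS n beta.
have B0 : @pair_term R d m SS n beta <= B by rewrite ler_peMl.
rewrite sqr_sqrtr; first by apply: (le_trans B0); rewrite le_max lexx orbT.
by rewrite le_max (le_trans pt0 B0) orbT.
Qed.

Lemma ln_dual_ge : (0 < F)%N ->
  ln beta^-1 <= ln (Num.max (2 * F%:R * s / beta) 1).
Proof.
move=> F0; have /andP[b0 b1] := beta01.
rewrite ler_ln ?posrE ?invr_gt0// ?lt_max ?ltr01 ?orbT// le_max; apply/orP; left.
rewrite -[leLHS]mul1r ler_pM2r ?invr_gt0//.
have h1 : 1 <= F%:R :> R by rewrite ler1n.
have h2 : 1 <= s by rewrite ler1n.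
by nra.
Qed.

Lemma ln_inv_gt0 : 0 < ln beta^-1.
Proof. by have /andP[b0 b1] := beta01; rewrite ln_gt0// invf_gt1. Qed.

Lemma expRN_le t : ln beta^-1 <= t -> expR (- t) <= beta.
Proof.
have /andP[b0 _] := beta01; move=> h.
by rewrite expRN -[leRHS]invrK lef_pV2 ?posrE ?expR_gt0 ?invr_gt0//
  -[leLHS]lnK ?posrE ?invr_gt0// ler_expR.
Qed.

End CriticalValue.

Section PowerBound.
Context {R : realType} {d : nat} {m : 'I_d -> nat}.
Local Notation X := (coords m [set: 'I_d]).
Variables (x0 : X) (SS : {set {set 'I_d}}) (n : {set 'I_d} -> nat).
Variables (F : nat) (fl : 'I_F -> fun_family R m) (D alpha beta : R).
Variable P : fun_family R m.
Local Notation s := (#|SS|%:R : R).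
Local Notation emp_index := (@emp_index R d m SS n).
Implicit Types (S : {set 'I_d}).
Arguments fl : clear implicits.
Hypothesis s_gt0 : (0 < #|SS|)%N.
Hypothesis n_gt0 : forall S, S \in SS -> (0 < n S)%N.
Hypothesis dP : distributions SS P.
Hypothesis D_gt0 : 0 < D.
Hypothesis flG : forall l, Gplus SS (fl l).
Hypothesis flb : forall l S, S \in SS -> forall y, -1 <= fl l S y <= s - 1.
Hypothesis flD : forall P, consistent SS P ->
  Rindex SS P <= D * max_Rdual_pos SS P fl.
Hypothesis beta01 : 0 < beta < 1.

Let s0 : 0 < s. Proof. by rewrite ltr0n. Qed.
Let s1 : 1 <= s. Proof. by rewrite ler1n. Qed.

Local Notation power c := (mean (prodw (sample_law x0 SS (n := n) P))
  (fun w => (c <= emp_index w)%R%:R)).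
Local Notation Cb := (critical_value m n SS D F beta).

Lemma power_of_listed (l : 'I_F) (c : R) : c + Cb / D <= Rdual SS P (fl l) ->
  1 - beta <= power c.
Proof.
have nm0 : 0 < (min_size n SS)%:R :> R by rewrite ltr0n min_size_gt0.
have F0 : (0 < F)%N by case: (F) l => [[]|].
have C0 : 0 <= Cb by exact: critical_value_ge0.
move=> cf; apply: (@power_of_dual R d m x0 SS n P s_gt0 n_gt0 dP (fl l) (fun=> s)
  (s / (min_size n SS)%:R) c (Cb / D) beta (flG l) _ _ _ _ _ cf).
- move=> S SSS y y'; have /andP[_ h1] := flb l SSS y; have /andP[h2 _] := flb l SSS y'.
  by apply: (le_trans (lerB h1 h2)); rewrite opprK subrK.
- rewrite -mulr_sumr mulrA -exprMn mulVf ?gt_eqF// expr1n mul1r mulr_natl -sumr_const.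
  by apply: ler_sum => S SSS; rewrite lef_pV2 ?posrE ?ltr0n ?n_gt0 ?min_size_gt0// ler_nat min_size_le.
- by rewrite divr_gt0.
- by rewrite divr_ge0// ltW.
apply: expRN_le => //; apply: (le_trans (ln_dual_ge s_gt0 beta01 F0)).
set L := ln _; have L0 : 0 <= L by rewrite ln_ge0// le_max lexx orbT.
have := @critical_value_dual R d m SS n D F beta; rewrite -/L => h.
have Dn : D != 0 by rewrite gt_eqF.
set nm : R := (min_size n SS)%:R in nm0 h *.
have -> : 2 * (Cb / D) ^+ 2 / (s / nm) = Cb ^+ 2 * (2 * nm / (D ^+ 2 * s)).
  by field; rewrite Dn !gt_eqF.
have k0 : 0 <= 2 * nm / (D ^+ 2 * s) by rewrite divr_ge0 ?mulr_ge0 ?sqr_ge0 ?ltW.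
apply: le_trans (ler_wpM2r k0 h).
have -> : s ^+ 2 * (2 * D ^+ 2 * L / nm) * (2 * nm / (D ^+ 2 * s)) = 4 * s * L.
  by field; rewrite Dn !gt_eqF.
by rewrite ler_peMl//; have := s1; lra.
Qed.

Lemma power_of_pair S1 S2 (c : R) : S1 \in SS -> S2 \in SS -> S1 != S2 ->
  S1 :&: S2 != finset.set0 ->
  c + Cb <= (2 * s)^-1 * \sum_z `|cell_gap x0 P S1 S2 z| ->
  1 - beta <= power c.
Proof.
move=> S1S S2S ne S12 h.
have ov : has_overlap SS by exists S1, S2.
have C0 : 0 <= Cb by exact: critical_value_ge0.
have ln0 := ln_inv_gt0 beta01.
pose p := @pair_term R d m SS n beta.
have pt0 : 0 < p by exact: pair_term_gt0.
have n2 : S2 \in nbr SS S1 by rewrite mem_nbr S2S S12 eq_sym ne.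
have n1 : S1 \in nbr SS S2 by rewrite mem_nbr S1S ne finset.setIC S12.
have [_ b1] := @pair_bounds R d m SS n beta n_gt0 beta01 ov S1 S2 S1S n2.
have [_ b2] := @pair_bounds R d m SS n beta n_gt0 beta01 ov S2 S1 S2S n1.
rewrite -/p in b1 b2; set r := p / _ in b1 b2; have r0 : 0 < r by rewrite divr_gt0.
apply: (@power_of_dual R d m x0 SS n P s_gt0 n_gt0 dP _
  (fun S => (S \in [:: S1; S2])%:R) (s^-1 ^+ 2 * (2 * r)) c Cb beta
  (Gplus_pair_test x0 P S1S S2S ne) _ _ _ C0).
- move=> S SSS y y'; rewrite /pair_test !inE.
  by case: (S == S1); [|case: (S == S2)] => /=; do ?case: (0 < _) => /=; lra.
- rewrite ler_pM2l ?exprn_gt0 ?invr_gt0// (sum_pair S1S S2S ne) => [|S /negPf h1 /negPf h2].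
    by rewrite !inE !eqxx orbT !expr1n; lra.
  by rewrite !inE h1 h2 expr0n mul0r.
- by rewrite !mulr_gt0// invr_gt0.
- apply: expRN_le => //.
  have := @critical_value_pair R d m SS n D F beta => h1; rewrite -/p in h1.
  have -> : 2 * Cb ^+ 2 / (s^-1 ^+ 2 * (2 * r)) = Cb ^+ 2 * (s ^+ 2 * ln beta^-1 / p).
    by rewrite /r; field; rewrite !gt_eqF.
  have k0 : 0 <= s ^+ 2 * ln beta^-1 / p by rewrite divr_ge0 ?mulr_ge0 ?sqr_ge0// ltW.
  apply: le_trans (ler_wpM2r k0 h1).
  have -> : s ^+ 2 * p * (s ^+ 2 * ln beta^-1 / p) = (s ^+ 2) ^+ 2 * ln beta^-1.
    by field; rewrite gt_eqF.
  by rewrite ler_peMl ?(ltW ln0)// !exprn_ege1.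
- by rewrite Rdual_pair_test.
Qed.

Local Notation Ca := (critical_value m n SS D F alpha).

(** If neither a listed function nor a pair of marginals accounted for a third
    of the index, Rindex_le_gaps would bound the index by two thirds of itself. *)
Lemma power_finite : power_cst #|SS| D * (Ca + Cb) <= Rindex SS P ->
  1 - beta <= power Ca.
Proof.
move=> H; have /andP[b0 b1] := beta01.
have Ca0 : 0 <= Ca by exact: critical_value_ge0.
have Cb0 : 0 <= Cb by exact: critical_value_ge0.
have R0 := Rindex_ge0 s_gt0 dP; have G0 := gap_cst_gt0 s_gt0 D_gt0.
have pp : pmf (prodw (sample_law x0 SS (n := n) P)).
  by apply: prodw_pmf => k; exact: sample_law_pmf.
move: R0; rewrite le_eqVlt => /predU1P[R0|R0].
  have Ca00 : Ca = 0.
    apply/eqP; rewrite eq_le Ca0 andbT; move: H; rewrite -R0.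
    by rewrite pmulr_rle0 ?power_cst_gt0//; lra.
  rewrite (eq_mean _ (h := fun=> 1)) ?mean_cst//; first by lra.
  by move=> w; rewrite Ca00 (Rindex_ge0 s_gt0) //; exact: emp_distributions.
have HD : 3 * (D + 1) * (Ca + Cb) <= Rindex SS P.
  apply: le_trans H; rewrite ler_wpM2r ?addr_ge0// /power_cst.
  by have := mulr_gt0 s0 G0; rewrite -mulrA; lra.
have HG : 6 * s * gap_cst #|SS| D * (Ca + Cb) <= Rindex SS P.
  by apply: le_trans H; rewrite ler_wpM2r ?addr_ge0// /power_cst; have := D_gt0; lra.
have [/existsP[l lR]|] := boolP [exists l, Rindex SS P / (3 * D) < Rdual SS P (fl l)].
  apply: (@power_of_listed l); apply: le_trans _ (ltW lR).
  rewrite ler_pdivlMr ?mulr_gt0//; apply: le_trans HD.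
  have -> : (Ca + Cb / D) * (3 * D) = 3 * (D * Ca + Cb) by field; rewrite gt_eqF.
  by have := mulr_ge0 (ltW D_gt0) Cb0; lra.
rewrite negb_exists => /forallP dual.
pose bad (p : {set 'I_d} * {set 'I_d}) := [&& p.1 \in SS, p.2 \in SS, p.1 != p.2,
  p.1 :&: p.2 != finset.set0 &
  Rindex SS P / (3 * gap_cst #|SS| D) < \sum_z `|cell_gap x0 P p.1 p.2 z| ].
have [/existsP[[S1 S2] /and5P[/= S1S S2S ne S12 h]]|] := boolP [exists p, bad p].
  apply: (power_of_pair S1S S2S ne S12); rewrite ler_pdivlMl ?mulr_gt0//.
  apply: le_trans _ (ltW h); rewrite ler_pdivlMr ?(mulr_gt0 _ G0)//; apply: le_trans HG.
  by rewrite le_eqVlt; apply/orP; left; apply/eqP; ring.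
rewrite negb_exists => /forallP gap.
have := @Rindex_le_gaps R d m x0 SS P s_gt0 dP F fl D D_gt0 flG flb flD
  (Rindex SS P / (3 * gap_cst #|SS| D)) (Rindex SS P / (3 * D)).
have -> : gap_cst #|SS| D * (Rindex SS P / (3 * gap_cst #|SS| D)) +
    D * (Rindex SS P / (3 * D)) = Rindex SS P * (2 / 3).
  by field; rewrite !gt_eqF.
move=> h; suff : Rindex SS P <= Rindex SS P * (2 / 3) by lra.
apply: h => [||S1 S2 S1S S2S ne S12|l]; [| | |by rewrite leNgt dual].
- by rewrite divr_ge0 ?(ltW R0)// mulr_ge0// ltW.
- by rewrite divr_ge0 ?(ltW R0)// mulr_ge0// ltW.
- by have := gap (S1, S2); rewrite /bad /= S1S S2S ne S12 /= leNgt.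
Qed.

End PowerBound.

(** * Disjoint patterns *)

Section Disjoint.
Context {R : realType} {d : nat} {m : 'I_d -> nat}.
Local Notation X := (coords m [set: 'I_d]).
Variables (x0 : X) (SS : {set {set 'I_d}}).
Implicit Types (S : {set 'I_d}) (P : fun_family R m).
Hypothesis s_gt0 : (0 < #|SS|)%N.

(** Disjoint marginals are always compatible: each distribution in turn may be
    replaced by a point mass. *)
Lemma Rindex_no_overlap P : ~ has_overlap SS -> distributions SS P ->
  Rindex SS P <= 0.
Proof.
move=> nov dP.
pose P0 : fun_family R m := fun S y => (y == rst S x0)%:R.
have dP0 : distributions SS P0.
  move=> S _; split=> [y|]; first exact: ler0n.
  by rewrite (bigD1 (rst S x0))//= /P0 eqxx big1 ?addr0// => y /negPf ->.
have R0 : Rindex SS P0 <= 0.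
  apply: Rindex_le => f [_ f2]; rewrite oppr_le0 mulr_ge0 ?invr_ge0//.
  rewrite (eq_bigr (fun S => f S (rst S x0))) ?f2// => S _.
  rewrite (bigD1 (rst S x0))//= /P0 eqxx mulr1 big1 ?addr0// => y /negPf ->.
  by rewrite mulr0.
pose P_ (l : seq {set 'I_d}) : fun_family R m := fun S => if S \in l then P0 S else P S.
have dP_ l : distributions SS (P_ l).
  by move=> S SSS; rewrite /P_; case: (S \in l); [exact: dP0|exact: dP].
have H l : {subset l <= SS} -> Rindex SS P <= Rindex SS (P_ l).
  elim: l => [_|S0 l IH sub]; first by rewrite (eq_Rindex (P' := P_ [::])).
  have S0S : S0 \in SS by apply: sub; rewrite mem_head.
  have {}IH : Rindex SS P <= Rindex SS (P_ l).
    by apply: IH => S Sl; apply: sub; rewrite inE Sl orbT.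
  apply: (le_trans IH); apply: (Rindex_isolated s_gt0 S0S) => //.
    move=> S SSS ne; apply/eqP; apply: contra_notT nov => h.
    by exists S, S0.
  by move=> S _ /negPf ne; rewrite /P_ inE ne.
apply: le_trans R0; apply: (le_trans (H (enum SS) _)) => [S|]; first by rewrite mem_enum.
by rewrite (eq_Rindex (P' := P0))// => S SSS y; rewrite /P_ mem_enum SSS.
Qed.

Lemma critical_value_gt0 (n : {set 'I_d} -> nat) (D : R) F alpha : 0 < D -> (0 < F)%N ->
  (forall S, S \in SS -> (0 < n S)%N) -> 0 < alpha < 1 ->
  0 < critical_value m n SS D F alpha.
Proof.
move=> D0 F0 n0 a01; rewrite lt_neqAle critical_value_ge0 andbT eq_sym.
rewrite -sqrf_eq0 gt_eqF//; apply: lt_le_trans (@critical_value_dual R d m SS n D F alpha).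
rewrite mulr_gt0 ?exprn_gt0 ?ltr0n// divr_gt0 ?ltr0n ?min_size_gt0// !mulr_gt0 ?exprn_gt0//.
exact: lt_le_trans (ln_inv_gt0 a01) (ln_dual_ge s_gt0 a01 F0).
Qed.

End Disjoint.

(** * Size and power *)

Theorem theorem6 (R : realType) (s : nat) (DR : R) (s_gt0 : (0 < s)%N)
    (DR_gt0 : 0 < DR) :
  exists2 M : R, 0 < M &
    forall (d : nat) (m : 'I_d -> nat) (SS : {set {set 'I_d}})
      (F : nat) (f : 'I_F -> fun_family R m) (n : {set 'I_d} -> nat)
      (alpha beta : R),
    (0 < d)%N ->
    (forall j, (0 < m j)%N) ->
    #|SS| = s ->
    (forall S, S \in SS -> (0 < n S)%N) ->
    (forall l, Gplus SS (f l)) ->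
    (forall l S, S \in SS -> forall x, -1 <= f l S x <= #|SS|%:R - 1) ->
    (forall P : fun_family R m, consistent SS P ->
       max_Rdual_pos SS P f <= Rindex SS P <= DR * max_Rdual_pos SS P f) ->
    0 < alpha < 1 ->
    0 < beta < 1 ->
    forall (P : fun_family R m) (disp : measure_display)
      (Omega : measurableType disp) (Pr : probability Omega R)
      (X : forall S : {set 'I_d}, 'I_(n S) -> Omega -> coords m S),
    distributions SS P ->
    independent_samples SS P Pr X ->
    let Calpha := critical_value m n SS DR F alpha in
    let Cbeta := critical_value m n SS DR F beta in
    let rejection :=
      [set w | Calpha <= Rindex SS (empirical (fun S i => X S i w))]%classic in
    (* Calpha = 0 when F = 0 and no two distinct members of SS intersect; the
       rejection event is then certain and the size bound below fails. *)
    ((0 < F)%N \/ has_overlap SS -> compatible SS P ->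
       (Pr rejection <= alpha%:E)%E) /\
    (M * (Calpha + Cbeta) <= Rindex SS P ->
       ((1 - beta)%:E <= Pr rejection)%E).
Proof.
exists (power_cst s DR); first exact: power_cst_gt0.
move=> d m SS F f n alpha beta d0 m0 cardSS n0 fG fb fD a01 b01 P disp Omega Pr X dP indep.
move=> Calpha Cbeta rejection.
have SS0 : (0 < #|SS|)%N by rewrite cardSS.
have fD' P' : consistent SS P' -> Rindex SS P' <= DR * max_Rdual_pos SS P' f.
  by move=> /fD/andP[].
pose x0 : coords m [set: 'I_d]%SET := [ffun j => Ordinal (m0 (val j))].
have rejE : Pr rejection = (mean (prodw (sample_law x0 SS (n := n) P))
    (fun w => (Calpha <= emp_index SS w)%R%:R))%:E.
  apply: etrans (prob_embedded_data x0 indep (fun w => Calpha <= emp_index SS w)).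
  by congr (Pr _); apply/seteqP; split => w /=; rewrite /rejection/= (Rindex_empirical x0).
rewrite rejE !lee_fin; split => [nontrivial [_ [Q Qp PQ]]|H]; last first.
  by apply: (power_finite x0 SS0 n0 dP DR_gt0 fG fb fD' (alpha := alpha) b01); rewrite cardSS.
have [overlap|disjoint] := pselect (has_overlap SS).
  rewrite (emp_index_sample_law x0 n (fun r => Calpha <= r) PQ Qp).
  exact: (size_finite x0 Qp n0 SS0 (ltW DR_gt0) fG fb fD' a01 overlap).
have F0 : (0 < F)%N by case: nontrivial.
have C0 : 0 < Calpha by exact: critical_value_gt0.
rewrite (eq_mean _ (h := fun=> 0)); last first.
  move=> w; rewrite leNgt (le_lt_trans _ C0)//.
  by apply: (Rindex_no_overlap x0 SS0 disjoint); exact: emp_distributions.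
rewrite mean_cst; first by case/andP: a01 => /ltW.
by apply: prodw_pmf => k; exact: sample_law_pmf.
Qed.
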